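(* For every $\alpha>0$, the operator $\mathbf A_\alpha$ is self-adjoint in $\mathfrak H=\ell^2(\mathbb N_0,L^2(\mathbb R))$ and coincides with the closure of $\mathbf A_\alpha^0$.
   Context: $\mathbb N_0=\{0,1,2,\dots\}$. Elements of $\mathfrak H=\ell^2(\mathbb N_0,L^2(\mathbb R))$ are written $U\sim\{u_n\}_{n\in\mathbb N_0}$. Let $\mathcal W(\mathbb R)=\{u\in C(\mathbb R): u|_{\mathbb R_\pm}\in H^2(\mathbb R_\pm)\}$ ($H^2$ the Sobolev space), and $(Lu)(x)=-u''(x)+u(x)/2$ for $x\neq0$. For $\alpha>0$ put $\mu=\sqrt2/\alpha$. Let $\mathcal D_\alpha\subset\mathfrak H$ be the set of all $U\sim\{u_n\}\in\mathfrak H$ such that $u_n\in\mathcal W(\mathbb R)$ for each $n$, the matching conditions $$\mu\bigl(u_n'(0+)-u_n'(0-)\bigr)=\sqrt{n+1}\,u_{n+1}(0)+\sqrt n\,u_{n-1}(0),\qquad n\in\mathbb N_0,$$ hold (the last term being absent for $n=0$), and $\sum_{n\in\mathbb N_0}\|(L+n)u_n\|^2_{L^2(\mathbb R)}<\infty$. Let $\mathcal D_\alpha^0$ be the subset of all $U\in\mathcal D_\alpha$ having only finitely many non-zero components. Define $\mathbf A_\alpha U\sim\{(L+n)u_n\}$ with domain $\mathcal D_\alpha$, and let $\mathbf A_\alpha^0$ be the restriction of $\mathbf A_\alpha$ to $\mathcal D_\alpha^0$. *)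

(* Defs.v *)
From HB Require Import structures.
From mathcomp Require Import all_boot all_order all_algebra.
From mathcomp Require Import complex.
From mathcomp Require Import all_classical all_reals all_analysis.
Set Implicit Arguments.
Unset Strict Implicit.
Unset Printing Implicit Defensive.
Import Order.TTheory GRing.Theory Num.Theory.
Import numFieldNormedType.Exports.

Local Open Scope classical_set_scope.
Local Open Scope ring_scope.
Local Open Scope complex_scope.

(** ** Complex-valued functions on the line

    Functions take values in [R[i]]; measurability, integrals, derivatives
    and limits are taken componentwise. *)

Section ComplexFunctions.
Context {R : realType}.
Local Notation mu := (@lebesgue_measure R).
Implicit Types (I : set R) (u g : R -> R[i]).

Definition re_fun u (x : R) : R := complex.Re (u x).
Definition im_fun u (x : R) : R := complex.Im (u x).

Definition cintegral I u : R[i] :=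
  (\int[mu]_(x in I) re_fun u x) +i* (\int[mu]_(x in I) im_fun u x).

(** Squared [L^2(I)] norm, possibly [+oo]. *)
Definition sqnormL2 I u : \bar R :=
  (\int[mu]_(x in I) (re_fun u x ^+ 2 + im_fun u x ^+ 2)%:E)%E.

Definition inL2 I u : Prop :=
  [/\ measurable_fun I (re_fun u), measurable_fun I (im_fun u)
    & (sqnormL2 I u < +oo)%E].

Definition ccontinuous u : Prop :=
  continuous (re_fun u) /\ continuous (im_fun u).

(** ** Sobolev spaces on an open subset [I] of the line *)

(** Real test functions, which suffice by linearity. *)
Definition test_function I (phi : R -> R) : Prop :=
  [/\ forall (n : nat) (x : R), derivable (derive1n n phi) x 1,
      compact (closure [set x | phi x != 0])
    & closure [set x | phi x != 0] `<=` I].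

Definition is_weak_deriv I u g : Prop :=
  forall phi : R -> R, test_function I phi ->
    cintegral I (fun x => u x * (derive1 phi x)%:C) =
    - cintegral I (fun x => g x * (phi x)%:C).

Definition inH1 I u : Prop :=
  inL2 I u /\ exists2 g, inL2 I g & is_weak_deriv I u g.

(** A representative on [I] of the weak derivative, unique up to null sets;
    the zero function when [u] has no weak derivative in [L^2(I)]. *)
Definition weak_deriv I u : R -> R[i] :=
  xget (fun=> 0) [set g | inL2 I g /\ is_weak_deriv I u g].

Definition inH2 I u : Prop := inH1 I u /\ inH1 I (weak_deriv I u).

Definition half_pos : set R := [set x | 0 < x].
Definition half_neg : set R := [set x | x < 0].

Definition inW u : Prop :=
  [/\ ccontinuous u, inH2 half_pos u & inH2 half_neg u].

(** The one-sided limits of [u'] at [0].  A continuous [u] whose restriction to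
    a half-line lies in [H^2] is [C^1] there, its classical derivative being
    the continuous representative of the weak one, and that derivative has a
    limit at [0]. *)
Definition deriv0p u : R[i] :=
  lim (derive1 (re_fun u) @ 0^'+) +i*
  lim (derive1 (im_fun u) @ 0^'+).
Definition deriv0m u : R[i] :=
  lim (derive1 (re_fun u) @ 0^'-) +i*
  lim (derive1 (im_fun u) @ 0^'-).

(** [u''] away from [0]; the value at [0] is irrelevant. *)
Definition deriv2 u (x : R) : R[i] :=
  if 0 < x then weak_deriv half_pos (weak_deriv half_pos u) x
  else weak_deriv half_neg (weak_deriv half_neg u) x.

Definition opL u (x : R) : R[i] := - deriv2 u x + u x / 2%:R.

End ComplexFunctions.

(** ** The Hilbert space [l^2(N, L^2(R))]

    Elements are represented by sequences of functions, two of which represent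
    the same element when they are componentwise equal almost everywhere
    ([eqH]). *)

Section HilbertSpace.
Context {R : realType}.
Local Notation mu := (@lebesgue_measure R).
Implicit Types U V : nat -> R -> R[i].

Definition sqnormH U : \bar R := (\sum_(0 <= n <oo) sqnormL2 setT (U n))%E.

Definition inH U : Prop :=
  (forall n, inL2 setT (U n)) /\ (sqnormH U < +oo)%E.

Definition eqH U V : Prop := forall n, {ae mu, forall x, U n x = V n x}.

Definition subH U V : nat -> R -> R[i] := fun n x => U n x - V n x.

(** Linear in the first argument. *)
Definition dotH U V : R[i] :=
  let c n := cintegral setT (fun x => U n x * conjc (V n x)) in
  limn (series (fun n => complex.Re (c n))) +i*
  limn (series (fun n => complex.Im (c n))).

(** ** Unbounded operators

    An operator is given by its graph, a set of pairs of elements of [inH].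
    All graphs below contain, with a pair, every pair in [inH] that is
    componentwise [eqH] to it, so that equality of graphs as sets is equality
    of operators on the space of classes. *)

Definition opgraph := set ((nat -> R -> R[i]) * (nat -> R -> R[i])).
Implicit Types A : opgraph.

Definition domain A : set (nat -> R -> R[i]) := [set U | exists F, A (U, F)].

Definition densely_defined A : Prop :=
  forall U, inH U -> forall e : R, 0 < e ->
    exists2 V, domain A V & (sqnormH (subH U V) < (e ^+ 2)%:E)%E.

Definition adjoint A : opgraph :=
  [set VG | [/\ inH VG.1, inH VG.2 &
     forall U F, A (U, F) -> dotH F VG.1 = dotH U VG.2]].

(** Density of the domain makes the adjoint, a priori a linear relation,
    single-valued and linear modulo [eqH]. *)
Definition self_adjoint A : Prop := densely_defined A /\ adjoint A = A.

(** The closure of the graph in the product space. *)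
Definition op_closure A : opgraph :=
  [set VG | [/\ inH VG.1, inH VG.2 &
     forall e : R, 0 < e -> exists U F, [/\ A (U, F),
       (sqnormH (subH VG.1 U) < (e ^+ 2)%:E)%E &
       (sqnormH (subH VG.2 F) < (e ^+ 2)%:E)%E]]].

End HilbertSpace.

(** ** The operators [A_alpha] and [A_alpha^0] *)

Section Smilansky.
Context {R : realType}.
Implicit Types (alpha : R) (U : nat -> R -> R[i]).

Definition coupling alpha : R := Num.sqrt 2%:R / alpha.

(** For [n = 0] the last term vanishes because of the factor [sqrt 0]. *)
Definition matching alpha U : Prop :=
  forall n : nat,
    (coupling alpha)%:C * (deriv0p (U n) - deriv0m (U n)) =
    (Num.sqrt n.+1%:R)%:C * U n.+1 0 + (Num.sqrt n%:R)%:C * U n.-1 0.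

(** The sequence [{(L + n) u_n}]. *)
Definition act U : nat -> R -> R[i] :=
  fun n x => opL (U n) x + n%:R * U n x.

(** The continuous representatives of the elements of the domain. *)
Definition Dom alpha : set (nat -> R -> R[i]) :=
  [set U | [/\ inH U, forall n, inW (U n), matching alpha U &
     (\sum_(0 <= n <oo) sqnormL2 setT (act U n) < +oo)%E]].

Definition Dom0 alpha : set (nat -> R -> R[i]) :=
  [set U | Dom alpha U /\
     exists N : nat, forall n, (N <= n)%N -> forall x, U n x = 0].

Definition graph_on (D : set (nat -> R -> R[i])) : opgraph :=
  [set VG | [/\ inH VG.1, inH VG.2 &
     exists U, [/\ D U, eqH VG.1 U & eqH VG.2 (act U)]]].

Definition opA alpha : opgraph := graph_on (Dom alpha).
Definition opA0 alpha : opgraph := graph_on (Dom0 alpha).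

End Smilansky.

(* Main.v *)
(** On each half-line, the functions of class [H^2] are the double primitives of
    functions of [L^2], which gives Green's formula.  Summing it over the first
    [M] components of two elements [u], [v] of the domain, the matching
    conditions make the boundary terms telescope to
    [sqrt M * (u M 0 * v M.-1 0 - u M.-1 0 * v M 0)], which vanishes for large
    [M] when [u] is finite.  Hence [A_alpha] is contained in the adjoint of
    [A_alpha^0].  Conversely, testing an element [V] of the domain of that adjoint
    against functions in a single component shows that each [V n] is in [H^2] on
    both half-lines (du Bois-Reymond) and continuous at the origin, and testing
    against a finite sequence whose only nonzero boundary value is the [k]-th
    yields the [k]-th matching condition; so the adjoint of [A_alpha^0] is
    [A_alpha].

    It remains to show that [A_alpha] is contained in the closure of
    [A_alpha^0].  Multiply the components of [U] by a cutoff in [n] descending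
    linearly from 1 to 0 between [N] and [2 N].  The error in the [n]-th matching
    condition is of size [sqrt n / N] times the neighbouring boundary values, and
    is compensated by a function supported near the origin, at the scale
    [(n + 1/2)^(-1/2)].  Since
    [|u n 0|^2 <= K * sqrt (n + 1/2) * (||u n||^2 + ||(L + n) (u n)||^2)], this
    compensation costs, in the graph norm, no more than a tail of a convergent
    series.  Approximating the first argument in this way extends the
    symmetry relation from [A_alpha^0] to [A_alpha]. *)
Require Import Defs.
From mathcomp Require Import all_boot all_order all_algebra.
From mathcomp Require Import complex ring lra.
From mathcomp Require Import all_classical all_reals all_analysis.
From mathcomp Require Import measurable_realfun.
Set Implicit Arguments.
Unset Strict Implicit.
Unset Printing Implicit Defensive.
Import Order.TTheory GRing.Theory Num.Theory.
Import numFieldNormedType.Exports.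

Local Open Scope classical_set_scope.
Local Open Scope ring_scope.

(** The proof rests on a cycle of inclusions: the adjoint of [opA0] lies in [opA], [opA] in the
    closure of [opA0], and that closure in the adjoint of [opA0]. The obstacle is the symmetry of
    [opA] on two infinite sequences. With [r n] the sum of the squared graph norms of their [n]-th
    components, the trace estimate bounds the [M]-th boundary term only by a multiple of
    [M * (r M + r M.-1)]; summability of [r] does not make this tend to zero. The approximation
    lives on the same borderline. A cutoff of slope [s] costs about [s ^ 2 * n * (n + 1/2) * r n],
    so the slope must be of order [1 / N] where [n] is of order [N]: the descent has to occupy a
    range as long as [N] itself. The width [(n + 1/2)^(-1/2)] of the correction is the length at
    which [u''] and [(n + 1/2) u] have the same size. The weak derivatives in the definition of the
    domain are arbitrary representatives. They are replaced by triples [u], [w], [h] linked by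
    integrals, which have definite boundary values at the origin; since all coefficients are real,
    these triples are real. *)

Section RealDerivative.
Context {R : realType}.
Implicit Types (f g : R -> R) (x df dg : R).

(** The value of the derivative is an explicit argument, so that the rules compose syntactically and
    [isder_eq] adjusts the result at the end. *)
Definition isder (f : R -> R) (x df : R) : Prop := is_derive x 1 f df.

Lemma isder_eq f x df dg : isder f x df -> df = dg -> isder f x dg.
Proof. by move=> fd <-. Qed.

Lemma isder_derive1 f x df : isder f x df -> derive1 f x = df.
Proof. by move=> [_ <-]; rewrite derive1E. Qed.

Lemma isder_derivable f x df : isder f x df -> derivable f x 1.
Proof. by case. Qed.

Lemma isDcst (c : R) x : isder (fun=> c) x 0.
Proof. exact: is_derive_cst. Qed.

Lemma isDid x : isder (fun y : R => y) x 1.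
Proof. exact: is_derive_id. Qed.

Lemma isDD f g x df dg : isder f x df -> isder g x dg ->
  isder (fun y => f y + g y) x (df + dg).
Proof. exact: is_deriveD. Qed.

Lemma isDN f x df : isder f x df -> isder (fun y => - f y) x (- df).
Proof. exact: is_deriveN. Qed.

Lemma isDM f g x df dg : isder f x df -> isder g x dg ->
  isder (fun y => f y * g y) x (f x * dg + g x * df).
Proof. exact: is_deriveM. Qed.

Lemma isDX f n x df : isder f x df ->
  isder (fun y => f y ^+ n) x (n%:R * f x ^+ n.-1 * df).
Proof.
move=> fd; elim: n => [|n IH]; first by rewrite !mul0r; exact: isDcst.
have -> : (fun y => f y ^+ n.+1) = (fun y => f y * f y ^+ n).
  by apply/funext => y; rewrite exprS.
apply: isder_eq; first exact: isDM fd IH.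
by case: n {IH} => [|n] /=; rewrite ?exprS -?natr1; ring.
Qed.

Lemma isDV f x df : f x != 0 -> isder f x df ->
  isder (fun y => (f y)^-1) x (- ((f x)^-1 ^+ 2 * df)).
Proof.
move=> f0 fd; apply: (@isder_eq _ _ (- (f x) ^- 2 *: df)).
  exact: (@is_deriveV R f x df 1 f0 fd).
by rewrite /GRing.scale/= exprVn mulNr.
Qed.

Lemma isDcomp f g x df dg : isder f (g x) df -> isder g x dg ->
  isder (fun y => f (g y)) x (df * dg).
Proof. by move=> *; exact: (@is_derive1_comp R f g). Qed.

Lemma isDlin (c d : R) x : isder (fun y => c * y + d) x c.
Proof.
apply: isder_eq; first by apply: isDD; [apply: isDM; [exact: isDcst|exact: isDid]|exact: isDcst].
by rewrite mulr1 mulr0 !addr0.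
Qed.

Lemma isD_near f g x df : (\forall y \near x, f y = g y) ->
  isder f x df -> isder g x df.
Proof. exact: near_eq_is_derive. Qed.

Lemma isD_continuous f x df : isder f x df -> {for x, continuous f}.
Proof. by move=> [fd _]; apply: differentiable_continuous; exact/derivable1_diffP. Qed.

End RealDerivative.

(** * Smooth functions and a smooth transition from 0 to 1 *)

Section Smooth.
Context {R : realType}.
Implicit Types f g : R -> R.

(** Differentiability of order [n] with the derivative supplied as a witness: products and inverses
    are then treated by induction on [n], without a formula for iterated derivatives. *)
Fixpoint nder (n : nat) f : Prop :=
  if n is n'.+1 then
    exists2 g : R -> R, (forall x : R, isder f x (g x)) & nder n' g
  else True.

Definition smooth f := forall n, nder n f.

Lemma is_derive_derive1 f g :
  (forall x : R, isder f x (g x)) -> derive1 f = g.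
Proof. by move=> fg; apply/funext => x; exact: isder_derive1. Qed.

Lemma smooth_derivable1n f : smooth f ->
  forall (n : nat) (x : R), derivable (derive1n n f) x 1.
Proof.
move=> sf n x; have := sf n.+1.
elim: n f {sf} => [|n IH] f [g fg ng]; first by rewrite derive1n0; have [] := fg x.
by rewrite derive1Sn (is_derive_derive1 fg); exact: IH.
Qed.

Lemma derivable1n_smooth f :
  (forall (n : nat) (x : R), derivable (derive1n n f) x 1) -> smooth f.
Proof.
move=> df n; elim: n f df => [//|n IH] f df; exists (derive1 f).
  by move=> x; rewrite derive1E; apply: derivableP; exact: (df 0%N).
by apply: IH => m x; rewrite -derive1Sn.
Qed.

Lemma nderS n f : nder n.+1 f -> nder n f.
Proof.
elim: n f => [//|n IH] f [g fg gn]; exists g => //; exact: IH.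
Qed.

Lemma nderD n f g : nder n f -> nder n g -> nder n (fun x => f x + g x).
Proof.
elim: n f g => [//|n IH] f g [f' ff' nf'] [g' gg' ng'].
exists (fun x => f' x + g' x); last exact: IH.
by move=> x; apply: isDD.
Qed.

Lemma nderM n f g : nder n f -> nder n g -> nder n (fun x => f x * g x).
Proof.
elim: n f g => [//|n IH] f g /[dup] /nderS nf [f' ff' nf'] /[dup] /nderS ng [g' gg' ng'].
exists (fun x => f x * g' x + g x * f' x); last by apply: nderD; exact: IH.
by move=> x; apply: isDM.
Qed.

Lemma nder_cst n (c : R) : nder n (fun=> c).
Proof.
elim: n c => [//|n IH] c; exists (fun=> 0); last exact: IH.
by move=> x; exact: is_derive_cst.
Qed.

Lemma nder_affine n f (c d : R) : nder n f -> nder n (fun x => f (c * x + d)).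
Proof.
elim: n f => [//|n IH] f [g fg ng]; exists (fun x => c * g (c * x + d)).
  move=> x; rewrite mulrC.
  by apply: (isDcomp (g := fun y => c * y + d)) => //; exact: isDlin.
by apply: nderM; [exact: nder_cst|exact: IH].
Qed.

(** The derivative [- g / f ^ 2] involves the inverse of [f] only undifferentiated, so the induction
    hypothesis of order [n] covers it. *)
Lemma nderV n f : (forall x, f x != 0) -> nder n f -> nder n (fun x => (f x)^-1).
Proof.
move=> f0; elim: n => [//|n IH] /[dup] /nderS nf [g fg ng].
exists (fun x => - 1 * ((f x)^-1 * (f x)^-1 * g x)).
  move=> x; rewrite mulN1r -expr2; exact: isDV.
apply: nderM; first exact: nder_cst.
by apply: nderM => //; apply: nderM; exact: IH.
Qed.

(** The classical flat function [exp (-1/x)], with the factors [x ^ (-m)] included because the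
    resulting family is closed, up to linear combinations, under differentiation. *)
Definition flat m (x : R) : R :=
  if 0 < x then x^-1 ^+ m * expR (- x^-1) else 0.

Lemma flat_ge0 m x : 0 <= flat m x.
Proof.
by rewrite /flat; case: ifPn => // x0; rewrite mulr_ge0 ?expR_ge0// exprn_ge0// invr_ge0 ltW.
Qed.

(** One term of the exponential series, [(1/x) ^ (m+1) / (m+1)! <= exp (1/x)], is enough. The bound
    gives differentiability of the whole family at the origin. *)
Lemma flat_le m x : 0 <= x -> flat m x <= m.+1`!%:R * x.
Proof.
rewrite le_eqVlt => /predU1P[<-|x0]; rewrite /flat ?ltxx ?mulr0// x0.
have xV : 0 < x^-1 by rewrite invr_gt0.
rewrite expRN; have := expR_ge1Dxn m (ltW xV).
move=> H; rewrite ler_pdivrMr ?expR_gt0//.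
have : x^-1 ^+ m.+1 / m.+1`!%:R <= expR x^-1.
  by apply: le_trans H; rewrite lerDr.
rewrite ler_pdivrMr ?ltr0n ?fact_gt0// => {}H.
have -> : x^-1 ^+ m = x * x^-1 ^+ m.+1.
  by rewrite exprS mulrA mulfV ?gt_eqF// mul1r.
by rewrite [X in _ <= X * _]mulrC -mulrA ler_pM2l// mulrC.
Qed.

Lemma is_derive_flat m (x : R) :
  isder (flat m) x (flat m.+2 x - m%:R * flat m.+1 x).
Proof.
have [x0|x0|->] := ltgtP x 0.
- rewrite /flat ltNge (ltW x0) /= mulr0 subr0.
  apply: (isD_near (f := cst 0)); last exact: isDcst.
  near=> y; rewrite ltNge ifF//; apply/negbTE; rewrite negbK; apply/ltW.
  by near: y; exact: lt_nbhsl.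
- rewrite /flat x0.
  apply: (isD_near (f := fun y => (y^-1) ^+ m * expR (- y^-1))).
    near=> y; rewrite ifT//; near: y; exact: lt_nbhsr.
  have xn0 : x != 0 by rewrite gt_eqF.
  have dV := isDV (f := fun y => y) xn0 (isDid x).
  apply: isder_eq (isDM (isDX m dV) (isDcomp (is_derive_expR _ : isder _ _ _) (isDN dV))) _.
  rewrite /= !mulr1; case: m => [|m] /=; first by rewrite !mul0r !expr0 expr2; ring.
  by rewrite !exprS expr0; ring.
- have flat0 k : flat k 0 = 0 by rewrite /flat ltxx.
  rewrite !flat0 mulr0 subr0.
  have cv : h^-1 *: ((flat m \o shift 0) (h *: 1) - flat m 0) @[h --> 0^'] --> (0 : R).
    apply/cvgr0Pnorm_le => /= e e0.
    pose C : R := m.+2`!%:R.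
    have C0 : 0 < C by rewrite ltr0n fact_gt0.
    near=> h; rewrite flat0 subr0 addr0 /GRing.scale /= mulr1.
    have [h0|h0] := leP h 0.
      by rewrite /flat ltNge h0 /= mulr0 normr0 ltW.
    (* For positive [h] the difference quotient at the origin is the next member of the family,
       which [flat_le] sends to zero. *)
    have -> : h^-1 * flat m h = flat m.+1 h.
      by rewrite /flat h0 mulrA -exprS.
    rewrite ger0_norm ?flat_ge0//; apply: le_trans (flat_le _ (ltW h0)) _.
    rewrite -/C mulrC -ler_pdivlMr//; apply: le_trans (ler_norm _) _; near: h.
    exact: (dnbhs0_le (divr_gt0 e0 C0)).
  rewrite /isder; apply: DeriveDef; last exact: cvg_lim cv.
  by apply/cvg_ex; exists 0.
Unshelve. all: by end_near. Qed.

Lemma smooth_flat m : smooth (flat m).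
Proof.
move=> n; elim: n m => [//|n IH] m.
exists (fun x => flat m.+2 x + (- m%:R) * flat m.+1 x).
  by move=> x; rewrite mulNr; exact: is_derive_flat.
by apply: nderD => //; apply: nderM => //; exact: nder_cst.
Qed.

Lemma flat_gt0 m (x : R) : 0 < x -> 0 < flat m x.
Proof. by move=> x0; rewrite /flat x0 mulr_gt0 ?expR_gt0// exprn_gt0// invr_gt0. Qed.

(** The standard smooth transition: 0 on the negative half-line, 1 from 1 onwards. The denominator
    never vanishes because [x] and [1 - x] are not both nonpositive. *)
Definition step (x : R) : R := flat 0 x / (flat 0 x + flat 0 (1 - x)).

Lemma step_den (x : R) : 0 < flat 0 x + flat 0 (1 - x).
Proof.
have [x0|x0] := ltP 0 x; first by rewrite ltr_wpDr ?flat_ge0// flat_gt0.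
by rewrite ltr_wpDl ?flat_ge0// flat_gt0//; lra.
Qed.

Lemma smooth_step : smooth step.
Proof.
move=> n; apply: nderM; first exact: smooth_flat.
apply: nderV => [x|]; first by rewrite gt_eqF// step_den.
apply: nderD; first exact: smooth_flat.
have -> : (fun x : R => flat 0 (1 - x)) = (fun x => flat 0 ((-1) * x + 1)).
  by apply/funext => x; congr flat; ring.
by apply: nder_affine; exact: smooth_flat.
Qed.

Lemma step_ge0 x : 0 <= step x.
Proof. by rewrite divr_ge0 ?flat_ge0// ltW// step_den. Qed.

Lemma step_le1 x : step x <= 1.
Proof. by rewrite ler_pdivrMr ?step_den// mul1r lerDl flat_ge0. Qed.

Lemma step_eq0 x : x <= 0 -> step x = 0.
Proof. by move=> x0; rewrite /step {1}/flat ltNge x0 /= mul0r. Qed.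

Lemma step_eq1 x : 1 <= x -> step x = 1.
Proof.
move=> x1; rewrite /step [flat 0 (1 - x)]/flat ifF ?addr0; last by apply/negbTE; rewrite -leNgt; lra.
by rewrite divff// gt_eqF// flat_gt0//; lra.
Qed.

Lemma smooth_cst (c : R) : smooth (fun=> c).
Proof. by move=> n; exact: nder_cst. Qed.

Lemma smoothD f g : smooth f -> smooth g -> smooth (fun x => f x + g x).
Proof. by move=> sf sg n; exact: nderD. Qed.

Lemma smoothM f g : smooth f -> smooth g -> smooth (fun x => f x * g x).
Proof. by move=> sf sg n; exact: nderM. Qed.

Lemma smooth_affine f (c d : R) : smooth f -> smooth (fun x => f (c * x + d)).
Proof. by move=> sf n; exact: nder_affine. Qed.

Lemma smooth_is_derive f : smooth f -> forall x, isder f x (derive1 f x).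
Proof.
by move=> sf x; have [g fg _] := sf 1%N; rewrite (is_derive_derive1 fg).
Qed.

Lemma smooth_derive1 f : smooth f -> smooth (derive1 f).
Proof.
by move=> sf n; have [g fg ng] := sf n.+1; rewrite (is_derive_derive1 fg).
Qed.

Lemma smooth_primitive f g : (forall x, isder f x (g x)) -> smooth g -> smooth f.
Proof. by move=> fg sg [//|n]; exists g. Qed.

Lemma smooth_continuous f : smooth f -> continuous f.
Proof. by move=> sf x; apply: isD_continuous; exact: smooth_is_derive. Qed.

End Smooth.

(** * Integrable and square-integrable real functions *)

Section Integration.
Context {R : realType}.
Local Notation mu := (@lebesgue_measure R).
Implicit Types (f g h : R -> R) (A B : set R).

Definition itg A f := mu.-integrable A (EFin \o f).

Lemma itg_measurable A f : itg A f -> measurable_fun A f.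
Proof. by move=> /measurable_int/measurable_EFinP. Qed.

Lemma itgD A f g : measurable A -> itg A f -> itg A g -> itg A (fun x => f x + g x).
Proof. by move=> mA; exact: integrableD. Qed.

Lemma itgB A f g : measurable A -> itg A f -> itg A g -> itg A (fun x => f x - g x).
Proof. by move=> mA; exact: integrableB. Qed.

Lemma itgZ A f (c : R) : measurable A -> itg A f -> itg A (fun x => c * f x).
Proof. by move=> mA; exact: integrableZl. Qed.

Lemma itgN A f : measurable A -> itg A f -> itg A (fun x => - f x).
Proof. by move=> mA; exact: integrableN. Qed.

Lemma itgS A B f : measurable A -> measurable B -> A `<=` B -> itg B f -> itg A f.
Proof. by move=> mA mB AB; exact: integrableS. Qed.

Lemma eq_itg A f g : {in A, f =1 g} -> itg A f -> itg A g.
Proof.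
move=> fg fi.
apply/integrableP; move/integrableP : fi => [mf fi]; split.
  by apply: eq_measurable_fun mf => x xA /=; rewrite fg.
rewrite (_ : (\int[mu]_(x in A) _ = \int[mu]_(x in A) `|(EFin \o f) x|)%E)//.
by apply: eq_integral => x xA /=; rewrite fg.
Qed.

Lemma le_itg A f g : measurable A -> measurable_fun A f ->
  (forall x, A x -> `|f x| <= g x) -> itg A g -> itg A f.
Proof.
move=> mA mf fg; apply: le_integrable => //; first exact/measurable_EFinP.
by move=> x Ax /=; rewrite lee_fin (le_trans (fg x Ax))// ler_norm.
Qed.

Lemma itg_bounded A f (a b M : R) : measurable A -> A `<=` `[a, b] ->
  measurable_fun A f -> (forall x, A x -> `|f x| <= M) -> itg A f.
Proof.
move=> mA Aab mf fM; apply: (@measurable_bounded_integrable _ _ _ mu) => //.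
  apply: le_lt_trans (le_measure mu _ _ Aab) _; rewrite ?inE//.
  by rewrite /= lebesgue_measure_itv /=; case: ifP => _; rewrite ?ltry.
exists M; split=> [|r Mr x Ax /=]; first exact: num_real.
exact: le_trans (fM x Ax) (ltW Mr).
Qed.

Lemma itg_continuous f (a b : R) : {within `[a, b], continuous f} -> itg `[a, b] f.
Proof. by move=> cf; apply: continuous_compact_integrable => //; exact: segment_compact. Qed.

Definition L2 A f := measurable_fun A f /\ itg A (fun x => f x ^+ 2).

(** An infinite integral is sent to 0 by [Rintegral], so this number is the squared norm only
    together with [L2 A f]. *)
Definition nsq A f : R := \int[mu]_(x in A) (f x ^+ 2).

Lemma nsq_ge0 A f : 0 <= nsq A f.
Proof. by apply: Rintegral_ge0 => x _; exact: sqr_ge0. Qed.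

Lemma nsqE A f : L2 A f -> (\int[mu]_(x in A) (f x ^+ 2)%:E = (nsq A f)%:E)%E.
Proof.
move=> [_ fi]; rewrite /nsq /Rintegral fineK//.
apply/fin_numPlt; apply/andP; split.
  by apply: (@lt_le_trans _ _ 0%E) => //; apply: integral_ge0 => x _; rewrite lee_fin sqr_ge0.
move/integrableP : fi => [_]; apply: le_lt_trans.
by rewrite le_eqVlt; apply/orP; left; apply/eqP; apply: eq_integral => x _ /=; rewrite ger0_norm ?sqr_ge0.
Qed.

Lemma L2P A f : measurable_fun A f ->
  (\int[mu]_(x in A) (f x ^+ 2)%:E < +oo)%E -> L2 A f.
Proof.
move=> mf fi; split => //; apply/integrableP; split.
  by apply/measurable_EFinP; exact: measurable_funX.
apply: le_lt_trans fi.
by rewrite le_eqVlt; apply/orP; left; apply/eqP; apply: eq_integral => x _ /=; rewrite ger0_norm ?sqr_ge0.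
Qed.

Lemma L2M A f g : measurable A -> L2 A f -> L2 A g -> itg A (fun x => f x * g x).
Proof.
move=> mA [mf fi] [mg gi]; apply: (@le_itg _ _ (fun x => f x ^+ 2 + g x ^+ 2)) => //.
- exact: measurable_funM.
- move=> x Ax; rewrite normrM; set a := `|f x|; set b := `|g x|.
  have -> : f x ^+ 2 = a ^+ 2 by rewrite -normrX ger0_norm ?sqr_ge0.
  have -> : g x ^+ 2 = b ^+ 2 by rewrite -normrX ger0_norm ?sqr_ge0.
  nra.
- exact: itgD.
Qed.

Lemma L2D A f g : measurable A -> L2 A f -> L2 A g -> L2 A (fun x => f x + g x).
Proof.
move=> mA [mf fi] [mg gi]; split; first exact: measurable_funD.
apply: (@le_itg _ _ (fun x => 2 * f x ^+ 2 + 2 * g x ^+ 2)) => //.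
- by apply: measurable_funX; exact: measurable_funD.
- by move=> x Ax; rewrite ger0_norm ?sqr_ge0//; have := sqr_ge0 (f x - g x); nra.
- by apply: itgD => //; exact: itgZ.
Qed.

Lemma L2Z A f (c : R) : measurable A -> L2 A f -> L2 A (fun x => c * f x).
Proof.
move=> mA [mf fi]; split; first exact: measurable_funM.
by apply: eq_itg (itgZ (c ^+ 2) mA fi) => x _; rewrite exprMn.
Qed.

Lemma L2N A f : measurable A -> L2 A f -> L2 A (fun x => - f x).
Proof.
move=> mA [mf fi]; split; first exact: measurableT_comp.
by apply: eq_itg fi => x _; rewrite sqrrN.
Qed.

Lemma L2B A f g : measurable A -> L2 A f -> L2 A g -> L2 A (fun x => f x - g x).
Proof. by move=> mA fi gi; apply: L2D => //; exact: L2N. Qed.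

Lemma L2S A B f : measurable A -> measurable B -> A `<=` B -> L2 B f -> L2 A f.
Proof.
move=> mA mB AB [mf fi]; split; last exact: itgS fi.
exact: measurable_funS mf.
Qed.

Lemma eq_L2 A f g : {in A, f =1 g} -> L2 A f -> L2 A g.
Proof.
move=> fg [mf fi]; split; first exact: eq_measurable_fun mf.
by apply: eq_itg fi => x xA; rewrite fg.
Qed.

Lemma L20 A : measurable A -> L2 A (fun=> 0).
Proof.
move=> mA; split; first exact: measurable_cst.
by apply: (@eq_itg _ (cst 0)) => [x _|]; [rewrite expr0n|exact: integrable0].
Qed.

Lemma L2_itg A f (a b : R) : measurable A -> A `<=` `[a, b] -> L2 A f -> itg A f.
Proof.
move=> mA Aab [mf fi]; apply: (@le_itg _ _ (fun x => 1 + f x ^+ 2)) => //.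
- move=> x _; have -> : f x ^+ 2 = `|f x| ^+ 2 by rewrite -normrX ger0_norm ?sqr_ge0.
  by have := normr_ge0 (f x); nra.
- apply: itgD => //; apply: (itg_bounded (M := 1) mA Aab) => // x _.
  by rewrite normr1.
Qed.

Lemma L2_bounded A f (a b M : R) : measurable A -> A `<=` `[a, b] ->
  measurable_fun A f -> (forall x, A x -> `|f x| <= M) -> L2 A f.
Proof.
move=> mA Aab mf fM; split => //.
apply: (itg_bounded (M := M ^+ 2) mA Aab); first exact: measurable_funX.
by move=> x Ax; rewrite normrX; apply: lerXn2r; rewrite ?nnegrE//; [exact: le_trans (fM x Ax)|exact: fM].
Qed.

Lemma itgU A B f : measurable A -> measurable B -> itg A f -> itg B f -> itg (A `|` B) f.
Proof.
move=> mA mB /integrableP[mf fi] /integrableP[mg gi]; apply/integrableP; split.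
  by apply/(measurable_funU _ mA mB).
have mabs C : measurable_fun C (EFin \o f) -> measurable_fun C (fun x => `|(f x)%:E|%E).
  by move=> mC; apply: measurableT_comp.
have mU : measurable_fun (A `|` B) (EFin \o f) by apply/(measurable_funU _ mA mB).
have -> : A `|` B = A `|` (B `\` A) by rewrite setDE setUIr setUv setIT.
rewrite ge0_integral_setU//=.
- rewrite lte_add_pinfty//; apply: le_lt_trans gi; apply: ge0_subset_integral => //.
  + exact: measurableD.
  + exact: mabs.
- exact: measurableD.
- have -> : A `|` (B `\` A) = A `|` B by rewrite setDE setUIr setUv setIT.
  exact: mabs.
- by apply/disj_setPS => x [Ax [_ /(_ Ax)]].
Qed.

Lemma L2U A B f : measurable A -> measurable B -> L2 A f -> L2 B f -> L2 (A `|` B) f.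
Proof. by move=> mA mB [mf fi] [mg gi]; split; [apply/(measurable_funU f mA mB)|exact: itgU]. Qed.

Lemma Rint_eq0 A f : (forall x, A x -> f x = 0) -> \int[mu]_(x in A) f x = 0.
Proof. by move=> f0; rewrite /Rintegral integral0_eq// => x Ax; rewrite f0. Qed.

Lemma Rint_itvD f (a b c : R) : a <= b -> b <= c -> itg `[a, c] f ->
  \int[mu]_(x in `[a, c]) f x = \int[mu]_(x in `[a, b]) f x + \int[mu]_(x in `[b, c]) f x.
Proof.
move=> ab bc fi; have := @Rintegral_itvB _ f (BLeft a) (BRight c) b fi.
rewrite !bnd_simp => /(_ ab bc) H.
rewrite -(@Rintegral_itv_obnd_cbnd _ b) -?H; first by rewrite addrC subrK.
by apply: itgS fi => // x; rewrite /= !in_itv/= => /andP[/ltW bx ->]; rewrite (le_trans ab bx).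
Qed.

Lemma ae_eq_itg A f g : measurable A -> measurable_fun A g -> ae_eq mu A f g -> itg A f -> itg A g.
Proof.
move=> mA mg fg /integrableP[mf fi]; apply/integrableP; split; first exact/measurable_EFinP.
rewrite (_ : (\int[mu]_(x in A) _ = \int[mu]_(x in A) `|(EFin \o f) x|)%E)//.
apply: ae_eq_integral => //.
- by apply: measurableT_comp => //; exact/measurable_EFinP.
- exact: measurableT_comp.
- by apply: filterS fg => x /= H Ax; rewrite H.
Qed.

Lemma ae_eq_Rint A f g : measurable A -> measurable_fun A f -> measurable_fun A g ->
  ae_eq mu A f g -> \int[mu]_(x in A) f x = \int[mu]_(x in A) g x.
Proof.
move=> mA mf mg fg; rewrite /Rintegral; congr fine; apply: ae_eq_integral => //.
- exact/measurable_EFinP.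
- exact/measurable_EFinP.
- by apply: filterS fg => x /= H Ax; rewrite H.
Qed.

Lemma ae_eq_L2 A f g : measurable A -> measurable_fun A g -> ae_eq mu A f g -> L2 A f -> L2 A g.
Proof.
move=> mA mg fg [mf fi]; split => //; apply: ae_eq_itg fi => //.
- exact: measurable_funX.
- by apply: filterS fg => x /= H Ax; rewrite H.
Qed.

Lemma ae_eq_nsq A f g : measurable A -> measurable_fun A f -> measurable_fun A g ->
  ae_eq mu A f g -> nsq A f = nsq A g.
Proof.
move=> mA mf mg fg; apply: ae_eq_Rint => //; try exact: measurable_funX.
by apply: filterS fg => x /= H Ax; rewrite H.
Qed.

Lemma le_nsq A B f : measurable A -> measurable B -> A `<=` B -> L2 B f -> nsq A f <= nsq B f.
Proof.
move=> mA mB AB f2; rewrite -lee_fin -!nsqE//; last exact: L2S f2.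
apply: ge0_subset_integral => //; first by apply/measurable_EFinP/measurable_funX; case: f2.
by move=> x _; rewrite lee_fin sqr_ge0.
Qed.

(* AM-GM with weight [s], which replaces the Cauchy-Schwarz inequality. *)
Lemma Rint_norm_le f g A (s : R) : measurable A -> 0 < s -> L2 A f -> L2 A g ->
  `|\int[mu]_(x in A) (f x * g x)| <= (s * nsq A f + nsq A g / s) / 2.
Proof.
move=> mA s0 f2 g2; apply: le_trans; first by apply: le_normr_Rintegral => //; exact: L2M.
have [[_ fi] [_ gi]] := (f2, g2).
rewrite /nsq -RintegralZl// -RintegralZr// -RintegralD//; last 2 first.
- exact: itgZ.
- by apply: eq_itg (itgZ s^-1 mA gi) => x _; rewrite mulrC.
rewrite -RintegralZr//; last first.
  by apply: itgD => //; [exact: itgZ|apply: eq_itg (itgZ s^-1 mA gi) => x _; rewrite mulrC].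
apply: le_Rintegral => //.
- exact: (integrable_norm (L2M mA f2 g2)).
- rewrite -/(itg _ _); apply: (@eq_itg _ (fun x => 2^-1 * (s * f x ^+ 2 + s^-1 * g x ^+ 2))).
    by move=> x _; rewrite mulrC [s^-1 * _]mulrC.
  by apply: itgZ => //; apply: itgD => //; exact: itgZ.
- move=> x _; rewrite normrM; set a := `|f x|; set b := `|g x|.
  have -> : f x ^+ 2 = a ^+ 2 by rewrite -normrX ger0_norm ?sqr_ge0.
  have -> : g x ^+ 2 = b ^+ 2 by rewrite -normrX ger0_norm ?sqr_ge0.
  rewrite ler_pdivlMr//.
  have : 0 <= (s * a - b) ^+ 2 / s by rewrite divr_ge0 ?sqr_ge0// ltW.
  have -> : (s * a - b) ^+ 2 / s = s * a ^+ 2 + b ^+ 2 / s - a * b * 2.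
    by field; rewrite gt_eqF.
  lra.
Qed.

Lemma nsqZ A f (c : R) : measurable A -> L2 A f -> nsq A (fun x => c * f x) = c ^+ 2 * nsq A f.
Proof.
move=> mA [_ fi]; rewrite /nsq -RintegralZl//.
by apply: eq_Rintegral => x _; rewrite exprMn.
Qed.

Lemma nsqD_le A f g : measurable A -> L2 A f -> L2 A g ->
  nsq A (fun x => f x + g x) <= 2 * nsq A f + 2 * nsq A g.
Proof.
move=> mA f2 g2; rewrite /nsq -!RintegralZl//; try by case: f2 g2 => ? ? [].
rewrite -RintegralD//; last 2 first.
- by apply: itgZ => //; case: f2.
- by apply: itgZ => //; case: g2.
apply: le_Rintegral => //.
- by case: (L2D mA f2 g2).
- by apply: itgD => //; apply: itgZ => //; [case: f2|case: g2].
- by move=> x _; have := sqr_ge0 (f x - g x); nra.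
Qed.

Lemma eq_nsq A f g : {in A, f =1 g} -> nsq A f = nsq A g.
Proof. by move=> fg; apply: eq_Rintegral => x xA; rewrite fg. Qed.

End Integration.

(** * Primitives of integrable functions and integration by parts *)

Section Primitive.
Context {R : realType}.
Local Notation mu := (@lebesgue_measure R).
Implicit Types (F G f g h : R -> R) (I J : set R).

(** Absolute continuity with density [f], expressed through the fundamental theorem of calculus.
    Unlike a pointwise derivative it makes sense up to the endpoint of a closed half-line and
    ignores null sets. Integrability is part of it because [Rintegral] has a value for every
    function. *)
Definition isprim J F f := forall x y : R, J x -> J y -> x <= y ->
  itg `[x, y] f /\ F y - F x = \int[mu]_(t in `[x, y]) f t.

Lemma isprimS I J F f : I `<=` J -> isprim J F f -> isprim I F f.
Proof. by move=> IJ H x y /IJ Jx /IJ Jy; exact: H. Qed.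

Lemma eq_isprim J F G f : {in J, F =1 G} -> isprim J F f -> isprim J G f.
Proof.
move=> FG H x y Jx Jy xy; have [fi e] := H x y Jx Jy xy; split => //.
by rewrite -e !FG ?inE.
Qed.

Lemma EFin_Rint (A : set R) f : measurable A -> itg A f ->
  (\int[mu]_(x in A) (f x)%:E = (\int[mu]_(x in A) f x)%:E)%E.
Proof. by move=> mA fi; rewrite /Rintegral fineK//; exact: integrable_fin_num. Qed.

Lemma patchR (A : set R) f x : (f \_ A) x = if x \in A then f x else 0.
Proof. by rewrite patchE. Qed.

Lemma itg_patch (A : set R) f : measurable A -> itg A f -> itg setT (f \_ A).
Proof.
by move=> mA fi; rewrite /itg -restrict_EFin; apply/integrable_restrict => //; rewrite setTI.
Qed.

Lemma EFin_Rint_patch (A : set R) f (F : R -> \bar R) : measurable A -> itg A f ->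
  (forall x, F x = ((f \_ A) x)%:E) ->
  (\int[mu]_x F x = (\int[mu]_(x in A) f x)%:E)%E.
Proof.
move=> mA fi FE; rewrite -EFin_Rint// [RHS]integral_mkcond; apply: eq_integral => x _.
by rewrite FE restrict_EFin.
Qed.

Lemma itg_itv1 f (x : R) : itg `[x, x] f.
Proof.
rewrite set_itv1; apply: null_set_integrable => //; last exact: lebesgue_measure_set1.
exact: measurable_fun_set1.
Qed.

Lemma isprim_C1 F f : (forall x, isder F x (f x)) -> continuous f -> isprim setT F f.
Proof.
move=> Ff cf x y _ _; rewrite le_eqVlt => /predU1P[<-|xy].
  by split; [exact: itg_itv1|rewrite set_itv1 Rintegral_set1 subrr].
have cfw : {within `[x, y], continuous f} by apply: continuous_subspaceT.
split; first exact: itg_continuous.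
have cF z : F @ z --> F z by exact: (isD_continuous (Ff z)).
rewrite /Rintegral (continuous_FTC2 xy cfw (F := F))//=.
  split; first by move=> z _; exact: isder_derivable (Ff z).
  - by apply: cvg_at_right_filter; exact: cF.
  - by apply: cvg_at_left_filter; exact: cF.
by move=> z _; exact: isder_derive1.
Qed.

Lemma isprimD J F G f g : isprim J F f -> isprim J G g ->
  isprim J (fun x => F x + G x) (fun x => f x + g x).
Proof.
move=> Ff Gg x y Jx Jy xy; have [fi Fe] := Ff x y Jx Jy xy; have [gi Ge] := Gg x y Jx Jy xy.
split; first exact: itgD.
by rewrite RintegralD// -Fe -Ge; ring.
Qed.

Lemma isprimZ J F f (c : R) : isprim J F f -> isprim J (fun x => c * F x) (fun x => c * f x).
Proof.
move=> Ff x y Jx Jy xy; have [fi Fe] := Ff x y Jx Jy xy.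
by split; [exact: itgZ|rewrite RintegralZl// -Fe mulrBr].
Qed.

Lemma isprim_cst J (c : R) : isprim J (fun=> c) (fun=> 0).
Proof.
move=> x y _ _ _; split; last by rewrite subrr Rintegral_cst// mul0r.
by apply: integrable0.
Qed.

Lemma isprim_cvg (a b : R) F f : a < b -> isprim `[a, b] F f -> {within `[a, b], continuous F}.
Proof.
move=> ab Ff; have aa : `[a, b]%classic a by rewrite /= in_itv/= lexx ltW.
have bb : `[a, b]%classic b by rewrite /= in_itv/= lexx ltW.
have [fi _] := Ff a b aa bb (ltW ab).
apply: (@subspace_eq_continuous _ _ _ (fun x => F a + \int[mu]_(t in `[a, x]) f t)).
  move=> x; rewrite inE /= => xab; have ax : a <= x by rewrite (itvP xab).
  by have [_ <-] := Ff a x aa xab ax; rewrite addrC subrK.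
have := parameterized_integral_continuous (ltW ab) fi.
move=> H x; apply: (@continuousD _ _ _ (cst (F a) : subspace `[a, b] -> R)); [exact: cst_continuous|exact: H].
Qed.

Lemma isprim_measurable (a b : R) F f : isprim `[a, b] F f -> measurable_fun `[a, b] F.
Proof.
move=> Ff; have [ab|ab|<-] := ltgtP a b.
- by apply: subspace_continuous_measurable_fun => //; exact: isprim_cvg Ff.
- by rewrite set_itv_ge ?bnd_simp -?ltNge//; exact: measurable_fun_set0.
- by rewrite set_itv1; exact: measurable_fun_set1.
Qed.

Lemma isprim_bounded (a b : R) F f : isprim `[a, b] F f ->
  exists M, forall x, `[a, b]%classic x -> `|F x| <= M.
Proof.
move=> Ff; have [ab|ab] := leP a b; last first.
  by exists 0 => x; rewrite set_itv_ge ?bnd_simp -?ltNge.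
have aa : `[a, b]%classic a by rewrite /= in_itv/= lexx.
have bb : `[a, b]%classic b by rewrite /= in_itv/= lexx andbT.
have [fi _] := Ff a b aa bb ab.
exists (`|F a| + \int[mu]_(t in `[a, b]) `|f t|) => x xab.
have ax : a <= x by move: xab; rewrite /= in_itv/= => /andP[].
have [fix_ Fe] := Ff a x aa xab ax.
have -> : F x = F a + (F x - F a) by rewrite addrC subrK.
apply: le_trans (ler_normD _ _) _; rewrite lerD2l Fe.
apply: le_trans; first by apply: le_normr_Rintegral.
have sub : `[a, x] `<=` `[a, b].
  by move=> t; move: xab; rewrite /= !in_itv/= => /andP[_ xb] /andP[-> /le_trans]; exact.
have ni := integrable_norm fi.
rewrite /Rintegral fine_le//.
- by apply: integrable_fin_num => //; exact: integrable_norm.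
- exact: integrable_fin_num.
- apply: ge0_subset_integral => //; exact: measurable_int ni.
Qed.

Lemma isprim_itgM (a b : R) F f g : isprim `[a, b] F f -> itg `[a, b] g ->
  itg `[a, b] (fun x => F x * g x).
Proof.
move=> Ff gi; have [M FM] := isprim_bounded Ff.
apply: (@le_itg _ _ _ (fun x => M * `|g x|)) => //.
- by apply: measurable_funM; [exact: isprim_measurable Ff|exact: itg_measurable].
- by move=> x xab; rewrite normrM ler_wpM2r// FM.
- by apply: itgZ => //; exact: integrable_norm.
Qed.

Lemma IBP (a b : R) F G f g : a <= b -> isprim `[a, b] F f -> isprim `[a, b] G g ->
  \int[mu]_(x in `[a, b]) (F x * g x) + \int[mu]_(x in `[a, b]) (G x * f x) =
  F b * G b - F a * G a.
Proof.
move=> ab Ff Gg.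
have aa : `[a, b]%classic a by rewrite /= in_itv/= lexx.
have bb : `[a, b]%classic b by rewrite /= in_itv/= lexx andbT.
have [fi Fab] := Ff a b aa bb ab; have [gi Gab] := Gg a b aa bb ab.
pose f' := f \_ `[a, b]; pose g' := g \_ `[a, b].
have f'i : itg setT f' by exact: itg_patch.
have g'i : itg setT g' by exact: itg_patch.
(* The integrand on the triangle; [f'] and [g'] vanish off [[a, b]], so both integrals run over the
   whole line. *)
pose K (z : R * R) : R := if z.2 <= z.1 then f' z.1 * g' z.2 else 0.
have mf' : measurable_fun setT f' by exact: itg_measurable.
have mg' : measurable_fun setT g' by exact: itg_measurable.
have mK : measurable_fun setT K.
  apply: measurable_fun_ifT => //.
  - apply: measurable_fun_ler; [exact: measurable_snd|exact: measurable_fst].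
  - by apply: measurable_funM; apply: measurableT_comp.
have mKE : measurable_fun setT (EFin \o K) by exact/measurable_EFinP.
have iK : (mu \x mu)%E.-integrable setT (EFin \o K).
  apply/integrable12ltyP => //.
  pose C := \int[mu]_y `|g' y|.
  have ng'i := integrable_norm g'i; have nf'i := integrable_norm f'i.
  have leK x : (\int[mu]_y `|(EFin \o K) (x, y)| <= (`|f' x| * C)%:E)%E.
    have zi : itg setT (fun y => `|f' x| * `|g' y|) by exact: itgZ.
    rewrite /C -RintegralZl// -EFin_Rint//; apply: ge0_le_integral => //.
    - apply: measurableT_comp => //; apply: (measurableT_comp mKE).
      exact: measurable_pair1.
    - by apply/measurable_EFinP; exact: itg_measurable zi.
    - move=> y _; rewrite /K lee_fin/=; case: ifP => _; first by rewrite normrM.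
      by rewrite normr0 mulr_ge0.
  have Ci : itg setT (fun x => `|f' x| * C).
    by apply: eq_itg (itgZ C measurableT nf'i) => x _; rewrite mulrC.
  apply: (@le_lt_trans _ _ (\int[mu]_x (`|f' x| * C)%:E)%E).
    apply: ge0_le_integral => //.
    - by move=> x _; apply: integral_ge0.
    - have mKa : measurable_fun setT (abse \o (EFin \o K)) by exact: measurableT_comp.
      have pos z : (0 <= (abse \o (EFin \o K)) z)%E by exact: abse_ge0.
      exact: (measurable_fun_fubini_tonelli_F (m2 := mu) _ mKa pos).
    - by apply/measurable_EFinP; exact: itg_measurable Ci.
  by rewrite EFin_Rint// ltry.
have := Fubini iK.
have fG : itg `[a, b] (fun x => f x * (G x - G a)).
  apply: (@eq_itg _ _ (fun x => G x * f x - G a * f x)) => [x _|]; first by ring.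
  by apply: itgB => //; [exact: isprim_itgM Gg fi|exact: itgZ].
have gF : itg `[a, b] (fun x => g x * (F b - F x)).
  apply: (@eq_itg _ _ (fun x => F b * g x - F x * g x)) => [x _|]; first by ring.
  by apply: itgB => //; [exact: itgZ|exact: isprim_itgM Ff gi].
have -> : (\int[mu]_x \int[mu]_y (EFin \o K) (x, y) =
   (\int[mu]_(x in `[a, b]) (f x * (G x - G a)))%:E)%E.
  apply: EFin_Rint_patch => // x; rewrite patchR; case: ifPn => [|/negP xab]; last first.
    rewrite (_ : (fun y => _) = cst 0%E); first by rewrite integral0.
    apply/funext => y; rewrite /= /K /= /f' [(f \_ _) _]patchR (negbTE (introN idP xab)).
    by rewrite mul0r; case: ifP.
  rewrite inE => xab; have ax : a <= x by move: xab; rewrite /= in_itv/= => /andP[].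
  have [gix ->] := Gg a x aa xab ax.
  rewrite -RintegralZl//; apply: EFin_Rint_patch => //; first exact: itgZ.
  move=> y /=; rewrite /K/= /f' /g' !patchR mem_set//=.
  have xb : x <= b by move: xab; rewrite /= in_itv/= => /andP[].
  case: ifPn => yx; last first.
    by rewrite (@memNset R)//= in_itv/= => /andP[_]; exact/negP.
  case: (boolP (y \in _)) => /=; rewrite ?inE ?notin_setE /= ?in_itv/= => yab.
    by rewrite mem_set//= in_itv/= yx andbT; case/andP: yab.
  rewrite (@memNset R) ?mulr0//= in_itv/= => /andP[ay _]; apply: yab.
  by rewrite ay (le_trans yx xb).
have -> : (\int[mu]_y \int[mu]_x (EFin \o K) (x, y) =
   (\int[mu]_(y in `[a, b]) (g y * (F b - F y)))%:E)%E.
  apply: EFin_Rint_patch => // y; rewrite patchR; case: ifPn => [|/negP yab]; last first.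
    rewrite (_ : (fun x => _) = cst 0%E); first by rewrite integral0.
    apply/funext => x; rewrite /= /K /= /g' [(g \_ _) _]patchR (negbTE (introN idP yab)).
    by rewrite mulr0; case: ifP.
  rewrite inE => yab; have yb : y <= b by move: yab; rewrite /= in_itv/= => /andP[].
  have [fiy ->] := Ff y b yab bb yb.
  rewrite -RintegralZl//; apply: EFin_Rint_patch => //; first exact: itgZ.
  move=> x /=; rewrite /K/= /f' /g' !patchR [y \in _]mem_set//=.
  have ay : a <= y by move: yab; rewrite /= in_itv/= => /andP[].
  case: ifPn => yx; last first.
    by rewrite (@memNset R)//= in_itv/= => /andP[+ _]; exact/negP.
  case: (boolP (x \in _)) => /=; rewrite ?inE ?notin_setE /= ?in_itv/= => xab.
    by rewrite mem_set//= ?in_itv/= ?yx 1?mulrC//; case/andP: xab.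
  rewrite (@memNset R) ?mul0r//= in_itv/= => /andP[_ xb]; apply: xab.
  by rewrite xb (le_trans ay yx).
move=> [] H.
have FiG : itg `[a, b] (fun x => G x * f x) by exact: isprim_itgM Gg fi.
have FiF : itg `[a, b] (fun x => F x * g x) by exact: isprim_itgM Ff gi.
have e1 : \int[mu]_(x in `[a, b]) (f x * (G x - G a)) =
          \int[mu]_(x in `[a, b]) (G x * f x) - G a * (F b - F a).
  rewrite Fab -RintegralZl// -RintegralB//; last exact: itgZ.
  by apply: eq_Rintegral => x _; ring.
have e2 : \int[mu]_(x in `[a, b]) (g x * (F b - F x)) =
          F b * (G b - G a) - \int[mu]_(x in `[a, b]) (F x * g x).
  rewrite Gab -RintegralZl// -RintegralB//; last exact: itgZ.
  by apply: eq_Rintegral => x _; ring.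
by move: H; rewrite e1 e2 => H; lra.
Qed.

Lemma isprim_isder (a b x : R) F f : isprim `[a, b] F f -> a < x -> x < b ->
  {for x, continuous f} -> isder F x (f x).
Proof.
move=> Ff ax xb cf; have ab := lt_trans ax xb.
have aa : `[a, b]%classic a by rewrite /= in_itv/= lexx ltW.
have bb : `[a, b]%classic b by rewrite /= in_itv/= lexx andbT ltW.
have [fi _] := Ff a b aa bb (ltW ab).
have [d dE] := continuous_FTC1_closed xb fi ax cf.
have dI : isder (fun y => \int[mu]_(t in `[a, y]) f t) x (f x).
  by rewrite -dE derive1E; exact: derivableP.
apply: (isD_near (f := fun y => F a + \int[mu]_(t in `[a, y]) f t)).
  near=> y; have ay : a < y by near: y; exact: lt_nbhsr.
  have yb : y < b by near: y; exact: lt_nbhsl.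
  have yy : `[a, b]%classic y by rewrite /= in_itv/= !ltW.
  by have [_ <-] := Ff a y aa yy (ltW ay); rewrite addrC subrK.
by apply: isder_eq; [apply: isDD dI; exact: isDcst|rewrite add0r].
Unshelve. all: by end_near. Qed.

Definition prim (c : R) f (x : R) : R :=
  if c <= x then \int[mu]_(t in `[c, x]) f t else - \int[mu]_(t in `[x, c]) f t.

Lemma prim_base c f : prim c f c = 0.
Proof. by rewrite /prim lexx set_itv1 Rintegral_set1. Qed.

Lemma isprim_prim J c f : J c -> (forall x y, J x -> J y -> itg `[x, y] f) ->
  isprim J (prim c f) f.
Proof.
move=> Jc Jf x y Jx Jy xy; split; first exact: Jf.
rewrite /prim; case: ifPn => cy; case: ifPn => cx.
- by rewrite (Rint_itvD cx xy); [ring|exact: Jf].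
- by rewrite -ltNge in cx; rewrite (Rint_itvD (ltW cx) cy); [ring|exact: Jf].
- by rewrite (le_trans cx xy) in cy.
- by rewrite -ltNge in cy; rewrite (Rint_itvD xy (ltW cy)); [ring|exact: Jf].
Qed.

End Primitive.

(** * Test functions on an open interval and what they detect *)

Section TestFunctions.
Context {R : realType}.
Local Notation mu := (@lebesgue_measure R).
Implicit Types (f g h D V phi chi psi : R -> R) (I : set R).

(* The last clause lets almost everywhere statements on compact subintervals
   be transferred to [I], and makes [I] open. *)
Definition open_itv I := [/\ measurable I, is_interval I, I !=set0 &
  exists a b : nat -> R, (forall n, I (a n) /\ I (b n)) /\
    forall x, I x -> exists n, a n < x /\ x < b n].

Lemma open_itv_half_pos : open_itv (@half_pos R).
Proof.
have -> : @half_pos R = `]0, +oo[%classic.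
  by apply/seteqP; split=> x /=; rewrite in_itv/= andbT.
split; [by []|exact: interval_is_interval|by exists 1; rewrite /= in_itv/= andbT|].
exists (fun n => n.+1%:R^-1), (fun n => n.+2%:R); split=> [n|x /=].
  by rewrite /= !in_itv/= !andbT invr_gt0 !ltr0n.
rewrite in_itv/= andbT => x0; exists (Num.truncn (Num.max x x^-1)); split.
  rewrite invf_plt ?posrE//; apply: le_lt_trans (truncnS_gt _).
  by rewrite le_max lexx orbT.
apply: (@lt_trans _ _ (Num.truncn (Num.max x x^-1)).+1%:R); last by rewrite ltr_nat.
by apply: le_lt_trans (truncnS_gt _); rewrite le_max lexx.
Qed.

Lemma open_itv_half_neg : open_itv (@half_neg R).
Proof.
have -> : @half_neg R = `]-oo, 0[%classic.
  by apply/seteqP; split=> x /=; rewrite in_itv/=.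
split; [by []|exact: interval_is_interval|by exists (-1); rewrite /= in_itv/= ltrN10|].
have [_ _ _ [a [b [ab H]]]] := open_itv_half_pos.
exists (fun n => - b n), (fun n => - a n); split=> [n|x /=].
  by rewrite /= !in_itv/= !oppr_lt0; have [] := ab n.
rewrite in_itv/= => x0; have [|n [an bn]] := H (- x); first by rewrite /half_pos/= oppr_gt0.
by exists n; rewrite ltrNl ltrNr.
Qed.

Definition locitg I f := forall x y, I x -> I y -> itg `[x, y] f.

(** Test functions with explicit bounds of the support inside [I], the form in which integrals over
    [I] are reduced to compact intervals. The next two lemmas prove the equivalence with
    [test_function]. *)
Definition tst I phi := smooth phi /\ exists a b, [/\ I a, I b, a <= b &
  forall x, x <= a \/ b <= x -> phi x = 0].

Lemma sub_itv I (a b : R) : is_interval I -> I a -> I b -> `[a, b] `<=` I.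
Proof. by move=> iI Ia Ib x /=; rewrite in_itv/= => xab; exact: iI xab. Qed.

Lemma tst_test_function I phi : open_itv I -> tst I phi -> test_function I phi.
Proof.
move=> [_ iI _ _] [sp [a [b [Ia Ib ab p0]]]].
have sub : closure [set x | phi x != 0] `<=` `[a, b].
  have -> : `[a, b]%classic = closure `[a, b].
    by apply/closure_id; exact: itv_closed.
  apply: closure_subset => x /= px; rewrite in_itv/=; apply/andP; split.
    by rewrite leNgt; apply: contraNN px => xa; rewrite p0//; left; exact: ltW.
  by rewrite leNgt; apply: contraNN px => xa; rewrite p0//; right; exact: ltW.
split; first exact: smooth_derivable1n.
- apply: (subclosed_compact _ (@segment_compact _ a b) sub); exact: closed_closure.
- by apply: subset_trans sub _; exact: sub_itv.
Qed.

(** The compact support has a least and a greatest point; as these belong to [I], the exhausting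
    sequences of [open_itv] pass strictly beyond them. *)
Lemma test_function_tst I phi : open_itv I -> test_function I phi -> tst I phi.
Proof.
move=> [_ iI [x0 Ix0] [a [b [ab H]]]] [sp cK KI]; split; first exact: derivable1n_smooth.
set K := closure _ in cK KI.
have pK x : phi x != 0 -> K x by move=> px; exact: subset_closure.
have [K0|/set0P/negP/negPn/eqP K0] := pselect (K !=set0); last first.
  exists x0, x0; split => // x _; apply/eqP; apply: contraT => /pK.
  by rewrite K0.
have cid : {within K, continuous (id : R -> R)}.
  by apply: continuous_subspaceT => x; exact: cvg_id.
have [M MK HM] := compact_EVT_max K0 cK cid.
have [m mK Hm] := compact_EVT_min K0 cK cid.
rewrite !inE in MK mK.
have [i [aim _]] := H m (KI _ mK); have [j [_ Mbj]] := H M (KI _ MK).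
have mM : m <= M by apply: HM; rewrite inE.
exists (a i), (b j); split; [by have [] := ab i|by have [] := ab j| |].
  by rewrite ltW// (lt_le_trans aim)// (le_trans mM)// ltW.
move=> x xab; apply/eqP; apply: contraT => /pK Kx.
have xm : m <= x by apply: Hm; rewrite inE.
have xM : x <= M by apply: HM; rewrite inE.
case: xab => [xa|bx].
- by move: (lt_le_trans aim xm); rewrite ltNge xa.
- by move: (le_lt_trans xM Mbj); rewrite ltNge bx.
Qed.

(** The bounds are moved strictly outwards, so that [phi] vanishes in a neighbourhood of every point
    outside and its derivative vanishes there as well, the endpoints included. *)
Lemma tst_bounds I phi : open_itv I -> tst I phi -> exists a b, [/\ I a, I b, a <= b,
  (forall x, x <= a \/ b <= x -> phi x = 0) &
  (forall x, x <= a \/ b <= x -> derive1 phi x = 0)].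
Proof.
move=> [_ iI [x0 Ix0] [a [b [ab H]]]] [sp [c [d [Ic Id cd p0]]]].
have [i [ai _]] := H c Ic; have [j [_ bj]] := H d Id.
exists (a i), (b j); split; [by have [] := ab i|by have [] := ab j| | |].
- by rewrite ltW// (lt_le_trans ai)// (le_trans cd)// ltW.
- by move=> x [xa|bx]; apply: p0; [left|right];
    [exact: le_trans xa (ltW ai)|exact: le_trans (ltW bj) bx].
move=> x xab; apply: isder_derive1.
apply: (isD_near (f := cst 0)); last exact: isDcst.
case: xab => [xa|bx].
- near=> y; rewrite p0//; left; apply/ltW; near: y; apply: lt_nbhsl.
  exact: le_lt_trans ai.
- near=> y; rewrite p0//; right; apply/ltW; near: y; apply: lt_nbhsr.
  exact: lt_le_trans bx.
Unshelve. all: by end_near. Qed.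

Lemma tst_derive1 I phi : open_itv I -> tst I phi -> tst I (derive1 phi).
Proof.
move=> oI pt; have [a [b [Ia Ib ab _ p0]]] := tst_bounds oI pt.
by case: pt => sp _; split; [exact: smooth_derive1|exists a, b].
Qed.

Lemma Rint_supp I phi f (a b : R) : is_interval I -> I a -> I b ->
  (forall x, x <= a \/ b <= x -> phi x = 0) ->
  \int[mu]_(x in I) (f x * phi x) = \int[mu]_(x in `[a, b]) (f x * phi x).
Proof.
move=> iI Ia Ib p0; rewrite Rintegral_mkcond [RHS]Rintegral_mkcond.
congr (Rintegral _ _ _); apply/funext => x; rewrite !patchR.
have [xab|xab] := boolP (x \in `[a, b]%classic).
  by rewrite mem_set//; apply: sub_itv Ia Ib _ _ => //; rewrite inE in xab.
have -> : phi x = 0.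
  apply: p0; move: xab; rewrite notin_setE /= in_itv/= => /negP.
  by rewrite negb_and -!ltNge => /orP[] /ltW; [left|right].
by rewrite mulr0; case: ifP.
Qed.

Lemma itg_cont_mul (a b : R) f phi : itg `[a, b] f -> continuous phi ->
  itg `[a, b] (fun x => f x * phi x).
Proof.
move=> fi cp; have cpw : {within `[a, b], continuous phi} by exact: continuous_subspaceT.
apply: (@integrableMl _ _ _ mu _ _ (EFin \o f) phi) => //.
  by apply: subspace_continuous_measurable_fun.
have [M [Mr HM]] := compact_bounded (continuous_compact cpw (@segment_compact _ a b)).
exists M; split => // r Mr' x xab; apply: HM => //; by exists x.
Qed.

Lemma itg_supp I phi f : open_itv I -> locitg I f -> tst I phi ->
  itg I (fun x => f x * phi x).
Proof.
move=> [mI iI _ _] fi [sp [a [b [Ia Ib ab p0]]]].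
have h1 : itg `[a, b] (fun x => f x * phi x).
  by apply: itg_cont_mul; [exact: fi|exact: smooth_continuous].
have h2 := itg_patch (measurable_itv _) h1.
apply: (@eq_itg _ I ((fun x => f x * phi x) \_ `[a, b])); last first.
  by apply: itgS h2.
move=> x xI; rewrite patchR; case: ifPn => // xab.
rewrite p0 ?mulr0//; move: xab; rewrite notin_setE /= in_itv/= => /negP.
by rewrite negb_and -!ltNge => /orP[] /ltW; [left|right].
Qed.

(** Smooth functions between 0 and 1, supported in [[a, b]], converging to the indicator of the open
    interval. *)
Definition bump (a b : R) (n : nat) (x : R) : R :=
  step (n%:R * (x - a)) * step (n%:R * (b - x)).

Lemma smooth_bump a b n : smooth (bump a b n).
Proof.
have -> : bump a b n = fun x => step (n%:R * x + (- (n%:R * a))) * step ((- n%:R) * x + n%:R * b).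
  by apply/funext => x; rewrite /bump; congr (step _ * step _); ring.
by apply: smoothM; apply: smooth_affine; exact: smooth_step.
Qed.

Lemma bump_supp a b n x : x <= a \/ b <= x -> bump a b n x = 0.
Proof.
move=> [xa|bx]; rewrite /bump.
- by rewrite step_eq0 ?mul0r// mulr_ge0_le0// subr_le0.
- by rewrite [X in _ * X]step_eq0 ?mulr0// mulr_ge0_le0// subr_le0.
Qed.

Lemma bump_ge0 a b n x : 0 <= bump a b n x.
Proof. by rewrite mulr_ge0// step_ge0. Qed.

Lemma bump_le1 a b n x : bump a b n x <= 1.
Proof. by rewrite mulr_ile1 ?step_ge0 ?step_le1. Qed.

Lemma bump_near1 a b x : a < x -> x < b -> \forall n \near \oo, bump a b n x = 1.
Proof.
move=> ax xb.
have pos (d : R) : 0 < d -> \forall n \near \oo, 1 <= n%:R * d.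
  move=> d0; near=> n; rewrite -ler_pdivrMr// mul1r.
  by near: n; exact: nbhs_infty_ger.
have h1 : 0 < x - a by rewrite subr_gt0.
have h2 : 0 < b - x by rewrite subr_gt0.
near=> n; rewrite /bump !step_eq1 ?mulr1//; near: n; exact: pos.
Unshelve. all: by end_near. Qed.

Lemma bump_cvg a b x : a < x -> x < b -> bump a b n x @[n --> \oo] --> (1 : R).
Proof.
move=> ax xb; apply: (cvg_near_cst (1 : R)); exact: bump_near1.
Qed.

Lemma tst_bump I a b n : I a -> I b -> a <= b -> tst I (bump a b n).
Proof.
move=> Ia Ib ab; split; first exact: smooth_bump.
by exists a, b; split => // x; exact: bump_supp.
Qed.

Lemma aeS (P Q : R -> Prop) : {ae mu, forall x, P x} -> (forall x, P x -> Q x) ->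
  {ae mu, forall x, Q x}.
Proof.
move=> [N [mN N0 PN]] PQ; exists N; split => // x /= nQ; apply: PN => /= Px.
exact/nQ/PQ.
Qed.

Lemma aeI (P Q : R -> Prop) : {ae mu, forall x, P x} -> {ae mu, forall x, Q x} ->
  {ae mu, forall x, P x /\ Q x}.
Proof.
move=> hP hQ; have := negligibleU hP hQ; rewrite -setCI; exact.
Qed.

Lemma ae_neq0 : {ae mu, forall t : R, t <> 0}.
Proof.
exists [set 0]; split => //; first exact: lebesgue_measure_set1.
by move=> t /= /contrapT.
Qed.

Lemma ae_not_in_endpoints (a b : R) : {ae mu, forall x, `[a, b]%classic x -> a < x /\ x < b}.
Proof.
exists [set a; b]; split; first exact: measurableU.
  apply/eqP; rewrite eq_le measure_ge0 andbT.
  apply: le_trans (measureU2 _ _ _) _ => //.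
  by rewrite [X in (X + _ <= _)%E](lebesgue_measure_set1 a) [X in (_ + X <= _)%E](lebesgue_measure_set1 b) adde0.
move=> x /= /not_implyP[]; rewrite in_itv/= => /andP[].
rewrite le_eqVlt => /predU1P[->|ax]; first by left.
by rewrite le_eqVlt => /predU1P[->|xb]; [right|case].
Qed.

Lemma Rint_bump_cvg (a b : R) f : itg `[a, b] f ->
  \int[mu]_(x in `[a, b]) (f x * bump a b n x) @[n --> \oo] --> \int[mu]_(x in `[a, b]) f x.
Proof.
move=> fi.
have fni n : itg `[a, b] (fun x => f x * bump a b n x).
  by apply: itg_cont_mul => //; apply: smooth_continuous; exact: smooth_bump.
have [] := @dominated_convergence _ _ _ mu `[a, b] (measurable_itv _)
  (fun n x => (f x * bump a b n x)%:E) (EFin \o f) (fun x => `|f x|%:E).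
- by move=> n; exact: measurable_int (fni n).
- exact: measurable_int fi.
- move: (ae_not_in_endpoints a b) => /aeS; apply => x H xab; have [ax xb] := H xab.
  apply: cvg_EFin; first by apply: nearW.
  rewrite -[X in _ --> X]mulr1; apply: cvgM; first exact: cvg_cst.
  exact: bump_cvg.
- exact: integrable_norm.
- apply: nearW => x n _ /=; rewrite lee_fin normrM ler_piMr//.
  by rewrite ger0_norm ?bump_ge0// bump_le1.
move=> _ _ H; apply: fine_cvg; rewrite /= fineK; last exact: integrable_fin_num.
exact: H.
Qed.

(** The bumps turn the hypothesis on test functions into one on indicators of intervals, by
    dominated convergence. *)
Lemma Rint_tst_eq0 I f : open_itv I -> locitg I f ->
  (forall phi, tst I phi -> \int[mu]_(x in I) (f x * phi x) = 0) ->
  forall a b, I a -> I b -> a <= b -> \int[mu]_(x in `[a, b]) f x = 0.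
Proof.
move=> oI fi f0 a b Ia Ib ab; have [mI iI _ _] := oI.
have := Rint_bump_cvg (fi a b Ia Ib).
rewrite (_ : (fun n => _) = fun=> 0); last first.
  apply/funext => n; rewrite -(Rint_supp _ iI Ia Ib); last by move=> x; exact: bump_supp.
  by apply: f0; exact: tst_bump.
by move=> /cvg_lim; rewrite lim_cst//; move=> ->.
Qed.

(** Lebesgue differentiation: almost everywhere [f] is the derivative of its primitive from [a], and
    this primitive is zero. *)
Lemma ae_eq0_itv (a b : R) f : itg `[a, b] f ->
  (forall x, a <= x -> x <= b -> \int[mu]_(t in `[a, x]) f t = 0) ->
  {ae mu, forall x, a < x -> x <= b -> f x = 0}.
Proof.
move=> fi f0; pose f' := f \_ `[a, b].
have f'i : itg setT f' by exact: itg_patch.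
(* The differentiation theorem is applied to a function on the whole line, so the extension by zero
   must have vanishing primitive for every [x], also outside [[a, b]]. *)
have F0 x : \int[mu]_(t in `[a, x]) f' t = 0.
  have [ax|xa] := leP a x; last by rewrite set_itv_ge ?bnd_simp -?ltNge// Rintegral_set0.
  have [xb|bx] := leP x b.
    rewrite -(f0 x ax xb); apply: eq_Rintegral => t; rewrite inE/= in_itv/= => /andP[at_ tx].
    by rewrite /f' patchR mem_set//= in_itv/= at_ (le_trans tx xb).
  have [ab|ba] := leP a b; last first.
    rewrite (_ : f' = fun=> 0) ?Rintegral_cst ?mul0r//.
    apply/funext => t; rewrite /f' patchR set_itv_ge ?bnd_simp -?ltNge//.
    by rewrite in_set0.
  rewrite -(f0 b ab (lexx b)) [LHS]Rintegral_mkcond [RHS]Rintegral_mkcond.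
  congr (Rintegral _ _ _); apply/funext => t; rewrite /f' !patchR.
  case: (boolP (t \in `[a, b]%classic)) => tab; last by case: ifP.
  by rewrite mem_set//; move: tab; rewrite inE/= !in_itv/= => /andP[-> tb]; rewrite (le_trans tb (ltW bx)).
have := @FTC1 R f' (BLeft a) _ _.
have -> : (fun y => \int[mu]_(t in [set` Interval (BLeft a) (BRight y)]) f' t) = cst 0.
  by apply/funext => y; exact: F0.
move=> /(_ (fun y => itgS (measurable_itv _) measurableT (@subsetT _ _) f'i)).
move=> /(_ (open_integrable_locally openT f'i)).
move=> /aeS; apply => x H ax xb.
have [|_] := H; first by rewrite /= lte_fin.
by rewrite derive1_cst /f' patchR mem_set//= in_itv/= (ltW ax) xb.
Qed.

Lemma ae_eq0_open_itv I f : open_itv I -> locitg I f ->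
  (forall a b, I a -> I b -> a <= b -> \int[mu]_(x in `[a, b]) f x = 0) ->
  {ae mu, forall x, I x -> f x = 0}.
Proof.
move=> [mI iI _ [a [b [ab H]]]] fi f0.
have : forall n, {ae mu, forall x, a n < x -> x <= b n -> f x = 0}.
  move=> n; have [Ia Ib] := ab n.
  apply: ae_eq0_itv; first exact: fi.
  move=> x ax xb; apply: f0 => //; apply: sub_itv Ia Ib _ _ => //.
  by rewrite /= in_itv/= ax xb.
move=> /ae_foralln; apply: filterS => x Hx /H[n [anx xbn]].
by apply: (Hx n) => //; exact: ltW.
Qed.

Lemma isder_prim (f : R -> R) (c x : R) : continuous f -> isder (prim c f) x (f x).
Proof.
move=> cf; have fi y z : itg `[y, z] f by apply: itg_continuous; exact: continuous_subspaceT.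
have H : isprim setT (prim c f) f by apply: isprim_prim.
apply: (@isprim_isder _ (x - 1) (x + 1)); [exact: isprimS H|lra|lra|exact: cf].
Qed.

(** Take [phi0] as the derivative of a smooth step [Phi] from 0 to 1, which has integral 1. The
    primitive of [chi], minus its total mass times [Phi], is then zero on both sides of a compact
    interval, hence a test function. *)
Lemma tst_split I : open_itv I -> exists2 phi0, tst I phi0 &
  forall chi, tst I chi -> exists2 psi, tst I psi &
    forall x, isder psi x (chi x - (\int[mu]_(y in I) chi y) * phi0 x).
Proof.
move=> oI; have [mI iI [x0 Ix0] [a [b [ab H]]]] := oI.
have [n [anx xbn]] := H x0 Ix0; have [Ia Ib] := ab n.
set a0 := a n in anx Ia *; set b0 := b n in xbn Ib *.
have ab0 : a0 < b0 by exact: lt_trans xbn.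
pose Phi x := step ((b0 - a0)^-1 * x + (- ((b0 - a0)^-1 * a0))).
have sPhi : smooth Phi by apply: smooth_affine; exact: smooth_step.
have PhiE x : Phi x = step ((x - a0) / (b0 - a0)) by rewrite /Phi; congr step; ring.
have Phi0 x : x <= a0 -> Phi x = 0.
  by move=> xa; rewrite PhiE step_eq0// mulr_le0_ge0 ?subr_le0// invr_ge0 subr_ge0 ltW.
have Phi1 x : b0 <= x -> Phi x = 1.
  by move=> bx; rewrite PhiE step_eq1// ler_pdivlMr ?subr_gt0// mul1r; lra.
exists (derive1 Phi).
  split; first exact: smooth_derive1.
  have [i [ai _]] := H a0 Ia; have [j [_ bj]] := H b0 Ib.
  exists (a i), (b j); split; [by have [] := ab i|by have [] := ab j| |].
    by rewrite ltW// (lt_trans ai)// (lt_trans ab0).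
  move=> x [xa|bx]; apply: isder_derive1.
  - apply: (isD_near (f := cst 0)); last exact: isDcst.
    near=> y; rewrite Phi0//; apply/ltW; near: y; apply: lt_nbhsl; exact: le_lt_trans ai.
  - apply: (isD_near (f := cst 1)); last exact: isDcst.
    near=> y; rewrite Phi1//; apply/ltW; near: y; apply: lt_nbhsr; exact: lt_le_trans bx.
move=> chi [schi [c [d [Ic Id cd chi0]]]].
pose m := \int[mu]_(y in I) chi y.
pose a1 := Num.min c a0; pose b1 := Num.max d b0.
have Ia1 : I a1 by rewrite /a1; case: ltP.
have Ib1 : I b1 by rewrite /b1; case: ltP.
have cchi := smooth_continuous schi.
have pchi := isder_prim a1 ^~ cchi.
have ip : isprim setT (prim a1 chi) chi by apply: isprim_C1 => // x; exact: pchi.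
have a1b1 : a1 <= b1 by rewrite /a1 /b1 ge_min (le_trans cd) ?orTb// le_max lexx.
have chia1 x : x <= a1 \/ b1 <= x -> chi x = 0.
  move=> [xa|bx]; apply: chi0; [left|right].
    by apply: le_trans xa _; rewrite /a1 ge_min lexx.
  by apply: le_trans bx; rewrite /b1 le_max lexx.
have mE : m = prim a1 chi b1.
  rewrite -[RHS]subr0 -(prim_base a1 chi).
  have [_ ->] := ip a1 b1 Logic.I Logic.I a1b1.
  have := Rint_supp (fun=> 1) iI Ia1 Ib1 chia1.
  rewrite /m; under eq_Rintegral do rewrite mul1r; move=> ->.
  by apply: eq_Rintegral => x _; rewrite mul1r.
have dpsi x : isder (fun x => prim a1 chi x + (- m) * Phi x) x (chi x - m * derive1 Phi x).
  apply: isder_eq; first by apply: isDD; [exact: pchi|apply: isDM; [exact: isDcst|exact: smooth_is_derive]].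
  by rewrite mulr0 addr0 mulNr.
exists (fun x => prim a1 chi x + (- m) * Phi x) => //; split.
  apply: smoothD; last by apply: smoothM => //; exact: smooth_cst.
  by apply: smooth_primitive schi => x; exact: pchi.
exists a1, b1; split => // x [xa|bx].
- rewrite Phi0 ?mulr0 ?addr0; last by apply: le_trans xa _; rewrite /a1 ge_min lexx orbT.
  have [_] := ip x a1 Logic.I Logic.I xa; rewrite prim_base sub0r => e.
  apply: oppr_inj; rewrite e oppr0 Rint_eq0//.
  by move=> t; rewrite /= in_itv/= => /andP[_ ta]; rewrite chia1//; left.
- rewrite Phi1 ?mulr1; last by apply: le_trans bx; rewrite /b1 le_max lexx orbT.
  have [_] := ip b1 x Logic.I Logic.I bx; rewrite mE => ->.
  rewrite Rint_eq0//.
  by move=> t; rewrite /= in_itv/= => /andP[ta _]; rewrite chia1//; right.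
Unshelve. all: by end_near. Qed.

End TestFunctions.

(** * The lemma of du Bois-Reymond, of first and of second order *)

Section WeakDerivative.
Context {R : realType}.
Local Notation mu := (@lebesgue_measure R).
Implicit Types (f g h u v w D V phi chi psi : R -> R) (I J : set R).

Definition wd I u g := forall phi, tst I phi ->
  \int[mu]_(x in I) (u x * derive1 phi x) = - \int[mu]_(x in I) (g x * phi x).

Lemma isprim_locitg I u w : is_interval I -> isprim I u w -> locitg I u.
Proof.
move=> iI uw x y Ix Iy; have uw' := isprimS (sub_itv iI Ix Iy) uw.
have [M HM] := isprim_bounded uw'.
by apply: (@itg_bounded _ _ _ x y M) => //; exact: isprim_measurable uw'.
Qed.

Lemma locitgS I J f : I `<=` J -> locitg J f -> locitg I f.
Proof. by move=> IJ fi x y /IJ Jx /IJ Jy; exact: fi. Qed.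

Lemma locitgB I f g : locitg I f -> locitg I g -> locitg I (fun x => f x - g x).
Proof. by move=> fi gi x y Ix Iy; apply: itgB; [by []|exact: fi|exact: gi]. Qed.

Lemma locitg_cst I (c : R) : locitg I (fun=> c).
Proof. by move=> x y _ _; apply: itg_continuous; apply: continuous_subspaceT => z; exact: cst_continuous. Qed.

Lemma isprim_wd I u w : open_itv I -> isprim I u w -> wd I u w.
Proof.
move=> oI uw phi tp; have [mI iI _ _] := oI.
have [a [b [Ia Ib ab p0 dp0]]] := tst_bounds oI tp.
rewrite (Rint_supp _ iI Ia Ib dp0) (Rint_supp _ iI Ia Ib p0).
have sp : smooth phi by case: tp.
have pp : isprim setT phi (derive1 phi).
  by apply: isprim_C1; [exact: smooth_is_derive|exact/smooth_continuous/smooth_derive1].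
have := IBP ab (isprimS (sub_itv iI Ia Ib) uw) (isprimS (@subsetT _ _) pp).
rewrite (p0 a); last by left. rewrite (p0 b); last by right.
rewrite !mulr0 subr0 => /eqP; rewrite addr_eq0 => /eqP ->.
by congr (- _); apply: eq_Rintegral => x _; rewrite mulrC.
Qed.

(* The lemma of du Bois-Reymond: every test function differs from a derivative
   of one by a multiple of a fixed test function. *)
Lemma wd_cst I D : open_itv I -> locitg I D ->
  (forall phi, tst I phi -> \int[mu]_(x in I) (D x * derive1 phi x) = 0) ->
  exists c, {ae mu, forall x, I x -> D x = c}.
Proof.
move=> oI Di D0; have [mI iI _ _] := oI.
have [phi0 t0 H] := tst_split oI.
pose C := \int[mu]_(x in I) (D x * phi0 x); exists C.
suff : {ae mu, forall x, I x -> D x - C = 0}.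
  by move=> /aeS; apply => x Hx /Hx /eqP; rewrite subr_eq0 => /eqP.
have DCi : locitg I (fun x => D x - C) by apply: locitgB => //; exact: locitg_cst.
apply: ae_eq0_open_itv => //; apply: Rint_tst_eq0 => // chi tchi.
have [psi tpsi dpsi] := H chi tchi.
have := D0 psi tpsi.
have i1 := itg_supp oI Di tchi; have i2 := itg_supp oI Di t0.
have i3 := itg_supp oI (@locitg_cst I 1) tchi.
set m := \int[mu]_(y in I) chi y in dpsi.
have mE : m = \int[mu]_(y in I) (1 * chi y) by apply: eq_Rintegral => x _; rewrite mul1r.
under eq_Rintegral => x _ do rewrite (isder_derive1 (dpsi x)).
have -> : \int[mu]_(x in I) (D x * (chi x - m * phi0 x)) =
    \int[mu]_(x in I) (D x * chi x) - m * C.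
  rewrite /C -RintegralZl// -RintegralB//; last exact: itgZ.
  by apply: eq_Rintegral => x _; ring.
move=> e; have -> : \int[mu]_(x in I) ((D x - C) * chi x) =
    \int[mu]_(x in I) (D x * chi x) - C * m.
  rewrite mE -RintegralZl// -RintegralB//; last exact: itgZ.
  by apply: eq_Rintegral => x _; ring.
by rewrite mulrC.
Qed.

(** The difference [u - v] has weak derivative zero. *)
Lemma wd_prim I u g v : open_itv I -> locitg I u -> wd I u g -> isprim I v g ->
  exists c, {ae mu, forall x, I x -> u x = v x + c}.
Proof.
move=> oI ui ug vg; have [mI iI _ _] := oI.
have vi := isprim_locitg iI vg.
have [|phi tp|c Hc] := @wd_cst I (fun x => u x - v x) oI; first exact: locitgB.
  have tdp := tst_derive1 oI tp.
  have -> : \int[mu]_(x in I) ((u x - v x) * derive1 phi x) =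
      \int[mu]_(x in I) (u x * derive1 phi x) - \int[mu]_(x in I) (v x * derive1 phi x).
    rewrite -RintegralB//; [|exact: itg_supp|exact: itg_supp].
    by apply: eq_Rintegral => x _; ring.
  by rewrite ug// (isprim_wd oI vg tp) subrr.
by exists c; move: Hc => /aeS; apply => x H /H <-; rewrite addrC subrK.
Qed.

(** No first weak derivative of [V] is assumed, as an element of the adjoint domain is only known
    through second derivatives of test functions. Subtracting a double primitive [K] of [h] leaves a
    function [D] that annihilates all second derivatives, and such a function is affine. *)
Lemma wd2_prim I V h : open_itv I -> locitg I V -> locitg setT h ->
  (forall phi, tst I phi -> \int[mu]_(x in I) (V x * derive1 (derive1 phi) x) =
     \int[mu]_(x in I) (h x * phi x)) ->
  exists v w, [/\ isprim setT v w, isprim setT w h & {ae mu, forall x, I x -> V x = v x}].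
Proof.
move=> oI Vi hi H; have [mI iI [x0 Ix0] _] := oI.
have kh : isprim setT (prim x0 h) h by apply: isprim_prim => // x y _ _; exact: hi.
have ki : locitg setT (prim x0 h).
  by apply: isprim_locitg kh => x y _ _ z _.
set k := prim x0 h in kh ki.
have Kk : isprim setT (prim x0 k) k by apply: isprim_prim => // x y _ _; exact: ki.
have Ki : locitg setT (prim x0 k) by apply: isprim_locitg Kk => x y _ _ z _.
set K := prim x0 k in Kk Ki.
pose D x := V x - K x.
have Di : locitg I D by apply: locitgB => //; exact: locitgS Ki.
have D0 phi : tst I phi -> \int[mu]_(x in I) (D x * derive1 (derive1 phi) x) = 0.
  move=> tp; have tdp := tst_derive1 oI tp; have tddp := tst_derive1 oI tdp.
  have KI := locitgS (@subsetT _ I) Ki.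
  have -> : \int[mu]_(x in I) (D x * derive1 (derive1 phi) x) =
     \int[mu]_(x in I) (V x * derive1 (derive1 phi) x) -
     \int[mu]_(x in I) (K x * derive1 (derive1 phi) x).
    rewrite -RintegralB//; [|exact: itg_supp|exact: itg_supp].
    by apply: eq_Rintegral => x _; rewrite /D; ring.
  rewrite H// (isprim_wd oI (isprimS (@subsetT _ _) Kk) tdp).
  by rewrite (isprim_wd oI (isprimS (@subsetT _ _) kh) tp) !opprK subrr.
have [phi0 t0 S] := tst_split oI.
pose C := \int[mu]_(x in I) (D x * derive1 phi0 x).
have idp : isprim setT (fun x : R => C * x) (fun=> C).
  apply: isprim_C1; last by move=> x; exact: cst_continuous.
  move=> x; apply: isder_eq; first by apply: isDM; [exact: isDcst|exact: isDid].
  by rewrite mulr1 mulr0 addr0.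
(* The slope of [D] must be [- C]. With [phi = psi' + m * phi0], the integral of [D * phi'] is
   [m * C], since [D] annihilates [psi'']; the integral of [C * x * phi'] is [- C * m]. The sum
   therefore has weak derivative zero. *)
have [|phi tp|c Hc] := @wd_cst I (fun x => D x + C * x) oI.
- move=> x y Ix Iy; apply: itgD => //; first exact: Di.
  by apply: (isprim_locitg _ idp) => // ? ? _ _ ? _.
- have [psi tpsi dpsi] := S phi tp.
  set m := \int[mu]_(y in I) phi y in dpsi.
  have tdp := tst_derive1 oI tp; have tdp0 := tst_derive1 oI t0.
  have i1 := itg_supp oI Di tdp; have i2 := itg_supp oI Di tdp0.
  have sphi0 : smooth phi0 by case: t0.
  have sphi : smooth phi by case: tp.
  have e1 : \int[mu]_(x in I) (D x * derive1 phi x) = m * C.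
    have := D0 psi tpsi.
    have -> : derive1 psi = fun x => phi x + (- m) * phi0 x.
      by apply/funext => x; rewrite (isder_derive1 (dpsi x)) mulNr.
    under eq_Rintegral => x _.
      rewrite (@isder_derive1 _ _ x (derive1 phi x + (- m) * derive1 phi0 x)); last first.
        apply: isder_eq; first by apply: isDD; [exact: smooth_is_derive|apply: isDM; [exact: isDcst|exact: smooth_is_derive]].
        by rewrite mulr0 addr0.
      over.
    have -> : \int[mu]_(x in I) (D x * (derive1 phi x + (- m) * derive1 phi0 x)) =
       \int[mu]_(x in I) (D x * derive1 phi x) - m * C.
      rewrite /C -RintegralZl// -RintegralB//; last exact: itgZ.
      by apply: eq_Rintegral => x _; ring.
    by move/eqP; rewrite subr_eq0 => /eqP.
  have i3 : itg I (fun x => C * x * derive1 phi x).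
    apply: itg_supp => //; apply: (isprim_locitg _ (isprimS (@subsetT _ _) idp)) => //.
  have -> : \int[mu]_(x in I) ((D x + C * x) * derive1 phi x) =
      \int[mu]_(x in I) (D x * derive1 phi x) + \int[mu]_(x in I) (C * x * derive1 phi x).
    by rewrite -RintegralD//; apply: eq_Rintegral => x _; ring.
  rewrite e1 (isprim_wd oI (isprimS (@subsetT _ _) idp) tp).
  have i4 := itg_supp oI (@locitg_cst I 1) tp.
  have -> : \int[mu]_(x in I) (C * phi x) = C * m.
    have -> : m = \int[mu]_(x in I) (1 * phi x) by apply: eq_Rintegral => x _; rewrite mul1r.
    by rewrite -RintegralZl//; apply: eq_Rintegral => x _; rewrite mul1r.
  by rewrite mulrC subrr.
exists (fun x => (K x + (-1) * (C * x)) + c), (fun x => (k x + (-1) * C) + 0); split.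
- apply: isprimD; last exact: isprim_cst.
  by apply: isprimD => //; exact: isprimZ.
- have H1 : isprim setT (fun=> (-1) * C) (fun=> (0:R)) by exact: isprim_cst.
  have H2 : isprim setT (fun=> (0:R)) (fun=> (0:R)) by exact: isprim_cst.
  have := isprimD (isprimD kh H1) H2.
  by congr isprim; apply/funext => x; rewrite !addr0.
- by move: Hc => /aeS; apply => x Hx /Hx <-; rewrite /D; ring.
Qed.

End WeakDerivative.

(** * Reflection at the origin, which transports results from one half-line to the other *)

Section Reflection.
Context {R : realType}.
Local Notation mu := (@lebesgue_measure R).
Implicit Types (f g h u v w F : R -> R) (A J : set R).

Definition oppset A : set R := [set x | A (- x)].

Lemma measurable_fun_opp : measurable_fun setT (fun x : R => - x).
Proof. by apply: continuous_measurable_fun; exact: opp_continuous. Qed.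

Lemma measurable_oppset A : measurable A -> measurable (oppset A).
Proof.
by move=> mA; rewrite -[X in measurable X]setTI; exact: measurable_fun_opp.
Qed.

Lemma oppset_itv (x y : R) : oppset `[x, y] = `[- y, - x]%classic.
Proof. by apply/seteqP; split => t /=; rewrite !in_itv/= lerNl lerNr andbC. Qed.

(** By uniqueness of Lebesgue measure it suffices to compare half-open intervals; reflection moves
    the closed end from right to left but keeps the length. *)
Lemma lebesgue_measure_opp A : measurable A -> mu (oppset A) = mu A.
Proof.
move=> mA.
pose T := measurableTypeR R.
have mo : measurable_fun [set: T] ((fun x : R => - x) : T -> T) by exact: measurable_fun_opp.
pose nu := measure_function_pushforward__canonical__measure_function_Measure mu mo.
suff H : forall X, ocitv X -> mu X = nu X by rewrite (lebesgue_measure_unique H mA).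
move=> X [[a b] _ <-] /=; rewrite /pushforward.
have -> : ((fun x : R => - x) @^-1` `]a, b]) = `[- b, - a[%classic.
  by apply/seteqP; split => t /=; rewrite !in_itv/= ltrNr lerNl andbC.
have e1 : mu `]a, b] = mu `[- b, - a[.
  rewrite !lebesgue_measure_itv/= !lte_fin ltrN2; case: ifP => // _.
  by congr EFin; rewrite opprK addrC.
exact: e1.
Qed.

Lemma ge0_integral_opp A (f : R -> \bar R) : measurable A -> measurable_fun A f ->
  (forall x, A x -> (0 <= f x)%E) ->
  (\int[mu]_(x in oppset A) f (- x)%R = \int[mu]_(x in A) f x)%E.
Proof.
move=> mA mf f0.
have f0' : {in A, forall y, (0 <= f y)%E} by move=> x /set_mem; exact: f0.
pose T := measurableTypeR R.
have mo : measurable_fun [set: T] ((fun x : R => - x) : T -> T) by exact: measurable_fun_opp.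
rewrite -(@ge0_integral_pushforward _ _ T T R _ mo mu A f mA mf f0').
by apply: eq_measure_integral => B mB _; exact: lebesgue_measure_opp.
Qed.

Lemma measurable_fun_oppset d (T : measurableType d) A (f : R -> T) : measurable A ->
  measurable_fun A f -> measurable_fun (oppset A) (fun x => f (- x)).
Proof.
move=> mA mf; apply: (@measurable_comp _ _ _ _ _ _ A f) => //.
  by move=> _ [x Ax <-].
Qed.

Lemma itg_opp A f : measurable A -> itg A f -> itg (oppset A) (fun x => f (- x)).
Proof.
move=> mA /integrableP[mf fi]; apply/integrableP; split.
  exact: (measurable_fun_oppset mA mf).
have := @ge0_integral_opp A (fun x => `|(f x)%:E|%E) mA _ (fun _ _ => abse_ge0 _).
rewrite /comp => ->//; by apply: measurableT_comp.
Qed.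

Lemma Rint_opp A f : measurable A -> itg A f ->
  \int[mu]_(x in oppset A) f (- x) = \int[mu]_(x in A) f x.
Proof.
move=> mA fi; rewrite /Rintegral; congr fine.
have mfi := measurable_int _ fi.
rewrite integralE [RHS]integralE; congr (_ - _)%E.
- have H := ge0_integral_opp mA (measurable_funepos mfi) (fun x _ => funepos_ge0 _ x).
  by apply: (etrans _ H); apply: eq_integral => x _; rewrite !funeposE.
- have H := ge0_integral_opp mA (measurable_funeneg mfi) (fun x _ => funeneg_ge0 _ x).
  by apply: (etrans _ H); apply: eq_integral => x _; rewrite !funenegE.
Qed.

Lemma L2_opp A f : measurable A -> L2 A f -> L2 (oppset A) (fun x => f (- x)).
Proof.
by move=> mA [mf fi]; split; [exact: measurable_fun_oppset|exact: (itg_opp mA fi)].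
Qed.

Lemma isprim_opp J F f : isprim J F f ->
  isprim (oppset J) (fun x => F (- x)) (fun x => - f (- x)).
Proof.
move=> Ff x y Jx Jy xy.
have [] := Ff (- y) (- x) Jy Jx _; first by rewrite lerN2.
move=> fi e; have m : measurable (`[- y, - x]%classic : set R) by exact: measurable_itv.
have fo := itg_opp m fi; rewrite oppset_itv !opprK in fo.
split; first exact: itgN.
have -> : \int[mu]_(t in `[x, y]) (- f (- t)) = - \int[mu]_(t in `[x, y]) (f (- t)).
  by rewrite -mulN1r -RintegralZl//; apply: eq_Rintegral => t _; rewrite mulN1r.
have := Rint_opp m fi; rewrite oppset_itv !opprK => ->.
by rewrite -e opprB.
Qed.

End Reflection.

(** * Green's formula on closed half-lines *)

Section HalfLine.
Context {R : realType}.
Local Notation mu := (@lebesgue_measure R).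
Implicit Types (f g h u v w B : R -> R).

Definition Jp : set R := `[0, +oo[%classic.
Definition Jm : set R := `]-oo, 0]%classic.

Lemma Jp_itv (x y : R) : 0 <= x -> `[x, y] `<=` Jp.
Proof. by move=> x0 t; rewrite /Jp /= !in_itv/= andbT => /andP[xt _]; exact: le_trans xt. Qed.

Lemma JpP (x : R) : Jp x <-> 0 <= x.
Proof. by rewrite /Jp /= in_itv/= andbT. Qed.

Lemma measurable_Jp : measurable Jp. Proof. exact: measurable_itv. Qed.
Hint Resolve measurable_Jp : core.

Lemma Rint_cst_itv (a b c : R) : a <= b -> \int[mu]_(x in `[a, b]) c = c * (b - a).
Proof.
move=> ab; rewrite Rintegral_cst//; congr (_ * _).
suff e : mu `[a, b] = (b - a)%:E by rewrite [X in fine X]e.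
rewrite lebesgue_measure_itv/= lte_fin; case: ltP => [_|ba]; first by rewrite -EFinD.
have -> : a = b by apply/eqP; rewrite eq_le ab.
by rewrite subrr.
Qed.

(** Used to show that limits at infinity vanish: an integrable function cannot stay away from zero
    on a set of infinite measure. *)
Lemma not_itg_Jp B (d X : R) : 0 < d -> 0 <= X -> itg Jp B ->
  (forall x, X <= x -> d <= `|B x|) -> False.
Proof.
move=> d0 X0 Bi dB.
have sub : `[X, +oo[ `<=` Jp by move=> t; rewrite /Jp /= !in_itv/= !andbT; exact: le_trans.
have Bi' : itg `[X, +oo[ B by exact: itgS Bi.
have /integrableP[_] := Bi'; rewrite ltNge => /negP; apply.
apply: (@le_trans _ _ (\int[mu]_(x in `[X, +oo[) d%:E)%E).
  have muE : mu `[X, +oo[ = +oo%E by rewrite lebesgue_measure_itv/= ltry addye.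
  by rewrite integral_cst// [X in (_ * X)%E]muE mulry gtr0_sg// mul1e.
apply: ge0_le_integral => //.
- by move=> x _; rewrite lee_fin ltW.
- by apply: measurableT_comp => //; exact: measurable_int Bi'.
- by move=> x; rewrite /= in_itv/= andbT => Xx; rewrite lee_fin dB.
Qed.

Lemma cvg_Rint_Jp f : itg Jp f ->
  \int[mu]_(x in `[0, n%:R]) f x @[n --> \oo] --> \int[mu]_(x in Jp) f x.
Proof.
move=> fi; have mf := itg_measurable fi.
have sub (n : nat) : `[0, n%:R] `<=` Jp by exact: Jp_itv.
have [] := @dominated_convergence _ _ _ mu Jp measurable_Jp
  (fun n x => ((f \_ `[0, n%:R]) x)%:E) (EFin \o f) (fun x => `|f x|%:E).
- move=> n; apply/measurable_EFinP/measurable_restrict => //.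
  by apply: measurable_funS mf; [exact: measurable_Jp|exact: subIsetl].
- exact: measurable_int fi.
- apply: aeW => x /JpP x0; apply: cvg_EFin; first exact: nearW.
  apply: (@cvg_near_cst _ _ (f x)); near=> n; rewrite /= patchR mem_set//= in_itv/= x0/=.
  by near: n; exact: nbhs_infty_ger.
- exact: integrable_norm.
- apply: aeW => x n _ /=; rewrite lee_fin patchR; case: ifP => // _.
  by rewrite normr0.
move=> _ _ H; apply: fine_cvg; rewrite /= fineK; last exact: integrable_fin_num.
apply: cvg_trans H; apply: near_eq_cvg; apply: nearW => n /=.
rewrite -[in RHS](setIidr (sub n)) [RHS]integral_mkcondr.
by apply: eq_integral => x _; rewrite restrict_EFin.
Unshelve. all: by end_near. Qed.

Lemma Rint_itv_mono f (a b c : R) : a <= b -> b <= c -> itg `[a, c] f ->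
  (forall x, b <= x -> 0 <= f x) ->
  \int[mu]_(x in `[a, b]) f x <= \int[mu]_(x in `[a, c]) f x.
Proof.
move=> ab bc fi f0; rewrite (Rint_itvD ab bc fi) lerDl; apply: Rintegral_ge0 => x.
by rewrite /= in_itv/= => /andP[bx _]; exact: f0.
Qed.

(** Dominated convergence gives the limit along the integers; since the tails of [|f|] decrease, the
    bound at one integer holds for all larger real [x]. *)
Lemma Rint_tail_Jp f (e : R) : itg Jp f -> 0 < e -> exists2 X, 0 <= X &
  forall x, X <= x -> `|\int[mu]_(t in `[0, x]) f t - \int[mu]_(t in Jp) f t| <= e.
Proof.
move=> fi e0; have ni : itg Jp (fun x => `|f x|) by exact: integrable_norm.
have /cvgrPdist_le /(_ e e0) [N _ HN] := cvg_Rint_Jp ni.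
exists N%:R => // x Nx; have x0 : 0 <= x by exact: le_trans Nx.
have tail g : itg Jp g -> \int[mu]_(t in Jp) g t - \int[mu]_(t in `[0, x]) g t =
    \int[mu]_(t in `]x, +oo[) g t.
  by move=> gi; rewrite -(@Rintegral_itvB _ g (BLeft 0) +oo%O x)// bnd_simp.
have sub : `]x, +oo[ `<=` Jp.
  by move=> t; rewrite /Jp /= !in_itv/= !andbT => /ltW; exact: le_trans.
rewrite distrC tail//; apply: le_trans.
  by apply: le_normr_Rintegral => //; exact: itgS fi.
rewrite -tail//; apply: le_trans (HN N (leqnn N)).
apply: le_trans (ler_norm _); rewrite lerD2l lerN2.
by apply: Rint_itv_mono => //; apply: itgS ni => //; exact: Jp_itv.
Qed.

(* If the integral of [w ^+ 2] were infinite, [v * w = (v ^+ 2)^`() / 2] would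
   tend to infinity, hence so would [v ^+ 2]. *)
Lemma primitive_L2_Jp v w h : isprim Jp v w -> isprim Jp w h ->
  L2 Jp v -> L2 Jp h -> L2 Jp w.
Proof.
move=> vw wh v2 h2.
have mw : measurable_fun Jp w.
  rewrite /Jp itv_bndy_bigcup_BRight; apply/measurable_fun_bigcup => // n.
  by rewrite add0r; apply: (isprim_measurable (f := h)); exact: isprimS (Jp_itv (lexx _)) wh.
apply: L2P => //; rewrite ltNge; apply/negP => woo.
pose Q (x : R) := \int[mu]_(t in `[0, x]) (w t ^+ 2).
have w2i (x : R) : itg `[0, x] (fun t => w t ^+ 2).
  apply: (eq_itg (f := fun t => w t * w t)) => [t _|]; first by rewrite expr2.
  have ww := isprimS (Jp_itv (lexx 0)) wh; apply: (isprim_itgM (ww x)).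
  have [M HM] := isprim_bounded (ww x).
  by apply: (itg_bounded (a := 0) (b := x) _ _ _ HM) => //; exact: isprim_measurable (ww x).
have Qoo (M : R) : exists n : nat, M <= Q n%:R.
  have nd : nondecreasing_seq (fun n : nat => `[0 : R, n%:R]%classic).
    move=> m n mn; apply/subsetPset => t; rewrite /= !in_itv/= => /andP[-> tm].
    by rewrite (le_trans tm)// ler_nat.
  have := @ge0_nondecreasing_set_cvg_integral _ (measurableTypeR R) R (fun n : nat => `[0 : R, n%:R]%classic)
    (fun t => (w t ^+ 2)%:E) mu nd (fun n => measurable_itv _)
    (fun n => measurable_int _ (w2i n%:R)) (fun n t _ => sqr_ge0 _).
  have JpE : (\bigcup_n `[0 : R, n%:R]%classic) = Jp.
    by rewrite /Jp itv_bndy_bigcup_BRight; apply: eq_bigcupr => n _; rewrite add0r.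
  rewrite JpE.
  have -> : (\int[mu]_(t in Jp) (w t ^+ 2)%:E = +oo)%E by apply/eqP; rewrite eq_le leey.
  move=> /cvgeyPge /(_ M) [n _ /(_ n (leqnn n))] /= Mn; exists n.
  by move: Mn; rewrite EFin_Rint// lee_fin.
pose C := \int[mu]_(t in Jp) `|v t * h t|.
have vhi : itg Jp (fun t => v t * h t) by exact: L2M.
have nvhi : itg Jp (fun t => `|v t * h t|) by exact: integrable_norm.
have key (x : R) : 0 <= x -> v 0 * w 0 + Q x - C <= v x * w x.
  move=> x0; have s := @Jp_itv 0 x (lexx 0).
  have vh' : itg `[0, x] (fun t => v t * h t) by exact: itgS vhi.
  have := IBP x0 (isprimS s vw) (isprimS s wh).
  have -> : \int[mu]_(t in `[0, x]) (w t * w t) = Q x.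
    by apply: eq_Rintegral => t _; rewrite expr2.
  have : - C <= \int[mu]_(t in `[0, x]) (v t * h t).
    rewrite lerNl; apply: le_trans (ler_norm _) _; rewrite normrN.
    apply: le_trans; first exact: le_normr_Rintegral.
    apply: fine_le; [exact: integrable_fin_num (integrable_norm vh')|exact: integrable_fin_num|].
    by apply: ge0_subset_integral => //; exact: measurable_int nvhi.
  clearbody C Q; lra.
(* With this threshold [key] yields [v * w >= 1] from [N] on. As [v ^+ 2] has derivative
   [2 * v * w], it is then at least 2 from [N + 1] on, against integrability. *)
have [N HN] := Qoo (1 + C - v 0 * w 0).
have vw1 (x : R) : N%:R <= x -> 1 <= v x * w x.
  move=> Nx; have x0 : 0 <= x by exact: le_trans Nx.
  have : Q N%:R <= Q x by apply: Rint_itv_mono => // t _; exact: sqr_ge0.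
  by have := key x x0; lra.
have v2i : itg Jp (fun x => v x ^+ 2) by case: v2.
apply: (@not_itg_Jp _ 2 (N%:R + 1) _ _ v2i) => //.
move=> x Nx; have Nx' : N%:R <= x by lra.
have s : `[N%:R, x] `<=` Jp by exact: Jp_itv.
have := IBP Nx' (isprimS s vw) (isprimS s vw).
have vwi : itg `[N%:R, x] (fun t => v t * w t).
  apply: isprim_itgM; first exact: isprimS s vw.
  by have [] := vw N%:R x; rewrite ?JpP//; exact: le_trans Nx'.
have : x - N%:R <= \int[mu]_(t in `[N%:R, x]) (v t * w t).
  have -> : x - N%:R = \int[mu]_(t in `[N%:R, x]) 1.
    by rewrite Rint_cst_itv// mul1r.
  apply: le_Rintegral => //.
    by apply: itg_continuous; apply: continuous_subspaceT => z; exact: cst_continuous.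
  by move=> t; rewrite /= in_itv/= => /andP[Nt _]; exact: vw1.
move=> h1 h2'; rewrite ger0_norm ?sqr_ge0// expr2.
have := sqr_ge0 (v N%:R); rewrite expr2; lra.
Qed.

(** The Sobolev space of order two on a closed half-line. Here [w] is the continuous representative
    of the derivative, so [w 0] is the one-sided derivative at the endpoint, while [h] matters only
    up to null sets. *)
Definition H2on J u w h := [/\ isprim J u w, isprim J w h & [/\ L2 J u, L2 J w & L2 J h]].

(** Integration by parts up to [x] leaves the boundary function [B] at [x]. It converges as [x]
    tends to infinity, and being a combination of products of square-integrable functions it is
    integrable, so its limit is zero. *)
Lemma green_Jp u w h u2 w2 h2 : H2on Jp u w h -> H2on Jp u2 w2 h2 ->
  \int[mu]_(x in Jp) (u x * h2 x - h x * u2 x) = w 0 * u2 0 - u 0 * w2 0.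
Proof.
move=> [uw wh [uL wL hL]] [uw2 wh2 [uL2 wL2 hL2]].
pose B x := u x * w2 x - w x * u2 x.
have Bi : itg Jp B by apply: itgB => //; exact: L2M.
pose q x := u x * h2 x - h x * u2 x.
have qi : itg Jp q by apply: itgB => //; exact: L2M.
have qE x : 0 <= x -> \int[mu]_(t in `[0, x]) q t = B x - B 0.
  move=> x0; have s := @Jp_itv 0 x (lexx 0).
  have m1 : itg `[0, x] (fun t => u t * h2 t) by apply: itgS (L2M _ uL hL2).
  have m2 : itg `[0, x] (fun t => h t * u2 t) by apply: itgS (L2M _ hL uL2).
  have m3 : itg `[0, x] (fun t => w2 t * w t) by apply: itgS (L2M _ wL2 wL).
  rewrite /q RintegralB//.
  have := IBP x0 (isprimS s uw) (isprimS s wh2).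
  have := IBP x0 (isprimS s uw2) (isprimS s wh).
  have -> : \int[mu]_(t in `[0, x]) (w2 t * w t) = \int[mu]_(t in `[0, x]) (w t * w2 t).
    by apply: eq_Rintegral => t _; rewrite mulrC.
  have -> : \int[mu]_(t in `[0, x]) (u2 t * h t) = \int[mu]_(t in `[0, x]) (h t * u2 t).
    by apply: eq_Rintegral => t _; rewrite mulrC.
  rewrite /B; lra.
apply/eqP; rewrite -subr_eq0; apply/negP => /negP d0.
(* This difference of the two sides equals the integral of [q] plus [B 0], that is, the limit of [B]
   at infinity. *)
set d := (X in X != 0) in d0.
have d0' : 0 < `|d| / 2 by rewrite divr_gt0// normr_gt0.
have [X X0 HX] := Rint_tail_Jp qi d0'.
apply: (@not_itg_Jp B (`|d| / 2) X) => // x Xx.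
have := HX x Xx; rewrite qE ?(le_trans X0 Xx)//.
have -> : B x - B 0 - \int[mu]_(t in Jp) q t = B x - d by rewrite /d /B /q; ring.
move=> H; have := ler_distD (B x) d 0; rewrite !subr0 distrC.
lra.
Qed.

Lemma oppset_Jm : oppset Jm = Jp.
Proof. by apply/seteqP; split => x; rewrite /oppset /Jm /Jp /= !in_itv/= andbT oppr_le0. Qed.

Lemma oppset_Jp : oppset Jp = Jm.
Proof. by apply/seteqP; split => x; rewrite /oppset /Jm /Jp /= !in_itv/= andbT oppr_ge0. Qed.

Lemma measurable_Jm : measurable Jm. Proof. exact: measurable_itv. Qed.

Lemma H2on_opp J u w h : measurable J -> H2on J u w h ->
  H2on (oppset J) (fun x => u (- x)) (fun x => - w (- x)) (fun x => h (- x)).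
Proof.
move=> mJ [uw wh [u2 w2 h2]]; have mo := measurable_oppset mJ; split.
- exact: isprim_opp uw.
- have := isprimZ (-1) (isprim_opp wh).
  by congr isprim; apply/funext => x; rewrite mulN1r ?opprK.
- by split; [exact: L2_opp|apply: L2N => //; exact: L2_opp|exact: L2_opp].
Qed.

Lemma green_Jm u w h u2 w2 h2 : H2on Jm u w h -> H2on Jm u2 w2 h2 ->
  \int[mu]_(x in Jm) (u x * h2 x - h x * u2 x) = - (w 0 * u2 0 - u 0 * w2 0).
Proof.
move=> H H'; have := green_Jp _ _.
have K := H2on_opp measurable_Jm H; have K' := H2on_opp measurable_Jm H'.
rewrite oppset_Jm in K K'; move=> /(_ _ _ _ _ _ _ K K').
have [_ _ [uL _ hL]] := H; have [_ _ [uL2 _ hL2]] := H'.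
have mJm := measurable_Jm.
have qi : itg Jm (fun x => u x * h2 x - h x * u2 x) by apply: itgB => //; exact: L2M.
by rewrite -oppset_Jm (Rint_opp mJm qi) !oppr0 => ->; ring.
Qed.

Lemma primitive_L2_Jm v w h : isprim Jm v w -> isprim Jm w h ->
  L2 Jm v -> L2 Jm h -> L2 Jm w.
Proof.
move=> vw wh v2 h2; have mJm := measurable_Jm; have mJp := measurable_Jp.
have := @primitive_L2_Jp (fun x => v (- x)) (fun x => - w (- x)) (fun x => h (- x)).
have e1 := isprim_opp vw.
have e2 : isprim (oppset Jm) (fun x => - w (- x)) (fun x => h (- x)).
  have := isprimZ (-1) (isprim_opp wh).
  by congr isprim; apply/funext => x; rewrite mulN1r ?opprK.
have e3 := L2_opp mJm v2; have e4 := L2_opp mJm h2.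
rewrite oppset_Jm in e1 e2 e3 e4; move=> /(_ e1 e2 e3 e4) e5.
have := L2_opp mJp (L2N mJp e5); rewrite oppset_Jp.
by apply: eq_L2 => x _; rewrite !opprK.
Qed.

Lemma JmUJp : Jm `|` Jp = setT.
Proof.
apply/seteqP; split => // x _; rewrite /Jm /Jp /= !in_itv/= andbT.
by have [|/ltW] := leP x 0; [left|right].
Qed.

Lemma L2_setT f : L2 Jm f -> L2 Jp f -> L2 setT f.
Proof. by rewrite -JmUJp; apply: L2U; [exact: measurable_Jm|exact: measurable_Jp]. Qed.

Lemma Rint_setT f : itg setT f ->
  \int[mu]_x f x = \int[mu]_(x in Jm) f x + \int[mu]_(x in Jp) f x.
Proof.
move=> fi.
have mN : measurable (`]-oo, 0[%classic : set R) by exact: measurable_itv.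
have E : `]-oo, 0[%classic `|` Jp = setT.
  apply/seteqP; split => // x _; rewrite /Jp /= !in_itv/= andbT.
  by have [|] := ltP x 0; [left|right].
rewrite -{1}E Rintegral_setU//.
- by rewrite Rintegral_itv_bndo_bndc//; exact: itgS fi.
- by rewrite E.
- by apply/disj_setPS => x [] ; rewrite /Jp /= !in_itv/= andbT => h1 h2; move: h1; rewrite ltNge h2.
Qed.

End HalfLine.

(** * From weak derivatives on an open half-line to double primitives on the closed one, and back *)

Section Sides.
Local Open Scope complex_scope.
Context {R : realType}.
Local Notation mu := (@lebesgue_measure R).
Implicit Types (f g h u v w phi : R -> R) (U G : R -> R[i]) (I J : set R).

(* [J] is the closed half-line whose interior is [I]. *)
Definition side I J := [/\ open_itv I, measurable J, is_interval J,
  (I `<=` J /\ forall x, J x -> I x \/ x = 0) &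
  forall x, J x -> forall e, 0 < e -> exists a b, a < b /\
    forall y, a < y -> y < b -> I y /\ `|x - y| < e].

Lemma side_pos : side (@half_pos R) Jp.
Proof.
split; [exact: open_itv_half_pos|exact: measurable_Jp|exact: interval_is_interval| |].
  split=> x; rewrite JpP /half_pos /=; first exact: ltW.
  by rewrite le_eqVlt => /predU1P[<-|]; [right|left].
move=> x /JpP x0 e e0; exists x, (x + e); split; first by rewrite ltrDl.
move=> y xy ye; split; first exact: le_lt_trans xy.
by rewrite distrC ger0_norm; lra.
Qed.

Lemma JmP (x : R) : Jm x <-> x <= 0.
Proof. by rewrite /Jm /= in_itv/=. Qed.

Lemma side_neg : side (@half_neg R) Jm.
Proof.
split; [exact: open_itv_half_neg|exact: measurable_Jm|exact: interval_is_interval| |].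
  split=> x; rewrite JmP /half_neg /=; first exact: ltW.
  by rewrite le_eqVlt => /predU1P[->|]; [right|left].
move=> x /JmP x0 e e0; exists (x - e), x; split; first by rewrite ltrBlDr ltrDl.
move=> y xy ye; split; first exact: lt_le_trans x0.
by rewrite ger0_norm; lra.
Qed.

(** If the functions differed at a point of [J], by continuity they would differ on a nonempty open
    interval of [I] close to it, which has positive measure. This reaches the endpoint of [J], which
    is not in [I]. *)
Lemma ae_eq_continuous I J (F G : R -> R) : side I J -> continuous F -> continuous G ->
  {ae mu, forall x, I x -> F x = G x} -> forall x : R, J x -> F x = G x :> R.
Proof.
move=> [_ _ _ _ near] cF cG [N [mN N0 FG]] x Jx; apply/eqP; rewrite -subr_eq0.
apply: contraT => Fx.
have cD : {for x, continuous (fun y => F y - G y)} by apply: continuousB; [exact: cF|exact: cG].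
have Fx0 : 0 < `|F x - G x| by rewrite normr_gt0.
have /nbhs_ballP[e /= e0 He] : \forall y \near x, F y - G y != 0.
  near=> y; rewrite -normr_gt0.
  have : `|F x - G x - (F y - G y)| < `|F x - G x|.
    by near: y; move/cvgrPdist_lt : cD; exact.
  have := ler_distD (F y - G y) (F x - G x) 0; rewrite !subr0; lra.
have [a [b [ab Hab]]] := near x Jx e e0.
have sub : `]a, b[ `<=` N.
  move=> y /=; rewrite in_itv/= => /andP[ay yb]; have [Iy xy] := Hab y ay yb.
  by apply: FG => /= /(_ Iy) /eqP; rewrite -subr_eq0; apply/negP/He.
have : (mu `]a, b[ <= 0)%E by rewrite -N0; apply: le_measure; rewrite ?inE.
have -> : mu `]a, b[ = (b - a)%:E by rewrite lebesgue_measure_itv/= lte_fin ab EFinD.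
by rewrite lee_fin leNgt subr_gt0 ab.
Unshelve. all: by end_near. Qed.

Lemma side_L2 I J f : side I J -> L2 I f -> L2 J f.
Proof.
move=> [[mI iI _ _] mJ iJ [IJ JI] _] f2.
have E : I `|` (J `&` [set 0]) = J.
  apply/seteqP; split => x; first by case=> [/IJ|[]].
  by move=> Jx; have [Ix|x0] := JI x Jx; [left|right].
have m0 : measurable (J `&` [set 0] : set R) by apply: measurableI.
rewrite -E; apply: L2U => //.
apply: (@L2S _ _ [set 0]) => //.
split; first exact: measurable_fun_set1.
apply: null_set_integrable => //; last exact: lebesgue_measure_set1.
exact: measurable_fun_set1.
Qed.

Lemma isprim_continuous (F f : R -> R) : isprim setT F f -> continuous F.
Proof.
move=> Ff x; have ab : x - 1 < x + 1 by lra.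
have /(continuous_within_itvP _ ab)[+ _ _] := isprim_cvg ab (isprimS (@subsetT _ _) Ff).
by apply; rewrite in_itv/=; apply/andP; split; lra.
Qed.

Lemma L2_locitg I f : measurable I -> is_interval I -> L2 I f -> locitg I f.
Proof.
move=> mI iI f2 x y Ix Iy; apply: (@L2_itg _ _ _ x y) => //.
by apply: L2S f2 => //; exact: sub_itv.
Qed.

Lemma L2_patch I f : measurable I -> L2 I f -> L2 setT (f \_ I).
Proof.
move=> mI [mf fi]; split; first by apply/(measurable_restrictT f).
apply: (@eq_itg _ _ ((fun x => f x ^+ 2) \_ I)); last exact: itg_patch.
by move=> x _; rewrite !patchR; case: ifP => // _; rewrite expr0n.
Qed.

Lemma wd_ae_eq I u v g : open_itv I -> locitg I g -> locitg I v -> measurable_fun I g ->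
  measurable_fun I v ->
  {ae mu, forall x, I x -> g x = v x} -> forall phi, tst I phi ->
  \int[mu]_(x in I) (g x * phi x) = \int[mu]_(x in I) (v x * phi x).
Proof.
move=> oI gi vi mg mv gv phi tp; have [mI _ _ _] := oI.
have mp : measurable_fun I phi.
  by apply: measurable_funTS; apply: continuous_measurable_fun; apply: smooth_continuous; case: tp.
apply: ae_eq_Rint => //; try exact: measurable_funM.
by move: gv => /aeS; apply => x Hx Ix; rewrite Hx.
Qed.

Lemma wd_unique I u g1 g2 : open_itv I -> locitg I g1 -> locitg I g2 ->
  wd I u g1 -> wd I u g2 -> {ae mu, forall x, I x -> g1 x = g2 x}.
Proof.
move=> oI i1 i2 w1 w2.
suff : {ae mu, forall x, I x -> g1 x - g2 x = 0}.
  by move=> /aeS; apply => x Hx /Hx /eqP; rewrite subr_eq0 => /eqP.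
have i12 := locitgB i1 i2.
apply: ae_eq0_open_itv => //; apply: Rint_tst_eq0 => // phi tp.
have := w1 phi tp; rewrite w2// => /oppr_inj e.
have [mI _ _ _] := oI.
rewrite (_ : \int[mu]_(x in I) _ = \int[mu]_(x in I) (g1 x * phi x - g2 x * phi x)).
  by rewrite RintegralB//; [rewrite e subrr|exact: itg_supp|exact: itg_supp].
by apply: eq_Rintegral => x _; ring.
Qed.

(** The second weak derivative is integrated twice, each time fixing a constant with [wd_prim].
    Continuity of [u] upgrades the almost everywhere equality with the double primitive to an
    equality on all of [J]. *)
Lemma H2on_of_wd I J u g h : side I J -> continuous u -> L2 I u -> L2 I g -> L2 I h ->
  wd I u g -> wd I g h ->
  exists2 w, H2on J u w h & {ae mu, forall x, I x -> g x = w x}.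
Proof.
move=> sIJ cu u2 g2 h2 ug gh; have [oI mJ iJ [IJ JI] _] := sIJ.
have [mI iI [x0 Ix0] _] := oI.
(* Extension by zero makes the primitives continuous on the whole line, in particular at the origin,
   where no information on [h] is given. *)
pose h0 := h \_ I.
have h02 : L2 setT h0 by exact: L2_patch.
have h0i : locitg setT h0 by apply: L2_locitg h02 => // ? ? _ _ ? _.
have kh0 : isprim setT (prim x0 h0) h0 by apply: isprim_prim => // x y; exact: h0i.
have eqI x y : I x -> I y -> {in `[x, y]%classic, h0 =1 h}.
  by move=> Ix Iy t /set_mem/(sub_itv iI Ix Iy) It; rewrite /h0 patchR mem_set.
have prh F : isprim setT F h0 -> isprim I F h.
  move=> Fh x y Ix Iy xy; have [hi e] := Fh x y Logic.I Logic.I xy; split.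
    by apply: eq_itg hi; exact: eqI.
  by rewrite e; apply: eq_Rintegral; exact: eqI.
have ui := L2_locitg mI iI u2; have gi := L2_locitg mI iI g2.
have [c Hc] := wd_prim oI gi gh (prh _ kh0).
pose w x := prim x0 h0 x + c.
have wh0 : isprim setT w h0.
  have H1 : isprim setT (fun=> c) (fun=> (0:R)) by exact: isprim_cst.
  by have := isprimD kh0 H1; congr isprim; apply/funext => x; rewrite addr0.
have wi : locitg setT w by apply: isprim_locitg wh0 => ? ? _ _ ? _.
have Kw : isprim setT (prim x0 w) w by apply: isprim_prim => // x y; exact: wi.
have mw : measurable_fun I w.
  by apply: measurable_funTS; apply: continuous_measurable_fun; exact: isprim_continuous wh0.
have wdw : wd I u w.
  move=> phi tp; rewrite ug//; congr (- _).
  by apply: wd_ae_eq => //; [exact: locitgS wi|case: g2].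
have [d Hd] := wd_prim oI ui wdw (isprimS (@subsetT _ _) Kw).
have Kd : isprim setT (fun x => prim x0 w x + d) w.
  have H1 : isprim setT (fun=> d) (fun=> (0:R)) by exact: isprim_cst.
  by have := isprimD Kw H1; congr isprim; apply/funext => x; rewrite addr0.
have cK := isprim_continuous Kd.
have uK := ae_eq_continuous sIJ cu cK Hd.
exists w => //; split.
- apply: (@eq_isprim _ _ (fun x => prim x0 w x + d)); last exact: isprimS Kd.
  by move=> x /set_mem Jx; rewrite uK.
- move=> x y Jx Jy xy; have [hi e] := wh0 x y Logic.I Logic.I xy.
  have ae : {ae mu, forall t, `[x, y]%classic t -> h0 t = h t}.
    exists [set 0]; split=> [|| t /= /not_implyP[txy]] //; first exact: lebesgue_measure_set1.
    have [It|-> //] := JI t (sub_itv iJ Jx Jy txy).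
    by rewrite /h0 patchR mem_set.
  have hJ := side_L2 sIJ h2; have mh : measurable_fun `[x, y] h.
    by apply: measurable_funS (hJ.1) => //; exact: sub_itv.
  split; first exact: ae_eq_itg ae hi.
  by rewrite e; apply: ae_eq_Rint => //; exact: itg_measurable.
- split; [exact: side_L2 u2| |exact: side_L2 h2].
  apply: (side_L2 sIJ); apply: ae_eq_L2 g2 => //.
Qed.

Lemma H2on_wd I J u w h : side I J -> H2on J u w h -> wd I u w /\ wd I w h.
Proof.
move=> [oI _ _ [IJ _] _] [uw wh _].
by split; apply: isprim_wd => //; [exact: isprimS uw|exact: isprimS wh].
Qed.

Lemma inL2P I U : measurable I -> inL2 I U <-> L2 I (re_fun U) /\ L2 I (im_fun U).
Proof.
move=> mI; split=> [[mr mi fi]|[[mr ri] [mi ii]]].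
- have m1 : measurable_fun I (fun x => (re_fun U x ^+ 2 + im_fun U x ^+ 2)%:E).
    by apply/measurable_EFinP; apply: measurable_funD; exact: measurable_funX.
  split; apply: L2P => //; apply: le_lt_trans fi; apply: ge0_le_integral => //.
  + by move=> x _; rewrite lee_fin sqr_ge0.
  + by apply/measurable_EFinP; exact: measurable_funX.
  + by move=> x _; rewrite lee_fin lerDl sqr_ge0.
  + by move=> x _; rewrite lee_fin sqr_ge0.
  + by apply/measurable_EFinP; exact: measurable_funX.
  + by move=> x _; rewrite lee_fin lerDr sqr_ge0.
- split => //; rewrite /sqnormL2.
  have i : itg I (fun x => re_fun U x ^+ 2 + im_fun U x ^+ 2) by exact: itgD.
  by rewrite EFin_Rint// ltry.
Qed.

Lemma sqnormL2E I U : measurable I -> inL2 I U ->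
  sqnormL2 I U = (nsq I (re_fun U) + nsq I (im_fun U))%:E.
Proof.
move=> mI /(inL2P _ mI)[[mr ri] [mi ii]]; rewrite /sqnormL2 EFin_Rint//; last exact: itgD.
by rewrite /nsq RintegralD.
Qed.

Lemma is_weak_derivP I U G : open_itv I ->
  is_weak_deriv I U G <-> wd I (re_fun U) (re_fun G) /\ wd I (im_fun U) (im_fun G).
Proof.
move=> oI.
have reM (V : R -> R[i]) (r : R -> R) : re_fun (fun x => V x * (r x)%:C) = fun x => re_fun V x * r x.
  by apply/funext => x; rewrite /re_fun; case: (V x) => a b /=; rewrite mulr0 subr0.
have imM (V : R -> R[i]) (r : R -> R) : im_fun (fun x => V x * (r x)%:C) = fun x => im_fun V x * r x.
  by apply/funext => x; rewrite /im_fun; case: (V x) => a b /=; rewrite mulr0 add0r.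
split.
- move=> H; split=> phi /(tst_test_function oI) /H; rewrite /cintegral !reM !imM.
  + by move=> [].
  + by move=> [].
- move=> [Hr Hi] phi /(test_function_tst oI) tp.
  by rewrite /cintegral !reM !imM Hr// Hi//; apply/eqP; rewrite eq_complex /= !eqxx.
Qed.

Lemma weak_derivP I U : inH1 I U -> inL2 I (weak_deriv I U) /\ is_weak_deriv I U (weak_deriv I U).
Proof.
move=> [_ [G G2 UG]]; rewrite /weak_deriv.
by apply: (@xgetPex _ (fun=> 0) [set g | inL2 I g /\ is_weak_deriv I U g]); exists G.
Qed.

Lemma inH2_H2on I J U : side I J -> ccontinuous U -> inH2 I U ->
  exists wr wi, H2on J (re_fun U) wr (re_fun (weak_deriv I (weak_deriv I U))) /\
    H2on J (im_fun U) wi (im_fun (weak_deriv I (weak_deriv I U))).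
Proof.
move=> sIJ [cr ci] [H1 H2]; have [oI _ _ _ _] := sIJ; have [mI _ _ _] := oI.
have [/(inL2P _ mI)[g2r g2i] /(is_weak_derivP _ _ oI)[ur ui]] := weak_derivP H1.
have [/(inL2P _ mI)[h2r h2i] /(is_weak_derivP _ _ oI)[gr gi]] := weak_derivP H2.
have [/(inL2P _ mI)[u2r u2i] _] := H1.
have [wr Hr _] := H2on_of_wd sIJ cr u2r g2r h2r ur gr.
have [wi Hi _] := H2on_of_wd sIJ ci u2i g2i h2i ui gi.
by exists wr, wi.
Qed.

Lemma H2on_L2 I J u w h : side I J -> H2on J u w h -> [/\ L2 I u, L2 I w & L2 I h].
Proof.
move=> [[mI _ _ _] mJ _ [IJ _] _] [_ _ [u2 w2 h2]].
by split; [exact: L2S u2|exact: L2S w2|exact: L2S h2].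
Qed.

(** The function [weak_deriv] is some choice made by [xget]; [wd_unique] identifies it with the
    given derivatives up to null sets, which is all that can be claimed. *)
Lemma H2on_inH2 I J U wr hr wi hi : side I J ->
  H2on J (re_fun U) wr hr -> H2on J (im_fun U) wi hi ->
  inH2 I U /\ {ae mu, forall x, I x -> weak_deriv I (weak_deriv I U) x = hr x +i* hi x}.
Proof.
move=> sIJ Hr Hi; have [oI _ _ _ _] := sIJ; have [mI iI _ _] := oI.
have [ur2 wr2 hr2] := H2on_L2 sIJ Hr; have [ui2 wi2 hi2] := H2on_L2 sIJ Hi.
have [uwr whr] := H2on_wd sIJ Hr; have [uwi whi] := H2on_wd sIJ Hi.
have li f : L2 I f -> locitg I f by exact: L2_locitg.
have H1 : inH1 I U.
  split; first by apply/inL2P.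
  exists (fun x => wr x +i* wi x); first by apply/inL2P.
  by apply/is_weak_derivP.
have [/(inL2P _ mI)[g2r g2i] /(is_weak_derivP _ _ oI)[ur ui]] := weak_derivP H1.
have er := wd_unique oI (li _ g2r) (li _ wr2) ur uwr.
have ei := wd_unique oI (li _ g2i) (li _ wi2) ui uwi.
(* The given second derivative is a weak derivative of [w]; it has to be transferred to the chosen
   representative [g] of the first derivative. *)
have tr g w h : L2 I g -> L2 I w -> {ae mu, forall x, I x -> g x = w x} -> wd I w h -> wd I g h.
  move=> g2 w2 gw wh phi tp; rewrite -wh//.
  apply: wd_ae_eq => //; [exact: li|exact: li|by case: g2|by case: w2|exact: tst_derive1].
have H2 : inH1 I (weak_deriv I U).
  split; first by apply/inL2P.
  exists (fun x => hr x +i* hi x); first by apply/inL2P.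
  apply/is_weak_derivP => //; split.
  - exact: tr wr2 er whr.
  - exact: tr wi2 ei whi.
split=> //.
have [/(inL2P _ mI)[k2r k2i] /(is_weak_derivP _ _ oI)[gr gi]] := weak_derivP H2.
have er2 := wd_unique oI (li _ k2r) (li _ hr2) gr (tr _ _ _ g2r wr2 er whr).
have ei2 := wd_unique oI (li _ k2i) (li _ hi2) gi (tr _ _ _ g2i wi2 ei whi).
move: (aeI er2 ei2) => /aeS; apply => x [e1 e2] Ix.
by apply/eqP; rewrite eq_complex/= -e1// -e2// !eqxx.
Qed.

End Sides.

(** * Functions of class [H^2] on both half-lines, with a possible jump of the derivative at the
    origin *)

Section Strong.
Local Open Scope complex_scope.
Context {R : realType}.
Local Notation mu := (@lebesgue_measure R).
Implicit Types (f g h u v w : R -> R) (U : R -> R[i]) (I J : set R).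

Lemma H2on_ae I J u w h h' : side I J -> {ae mu, forall x, I x -> h x = h' x} ->
  measurable_fun I h' -> H2on J u w h -> H2on J u w h'.
Proof.
move=> sIJ hh mh' [uw wh [u2 w2 h2]]; have [[mI iI _ _] mJ iJ [IJ JI] _] := sIJ.
have hI : L2 I h by exact: L2S h2.
have h2' : L2 J h' by apply: (side_L2 sIJ); exact: ae_eq_L2 hI.
split => //; move=> x y Jx Jy xy; have [hi e] := wh x y Jx Jy xy.
have sub := sub_itv iJ Jx Jy.
have mh : measurable_fun `[x, y] h' by apply: measurable_funS (h2'.1).
have ae0 := @ae_neq0 R.
have ae : {ae mu, forall t, `[x, y]%classic t -> h t = h' t}.
  move: (aeI hh ae0) => /aeS; apply => t [Ht t0] txy.
  by have [It|//] := JI t (sub t txy); exact: Ht.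
by split; [exact: ae_eq_itg ae hi|rewrite e; apply: ae_eq_Rint => //; exact: itg_measurable].
Qed.

Lemma isprim_interior J u w h (a b x : R) : isprim J u w -> isprim J w h ->
  `[a, b] `<=` J -> a < x -> x < b -> isder u x (w x).
Proof.
move=> uw wh sub ax xb; apply: (isprim_isder (isprimS sub uw)) => //.
have ab := lt_trans ax xb.
have /(continuous_within_itvP _ ab)[+ _ _] := isprim_cvg ab (isprimS sub wh).
by apply; rewrite in_itv/= ax.
Qed.

Lemma cvg_deriv0p u w h : isprim Jp u w -> isprim Jp w h -> derive1 u x @[x --> 0^'+] --> w 0.
Proof.
move=> uw wh; have sub : `[0, 1] `<=` (@Jp R) by exact: Jp_itv.
have /(continuous_within_itvP _ ltr01)[_ + _] := isprim_cvg ltr01 (isprimS sub wh).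
apply: cvg_trans; apply: near_eq_cvg; near=> x.
apply/esym/isder_derive1/(isprim_interior uw wh sub).
- by near: x; exact: nbhs_right_gt.
- by near: x; exact: nbhs_right_lt.
Unshelve. all: by end_near. Qed.

Lemma Jm_itv (x y : R) : y <= 0 -> `[x, y] `<=` (@Jm R).
Proof. by move=> y0 t; rewrite /Jm /= !in_itv/= => /andP[_ ty]; exact: le_trans y0. Qed.

Lemma cvg_deriv0m u w h : isprim Jm u w -> isprim Jm w h -> derive1 u x @[x --> 0^'-] --> w 0.
Proof.
move=> uw wh; have sub : `[-1, 0] `<=` (@Jm R) by exact: Jm_itv.
have N10 : (-1 : R) < 0 by rewrite ltrN10.
have /(continuous_within_itvP _ N10)[_ _] := isprim_cvg N10 (isprimS sub wh).
apply: cvg_trans; apply: near_eq_cvg; near=> x.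
apply/esym/isder_derive1/(isprim_interior uw wh sub).
- by near: x; exact: nbhs_left_gt.
- by near: x; exact: nbhs_left_lt.
Unshelve. all: by end_near. Qed.

Lemma H2on_continuous u wp wm hp hm : H2on Jp u wp hp -> H2on Jm u wm hm -> continuous u.
Proof.
move=> [up wp' _] [um wm' _] x.
have [x0|x0|->] := ltgtP x 0.
- apply: (@isD_continuous _ _ _ (wm x)).
  by apply: (isprim_interior um wm' (@Jm_itv (x - 1) 0 (lexx 0))) => //; lra.
- apply: (@isD_continuous _ _ _ (wp x)).
  by apply: (isprim_interior up wp' (@Jp_itv _ 0 (x + 1) (lexx 0))) => //; lra.
- have N10 : (-1 : R) < 0 by rewrite ltrN10.
  have /(continuous_within_itvP _ ltr01)[_ cp _] := isprim_cvg ltr01 (isprimS (@Jp_itv _ 0 1 (lexx 0)) up).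
  have /(continuous_within_itvP _ N10)[_ _ cm] := isprim_cvg N10 (isprimS (@Jm_itv (-1) 0 (lexx 0)) um).
  by apply/left_right_continuousP; split.
Qed.

(* [wp] and [wm] represent the derivative of [u] on the two closed half-lines;
   their difference at the origin is the jump in the matching conditions. *)
Definition strong u wp wm h := H2on Jp u wp h /\ H2on Jm u wm h.

Lemma strong_L2 u wp wm h : strong u wp wm h -> L2 setT u /\ L2 setT h.
Proof. by move=> [[_ _ [? _ ?]] [_ _ [? _ ?]]]; split; exact: L2_setT. Qed.

(** Both half-lines share the values [u 0] and [u2 0], so the two boundary contributions combine
    into jumps of the derivatives. *)
Lemma strong_green u wp wm h u2 wp2 wm2 h2 : strong u wp wm h -> strong u2 wp2 wm2 h2 ->
  \int[mu]_x (u x * h2 x - h x * u2 x) =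
  (wp 0 - wm 0) * u2 0 - u 0 * (wp2 0 - wm2 0).
Proof.
move=> S S2; have [uL hL] := strong_L2 S; have [uL2 hL2] := strong_L2 S2.
rewrite Rint_setT; last by apply: itgB => //; exact: L2M.
by case: S S2 => [Sp Sm] [S2p S2m]; rewrite (green_Jp Sp S2p) (green_Jm Sm S2m); ring.
Qed.

Lemma inW_strong U : inW U -> exists wrp wrm wip wim,
  strong (re_fun U) wrp wrm (re_fun (deriv2 U)) /\
  strong (im_fun U) wip wim (im_fun (deriv2 U)).
Proof.
move=> [cU Up Um].
have [wrp [wip [Hrp Hip]]] := inH2_H2on side_pos cU Up.
have [wrm [wim [Hrm Him]]] := inH2_H2on side_neg cU Um.
exists wrp, wrm, wip, wim.
have ep x : half_pos x -> weak_deriv half_pos (weak_deriv half_pos U) x = deriv2 U x.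
  by rewrite /half_pos /= => x0; rewrite /deriv2 x0.
have em x : half_neg x -> weak_deriv half_neg (weak_deriv half_neg U) x = deriv2 U x.
  by rewrite /half_neg /= => x0; rewrite /deriv2 ltNge (ltW x0).
have [mIp _ _ _] := @open_itv_half_pos R; have [mIm _ _ _] := @open_itv_half_neg R.
have [_ _ h1] := H2on_L2 side_pos Hrp; have [_ _ h2] := H2on_L2 side_pos Hip.
have [_ _ h3] := H2on_L2 side_neg Hrm; have [_ _ h4] := H2on_L2 side_neg Him.
split; split.
- apply: H2on_ae side_pos _ _ Hrp; first by apply: aeW => x Ix; rewrite /re_fun ep.
  by apply: eq_measurable_fun (h1.1) => x /set_mem Ix; rewrite /re_fun ep.
- apply: H2on_ae side_neg _ _ Hrm; first by apply: aeW => x Ix; rewrite /re_fun em.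
  by apply: eq_measurable_fun (h3.1) => x /set_mem Ix; rewrite /re_fun em.
- apply: H2on_ae side_pos _ _ Hip; first by apply: aeW => x Ix; rewrite /im_fun ep.
  by apply: eq_measurable_fun (h2.1) => x /set_mem Ix; rewrite /im_fun ep.
- apply: H2on_ae side_neg _ _ Him; first by apply: aeW => x Ix; rewrite /im_fun em.
  by apply: eq_measurable_fun (h4.1) => x /set_mem Ix; rewrite /im_fun em.
Qed.

Lemma strong_inW U wrp wrm hr wip wim hi :
  strong (re_fun U) wrp wrm hr -> strong (im_fun U) wip wim hi ->
  inW U /\ {ae mu, forall x, deriv2 U x = hr x +i* hi x}.
Proof.
move=> [Hrp Hrm] [Hip Him].
have [Hp ep] := H2on_inH2 side_pos Hrp Hip; have [Hm em] := H2on_inH2 side_neg Hrm Him.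
split.
  by split => //; split; [exact: H2on_continuous Hrp Hrm|exact: H2on_continuous Hip Him].
have ae0 := @ae_neq0 R.
move: (aeI (aeI ep em) ae0) => /aeS; apply => x [[e1 e2] x0].
rewrite /deriv2; case: ltP => [xp|xm]; first exact: e1.
by apply: e2; rewrite /half_neg /= lt_neqAle xm andbT; exact/eqP.
Qed.

Lemma strong_deriv0 U wrp wrm hr wip wim hi :
  strong (re_fun U) wrp wrm hr -> strong (im_fun U) wip wim hi ->
  deriv0p U = wrp 0 +i* wip 0 /\ deriv0m U = wrm 0 +i* wim 0.
Proof.
move=> [[a1 a2 _] [b1 b2 _]] [[c1 c2 _] [d1 d2 _]]; split.
- rewrite /deriv0p; congr (_ +i* _); apply: cvg_lim => //; [exact: cvg_deriv0p a1 a2|exact: cvg_deriv0p c1 c2].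
- rewrite /deriv0m; congr (_ +i* _); apply: cvg_lim => //; [exact: cvg_deriv0m b1 b2|exact: cvg_deriv0m d1 d2].
Qed.

Lemma strong_lin u wp wm h u2 wp2 wm2 h2 (a b : R) :
  strong u wp wm h -> strong u2 wp2 wm2 h2 ->
  strong (fun x => a * u x + b * u2 x) (fun x => a * wp x + b * wp2 x)
    (fun x => a * wm x + b * wm2 x) (fun x => a * h x + b * h2 x).
Proof.
have lin J : measurable J -> forall u w h u2 w2 h2, H2on J u w h -> H2on J u2 w2 h2 ->
    H2on J (fun x => a * u x + b * u2 x) (fun x => a * w x + b * w2 x)
     (fun x => a * h x + b * h2 x).
  move=> mJ {}u w {}h {}u2 w2 {}h2 [uw wh [uL wL hL]] [uw2 wh2 [uL2 wL2 hL2]].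
  by split; [| |split]; try (by apply: isprimD; exact: isprimZ);
    (apply: L2D => //; exact: L2Z).
move=> [Sp Sm] [S2p S2m]; split; apply: lin => //; [exact: measurable_Jp|exact: measurable_Jm].
Qed.

Lemma strong0 : strong (fun=> 0) (fun=> 0) (fun=> 0) (fun=> 0).
Proof.
have z J : measurable J -> H2on J (fun=> 0) (fun=> 0) (fun=> 0).
  by move=> mJ; split; [exact: isprim_cst|exact: isprim_cst|split; exact: L20].
by split; apply: z; [exact: measurable_Jp|exact: measurable_Jm].
Qed.

End Strong.

(** * Sequences of real functions and the symmetry relation for finite sequences *)

Section RealSequences.
Context {R : realType}.
Local Notation mu := (@lebesgue_measure R).
Implicit Types (u v f g h w : nat -> R -> R) (c e : R).

(** Bounding all partial sums keeps norms of sequences within finite real sums. *)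
Definition nHle u c := forall M, \sum_(0 <= n < M) nsq setT (u n) <= c.

Definition inHr u := (forall n, L2 setT (u n)) /\ exists c, nHle u c.

Definition subr u v : nat -> R -> R := fun n x => u n x - v n x.

Lemma nHle_sub u v a b : (forall n, L2 setT (u n)) -> (forall n, L2 setT (v n)) ->
  nHle u a -> nHle v b -> nHle (subr u v) (2 * a + 2 * b).
Proof.
move=> u2 v2 ua vb M.
apply: (@le_trans _ _ (\sum_(0 <= n < M) (2 * nsq setT (u n) + 2 * nsq setT (v n)))).
  apply: ler_sum => n _; have vn : L2 setT (fun x => - v n x) by exact: L2N.
  apply: le_trans (nsqD_le measurableT (u2 n) vn) _.
  by rewrite lerD2l ler_pM2l// (@eq_nsq _ _ _ (fun x => (-1) * v n x)) ?nsqZ// => [|x _];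
    rewrite ?sqrrN ?expr1n ?mul1r// mulN1r.
by rewrite big_split/= -!mulr_sumr lerD// ler_pM2l.
Qed.

Lemma inHr_sub u v : inHr u -> inHr v -> inHr (subr u v).
Proof.
move=> [u2 [a ua]] [v2 [b vb]]; split; first by move=> n; exact: L2B.
by exists (2 * a + 2 * b); exact: nHle_sub.
Qed.

Definition dotn u v n : R := \int[mu]_x (u n x * v n x).
Definition dotr u v : R := limn (series (dotn u v)).

Lemma dotn_le u v s n : (forall n, L2 setT (u n)) -> (forall n, L2 setT (v n)) -> 0 < s ->
  `|dotn u v n| <= (s * nsq setT (u n) + nsq setT (v n) / s) / 2.
Proof. by move=> u2 v2 s0; exact: Rint_norm_le. Qed.

Lemma sum_dotn_le u v s a b M : (forall n, L2 setT (u n)) -> (forall n, L2 setT (v n)) ->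
  nHle u a -> nHle v b -> 0 < s ->
  \sum_(0 <= n < M) `|dotn u v n| <= (s * a + b / s) / 2.
Proof.
move=> u2 v2 ua vb s0.
apply: (@le_trans _ _ (\sum_(0 <= n < M) ((s * nsq setT (u n) + nsq setT (v n) / s) / 2))).
  by apply: ler_sum => n _; exact: dotn_le.
rewrite -mulr_suml ler_pM2r ?invr_gt0// big_split/= -mulr_sumr -mulr_suml.
by apply: lerD; [rewrite ler_pM2l|rewrite ler_pM2r ?invr_gt0].
Qed.

Lemma dot_cvg u v : inHr u -> inHr v -> cvgn (series (dotn u v)).
Proof.
move=> [u2 [a ua]] [v2 [b vb]]; apply: normed_cvg.
apply: nondecreasing_is_cvgn.
  by move=> m n mn; apply: (@nondecreasing_series _ (fun n => `|dotn u v n|) xpredT).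
exists ((1 * a + b / 1) / 2) => _ [M _ <-]; exact: sum_dotn_le.
Qed.

Lemma dotr_le u v s a b : inHr u -> inHr v -> nHle u a -> nHle v b -> 0 < s ->
  `|dotr u v| <= (s * a + b / s) / 2.
Proof.
move=> uH vH ua vb s0; have c := dot_cvg uH vH; case: uH vH => u2 _ [v2 _].
have B M : `|series (dotn u v) M| <= (s * a + b / s) / 2.
  apply: le_trans (sum_dotn_le M u2 v2 ua vb s0).
  exact: ler_norm_sum.
rewrite ler_norml; apply/andP; split.
- by apply: limr_ge => //; apply: nearW => M; have := B M; rewrite ler_norml => /andP[].
- by apply: limr_le => //; apply: nearW => M; have := B M; rewrite ler_norml => /andP[].
Qed.

Lemma dotr_subl u u' v : inHr u -> inHr u' -> inHr v ->
  dotr (subr u u') v = dotr u v - dotr u' v.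
Proof.
move=> uH uH' vH; rewrite /dotr -limB; [|exact: dot_cvg|exact: dot_cvg].
congr (limn _); apply/funext => M; rewrite /series /= fctE -sumrB.
apply: eq_bigr => n _; case: uH uH' vH => u2 _ [u2' _] [v2 _].
rewrite /dotn /subr -RintegralB//; [|exact: L2M|exact: L2M].
by apply: eq_Rintegral => x _; ring.
Qed.

(** The zeroth-order coefficient of [L + n], the half coming from [L]. *)
Definition kap n : R := n%:R + 2^-1.

(* The coefficients being real, the domain conditions decouple into conditions on
   the real and on the imaginary parts; [m0] stands for the coupling constant. *)
Definition rdom (m0 : R) u f := exists wp wm h : nat -> R -> R,
  [/\ forall n, strong (u n) (wp n) (wm n) (h n),
      forall n x, f n x = - h n x + kap n * u n x &
      forall n, m0 * (wp n 0 - wm n 0) =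
        Num.sqrt n.+1%:R * u n.+1 0 + Num.sqrt n%:R * u n.-1 0].

Definition rA m0 u f := [/\ rdom m0 u f, inHr u & inHr f].

Definition rA0 m0 u f := rA m0 u f /\ exists N, forall n, (N <= n)%N -> forall x, u n x = 0.

(** The terms with [kap n] are symmetric and cancel, which leaves Green's formula. *)
Lemma green_term u wp wm h f v wp' wm' h' g n :
  strong (u n) (wp n) (wm n) (h n) -> (forall x, f n x = - h n x + kap n * u n x) ->
  strong (v n) (wp' n) (wm' n) (h' n) -> (forall x, g n x = - h' n x + kap n * v n x) ->
  dotn f v n - dotn u g n =
    (wp n 0 - wm n 0) * v n 0 - u n 0 * (wp' n 0 - wm' n 0).
Proof.
move=> S fE S' gE; rewrite -(strong_green S S') /dotn.
have [uL hL] := strong_L2 S; have [vL hL'] := strong_L2 S'.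
have fL : L2 setT (f n).
  by apply: eq_L2 (L2D measurableT (L2N measurableT hL) (L2Z (kap n) measurableT uL)) => x _; rewrite fE.
have gL : L2 setT (g n).
  by apply: eq_L2 (L2D measurableT (L2N measurableT hL') (L2Z (kap n) measurableT vL)) => x _; rewrite gE.
rewrite -RintegralB//; [|exact: L2M|exact: L2M].
by apply: eq_Rintegral => x _; rewrite fE gE; ring.
Qed.

Lemma rA0_symmetric m0 u f v g : 0 < m0 -> rA0 m0 u f -> rA m0 v g -> dotr f v = dotr u g.
Proof.
move=> m0_gt0 [[[wp [wm [h [S fE Mu]]]] uH fH] [N uN]] [[wp' [wm' [h' [S' gE Mv]]]] vH gH].
have m00 : m0 != 0 by rewrite gt_eqF.
(* The discrete Wronskian of the two sequences of boundary values, which satisfy a Jacobi type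
   recursion with weights [sqrt n] through the matching conditions. *)
pose t n : R := Num.sqrt n%:R * (u n 0 * v n.-1 0 - u n.-1 0 * v n 0).
have step n : m0 * (dotn f v n - dotn u g n) = t n.+1 - t n.
  rewrite (green_term (S n) (fE n) (S' n) (gE n)) mulrBr mulrA Mu.
  rewrite [u n 0 * _]mulrC mulrA Mv /t /=; ring.
have sumE M : (N < M)%N -> series (dotn f v) M = series (dotn u g) M.
  move=> NM; apply/eqP; rewrite -subr_eq0 /series /= -sumrB.
  have : m0 * \sum_(0 <= n < M) (dotn f v n - dotn u g n) = t M - t 0%N.
    by rewrite mulr_sumr (eq_bigr _ (fun n _ => step n)) telescope_sumr.
  have -> : t 0%N = 0 by rewrite /t sqrtr0 mul0r.
  (* Both [u M] and [u M.-1] must vanish, hence the strict inequality between [N] and [M]. *)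
  have -> : t M = 0.
    rewrite /t !uN ?mul0r ?subrr ?mulr0//; last exact: ltnW.
    by case: M NM => // M; rewrite ltnS.
  by rewrite subr0 => /eqP; rewrite mulf_eq0 (negbTE m00).
rewrite /dotr; apply: cvg_lim => //.
apply: cvg_trans (dot_cvg uH gH); apply: near_eq_cvg; near=> M.
by rewrite sumE//; near: M; exact: nbhs_infty_gt.
Unshelve. all: by end_near. Qed.

End RealSequences.

(** * Explicit compactly supported functions with prescribed boundary data *)

Section Hats.
Context {R : realType}.
Local Notation mu := (@lebesgue_measure R).
Implicit Types (f g h u v w : R -> R).

(** Value [a] and slope [p] at the origin, because [step] is flat there, and zero beyond [d]. The
    parameter [d] sets the length scale. *)
Definition hat (a p d x : R) : R := (a + p * x) * (1 - step (d^-1 * x)).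

Definition hat1 (a p d x : R) : R :=
  p * (1 - step (d^-1 * x)) + (a + p * x) * (- (d^-1 * derive1 step (d^-1 * x))).

Definition hat2 (a p d x : R) : R :=
  p * (- (d^-1 * derive1 step (d^-1 * x))) +
  (p * (- (d^-1 * derive1 step (d^-1 * x))) +
   (a + p * x) * (- (d^-1 * (d^-1 * derive1 (derive1 step) (d^-1 * x))))).

Lemma smooth_scale f c : smooth f -> smooth (fun x => f (c * x)).
Proof.
move=> sf; have := smooth_affine c 0 sf.
by congr smooth; apply/funext => x; rewrite addr0.
Qed.

Lemma isder_scale f c x df : isder f (c * x) df -> isder (fun y => f (c * y)) x (c * df).
Proof.
move=> fd; rewrite mulrC; apply: (isDcomp (g := fun y => c * y)) => //.
by have := isDlin c 0 x; congr isder; apply/funext => y; rewrite addr0.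
Qed.

Lemma isder_lin (a p x : R) : isder (fun y : R => a + p * y) x p.
Proof. by have := isDlin p a x; congr isder; apply/funext => y; rewrite addrC. Qed.

Lemma isder_step (d x : R) :
  isder (fun y => 1 - step (d^-1 * y)) x (- (d^-1 * derive1 step (d^-1 * x))).
Proof.
apply: isder_eq; last exact: add0r; apply: isDD; first exact: isDcst.
by apply: isDN; apply: isder_scale; exact: smooth_is_derive smooth_step _.
Qed.

Lemma isder_hat a p d x : isder (hat a p d) x (hat1 a p d x).
Proof.
have lin := isder_lin a p x; have st := isder_step d x.
by apply: isder_eq; [exact: isDM lin st|rewrite /hat1; ring].
Qed.

Lemma isder_hat1 a p d x : isder (hat1 a p d) x (hat2 a p d x).
Proof.
have lin := isder_lin a p x; have st := isder_step d x.
have s1 : smooth (derive1 (@step R)) by apply: smooth_derive1; exact: smooth_step.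
have st1 : isder (fun y => - (d^-1 * derive1 step (d^-1 * y))) x
    (- (d^-1 * (d^-1 * derive1 (derive1 step) (d^-1 * x)))).
  apply: isDN; apply: isder_eq.
    by apply: isDM; [exact: isDcst|apply: isder_scale; exact: smooth_is_derive s1 _].
  by rewrite mulr0 addr0.
apply: isder_eq; first by apply: isDD; [apply: isDM st; exact: isDcst|exact: isDM lin st1].
by rewrite /hat2; ring.
Qed.

Lemma smooth_lin (a p : R) : smooth (fun x : R => a + p * x).
Proof.
apply: (@smooth_primitive _ _ (fun=> p)); last exact: smooth_cst.
by move=> x; exact: isder_lin.
Qed.

Lemma smooth_hat a p d : smooth (hat a p d).
Proof.
apply: smoothM; first exact: smooth_lin.
have -> : (fun x => 1 - step (d^-1 * x)) = (fun x : R => 1 + (-1) * step (d^-1 * x)).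
  by apply/funext => x; rewrite mulN1r.
apply: smoothD; first exact: smooth_cst.
by apply: smoothM; [exact: smooth_cst|apply: smooth_scale; exact: smooth_step].
Qed.

Lemma smooth_hat1 a p d : smooth (hat1 a p d).
Proof.
have -> : hat1 a p d = derive1 (hat a p d).
  by apply/funext => x; rewrite (isder_derive1 (isder_hat a p d x)).
by apply: smooth_derive1; exact: smooth_hat.
Qed.

Lemma smooth_hat2 a p d : smooth (hat2 a p d).
Proof.
have -> : hat2 a p d = derive1 (hat1 a p d).
  by apply/funext => x; rewrite (isder_derive1 (isder_hat1 a p d x)).
by apply: smooth_derive1; exact: smooth_hat1.
Qed.

(** At the origin itself the derivative is the left limit of zeros, by its continuity. *)
Lemma derive1_step_eq0 (x : R) : x <= 0 \/ 1 < x -> derive1 step x = 0.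
Proof.
have ds (y : R) : isder step y (derive1 step y) by exact: smooth_is_derive smooth_step y.
have neg (y : R) : y < 0 -> derive1 step y = 0.
  move=> y0; apply: isder_derive1; apply: (isD_near (f := cst 0)); last exact: isDcst.
  by near=> z; rewrite step_eq0//; apply/ltW; near: z; exact: lt_nbhsl.
move=> [|x1]; last first.
  apply: isder_derive1; apply: (isD_near (f := cst 1)); last exact: isDcst.
  by near=> z; rewrite step_eq1//; apply/ltW; near: z; exact: lt_nbhsr.
rewrite le_eqVlt => /predU1P[->|]; last exact: neg.
have cs : continuous (derive1 (@step R)).
  by apply: smooth_continuous; apply: smooth_derive1; exact: smooth_step.
have H1 : derive1 step y @[y --> (0:R)^'-] --> derive1 step (0:R).
  by apply: cvg_at_left_filter; exact: cs.
have H2 : derive1 step y @[y --> (0:R)^'-] --> (0:R).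
  apply: (@cvg_near_cst _ _ (0:R)); near=> y; apply: neg.
  by near: y; exact: nbhs_left_lt.
exact: (cvg_unique _ H1 H2).
Unshelve. all: by end_near. Qed.

Lemma hat_eq0 a p d x : 0 < d -> d < x -> hat a p d x = 0.
Proof.
by move=> d0 dx; rewrite /hat step_eq1 ?subrr ?mulr0// mulrC ler_pdivlMr// mul1r ltW.
Qed.

Lemma hat1_eq0 a p d x : 0 < d -> d < x -> hat1 a p d x = 0.
Proof.
move=> d0 dx; rewrite -(isder_derive1 (isder_hat a p d x)); apply: isder_derive1.
apply: (isD_near (f := cst 0)); last exact: isDcst.
by near=> z; rewrite hat_eq0//; near: z; exact: lt_nbhsr.
Unshelve. all: by end_near. Qed.

Lemma hat2_eq0 a p d x : 0 < d -> d < x -> hat2 a p d x = 0.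
Proof.
move=> d0 dx; rewrite -(isder_derive1 (isder_hat1 a p d x)); apply: isder_derive1.
apply: (isD_near (f := cst 0)); last exact: isDcst.
by near=> z; rewrite hat1_eq0//; near: z; exact: lt_nbhsr.
Unshelve. all: by end_near. Qed.

Lemma hat_0 a p d : hat a p d 0 = a.
Proof. by rewrite /hat !mulr0 step_eq0// subr0 mulr1 addr0. Qed.

Lemma hat1_0 a p d : hat1 a p d 0 = p.
Proof.
rewrite /hat1 !mulr0 step_eq0// subr0 mulr1 addr0 derive1_step_eq0; last by left.
by rewrite mulr0 oppr0 mulr0 addr0.
Qed.

Lemma nsq_Jp_le f (d B : R) : 0 < d -> measurable_fun Jp f ->
  (forall x : R, 0 <= x -> x <= d -> `|f x| <= B) -> (forall x : R, d < x -> f x = 0) ->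
  L2 Jp f /\ nsq Jp f <= B ^+ 2 * d.
Proof.
move=> d0 mf fB f0; have sub : `[0, d] `<=` (@Jp R) by exact: Jp_itv.
have mJ := @measurable_Jp R.
have f2 : L2 `[0, d] f.
  apply: (@L2_bounded _ _ _ 0 d B) => //; first exact: measurable_funS mf.
  by move=> x; rewrite /= in_itv/= => /andP[]; exact: fB.
have E : {in Jp, (fun x => f x ^+ 2) \_ `[0, d] =1 (fun x => f x ^+ 2)}.
  move=> x /set_mem/JpP x0; rewrite patchR; case: ifPn => // /negP xd.
  rewrite f0 ?expr0n// ltNge; apply/negP => xd'; apply: xd.
  by rewrite mem_set//= in_itv/= x0.
have i0 : itg setT ((fun x => f x ^+ 2) \_ `[0, d]) by apply: itg_patch => //; case: f2.
have fL : L2 Jp f by split => //; apply: eq_itg E _; exact: itgS i0.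
split=> //; have -> : nsq Jp f = nsq `[0, d] f.
  rewrite /nsq -[in RHS](setIidr sub) Rintegral_mkcondr.
  by apply: eq_Rintegral => x xJ; rewrite E.
have -> : B ^+ 2 * d = \int[mu]_(x in `[0, d]) (B ^+ 2) by rewrite Rint_cst_itv ?subr0// ltW.
apply: le_Rintegral => //; first by case: f2.
  by apply: itg_continuous; apply: continuous_subspaceT => z; exact: cst_continuous.
move=> x; rewrite /= in_itv/= => /andP[x0 xd].
rewrite -[f x ^+ 2]ger0_norm ?sqr_ge0// normrX lerXn2r ?nnegrE ?fB//.
exact: le_trans (fB x x0 xd).
Qed.

Lemma continuous_L2_Jp f (d : R) : 0 < d -> continuous f -> (forall x, d < x -> f x = 0) -> L2 Jp f.
Proof.
move=> d0 cf f0.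
have cw : {within `[0, d], continuous f} by exact: continuous_subspaceT.
have [M [Mr HM]] := compact_bounded (continuous_compact cw (@segment_compact _ 0 d)).
have mf : measurable_fun Jp f by apply: measurable_funTS; exact: continuous_measurable_fun.
have [] // := @nsq_Jp_le f d (M + 1) d0 mf _ f0.
by move=> x x0 xd; apply: (HM (M + 1)); [rewrite ltrDl|exists x => //; rewrite /= in_itv/= x0].
Qed.

Lemma H2on_hat a p d : 0 < d -> H2on Jp (hat a p d) (hat1 a p d) (hat2 a p d).
Proof.
move=> d0; have c0 := smooth_continuous (smooth_hat a p d).
have c1 := smooth_continuous (smooth_hat1 a p d).
have c2 := smooth_continuous (smooth_hat2 a p d).
split; [| |split].
- by apply: (isprimS (@subsetT _ _)); apply: isprim_C1 => // x; exact: isder_hat.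
- by apply: (isprimS (@subsetT _ _)); apply: isprim_C1 => // x; exact: isder_hat1.
- by apply: (continuous_L2_Jp d0) => // x; exact: hat_eq0.
- by apply: (continuous_L2_Jp d0) => // x; exact: hat1_eq0.
- by apply: (continuous_L2_Jp d0) => // x; exact: hat2_eq0.
Qed.

Lemma hat_le (d x : R) : 0 <= x -> x <= d -> `|hat 0 1 d x| <= d.
Proof.
move=> x0 xd; rewrite /hat add0r mul1r normrM ger0_norm//.
have := step_ge0 (d^-1 * x); have := step_le1 (d^-1 * x).
by move=> h1 h2; rewrite ger0_norm; [nra|lra].
Qed.

(** By scaling, the second derivative is [1 / d] times a fixed function of [x / d], namely
    [- 2 * step' y - y * step'' y], which is bounded on [[0, 1]]. *)
Lemma hat2_le : exists2 C : R, 0 <= C & forall d x : R, 0 < d -> 0 <= x -> x <= d ->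
  `|hat2 0 1 d x| <= C / d.
Proof.
have bnd f : continuous f -> exists2 M : R, 0 <= M & forall y : R, 0 <= y -> y <= 1 -> `|f y| <= M.
  move=> cf; have cw : {within `[0, 1], continuous f} by exact: continuous_subspaceT.
  have [M [Mr HM]] := compact_bounded (continuous_compact cw (@segment_compact _ 0 1)).
  have HM' y : 0 <= y -> y <= 1 -> `|f y| <= M + 1.
    by move=> y0 y1; apply: (HM (M + 1)); [rewrite ltrDl|exists y => //; rewrite /= in_itv/= y0].
  by exists (M + 1) => //; apply: le_trans (HM' 0 _ _).
have s1 : smooth (derive1 (@step R)) by apply: smooth_derive1; exact: smooth_step.
have [M1 M10 H1] := bnd _ (smooth_continuous s1).
have [M2 M20 H2] := bnd _ (smooth_continuous (smooth_derive1 s1)).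
exists (2 * M1 + M2); first by lra.
move=> d x d0 x0 xd; have y0 : 0 <= d^-1 * x by rewrite mulr_ge0// invr_ge0 ltW.
have y1 : d^-1 * x <= 1 by rewrite mulrC ler_pdivrMr// mul1r.
have := H1 _ y0 y1; have := H2 _ y0 y1; rewrite /hat2.
set A := derive1 (derive1 step) _; set B := derive1 step _ => HA HB.
have -> : 1 * - (d^-1 * B) + (1 * - (d^-1 * B) + (0 + 1 * x) * - (d^-1 * (d^-1 * A))) =
   d^-1 * (- (2 * B) - (d^-1 * x) * A) by ring.
rewrite normrM [`|d^-1|]ger0_norm ?invr_ge0 ?(ltW d0)// mulrC ler_wpM2r ?invr_ge0 ?(ltW d0)//.
apply: le_trans (ler_normB _ _) _; rewrite normrN !normrM [`|2|]ger0_norm//.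
rewrite [`|d^-1|]ger0_norm ?invr_ge0 ?(ltW d0)// [`|x|]ger0_norm//.
have := normr_ge0 A; nra.
Qed.

(** Only the values at the origin have to agree; a jump between [wp 0] and [wm 0] is allowed, as the
    matching conditions demand. *)
Lemma strong_glue up um wp wm hp hm : H2on Jp up wp hp -> H2on Jm um wm hm ->
  up 0 = um 0 ->
  strong (fun x : R => if 0 <= x then up x else um x) wp wm
    (fun x : R => if 0 < x then hp x else hm x).
Proof.
move=> Hp Hm e0; have [_ _ hpL] := H2on_L2 side_pos Hp; have [_ _ hmL] := H2on_L2 side_neg Hm.
split.
- apply: (H2on_ae side_pos (h := hp)).
  + by apply: aeW => x; rewrite /half_pos/= => ->.
  + by apply: eq_measurable_fun (hpL.1) => x /set_mem; rewrite /half_pos/= => ->.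
  + case: Hp => [uw wh [uL wL hL]]; split => //.
    * by apply: eq_isprim uw => x /set_mem/JpP ->.
    * by split => //; apply: eq_L2 uL => x /set_mem/JpP ->.
- have em (x : R) : x <= 0 -> (if 0 <= x then up x else um x) = um x.
    by rewrite le_eqVlt => /predU1P[->|x0]; [rewrite lexx|rewrite leNgt x0].
  apply: (H2on_ae side_neg (h := hm)).
  + by apply: aeW => x; rewrite /half_neg/= => x0; rewrite ltNge (ltW x0).
  + by apply: eq_measurable_fun (hmL.1) => x /set_mem; rewrite /half_neg/= => x0; rewrite ltNge (ltW x0).
  + case: Hm => [uw wh [uL wL hL]]; split => //.
    * by apply: eq_isprim uw => x /set_mem/JmP x0; rewrite em.
    * by split => //; apply: eq_L2 uL => x /set_mem/JmP x0; rewrite em.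
Qed.

Lemma nsq_setT f : L2 setT f -> nsq setT f = nsq Jm f + nsq Jp f.
Proof. by move=> [_ fi]; rewrite /nsq Rint_setT. Qed.

(** The optimal weight [s = B / A] turns the family of weighted bounds back into a quadratic one. *)
Lemma le_sqr_of_AMGM (A r B : R) : 0 <= A -> 0 <= r -> 0 < B ->
  (forall s, 0 < s -> A <= (s * r + B / s) / 2) -> A ^+ 2 <= r * B.
Proof.
rewrite le_eqVlt => /predU1P[<-|A0] r0 B0 H; first by rewrite expr0n/= mulr_ge0// ltW.
have := H (B / A) (divr_gt0 B0 A0).
have -> : (B / A * r + B / (B / A)) / 2 = (B * r / A + A) / 2.
  by congr (_ / 2); field; rewrite !gt_eqF.
rewrite ler_pdivlMr// => H'; have : A <= B * r / A by lra.
by rewrite ler_pdivlMr// -expr2 [B * r]mulrC.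
Qed.

End Hats.

(** * The trace estimate, the correction near the origin and the cutoff in [n] *)

Section TraceAndKick.
Context {R : realType}.
Local Notation mu := (@lebesgue_measure R).
Implicit Types (u v f g h w : nat -> R -> R).

Lemma kap_gt0 n : 0 < kap n :> R.
Proof. by rewrite /kap ltr_wpDl. Qed.

Lemma kap_ge n : 2^-1 <= kap n :> R.
Proof. by rewrite /kap lerDr. Qed.

(** Its inverse is the natural length of [L + n], at which the second derivative and the
    multiplication by [kap n] balance. *)
Definition skap n : R := Num.sqrt (kap n).

Lemma skap_gt0 n : 0 < skap n.
Proof. by rewrite sqrtr_gt0 kap_gt0. Qed.

Lemma skap2 n : skap n ^+ 2 = kap n.
Proof. by rewrite sqr_sqrtr// ltW// kap_gt0. Qed.

(** Since [kap n >= 1/2], one has [4 * kap n ^ 2 >= 1]; this is the origin of the constant 4. *)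
Lemma skapV3_le n : (skap n)^-1 ^+ 3 <= 4 * skap n.
Proof.
have s0 := skap_gt0 n; have k := kap_ge n; rewrite -skap2 in k.
rewrite exprVn -div1r ler_pdivrMr ?exprn_gt0//.
have -> : 4 * skap n * skap n ^+ 3 = 4 * (skap n ^+ 2) ^+ 2 by ring.
nra.
Qed.

(* Green's formula against [hat 0 1 d] with [d = (skap n)^-1] isolates [u 0]. *)
Lemma trace_le : exists2 K : R, 0 < K & forall n (u wp wm h f : R -> R),
  strong u wp wm h -> (forall x, f x = - h x + kap n * u x) ->
  u 0 ^+ 2 <= (nsq setT u + nsq setT f) * (K * skap n).
Proof.
have [C C0 HC] := @hat2_le R.
(* The square comes from the factor [q] paired with [u], the 4 from the hat paired with [f]. *)
pose K : R := (1 + C) ^+ 2 + 4; exists K; first by rewrite /K ltr_wpDl// sqr_ge0.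
move=> n u wp wm h f S fE.
have s0 := skap_gt0 n; set d := (skap n)^-1.
have d0 : 0 < d by rewrite invr_gt0.
have [uL hL] := strong_L2 S.
have fL : L2 setT f.
  by apply: eq_L2 (L2D measurableT (L2N measurableT hL) (L2Z (kap n) measurableT uL)) => x _; rewrite fE.
have mJ := @measurable_Jp R.
have Hz := H2on_hat 0 1 d0; have [Sp _] := S.
have := green_Jp Sp Hz; rewrite hat_0 hat1_0 mulr0 sub0r mulr1 => G.
(* This is [L + n] applied to the hat, so that [u 0] becomes the pairing of [u] with [q] minus that
   of [f] with the hat. At the scale [d] both terms of [q] are of order [skap n] on an interval of
   length [(skap n)^-1], hence the squared norm of order [skap n]. *)
pose q x := kap n * hat 0 1 d x - hat2 0 1 d x.
have [_ _ [zL _ z2L]] := Hz.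
have uJ : L2 Jp u by exact: L2S uL.
have fJ : L2 Jp f by exact: L2S fL.
have hJ : L2 Jp h by exact: L2S hL.
have mq : measurable_fun Jp q by apply: measurable_funB; [apply: measurable_funM => //; case: zL|case: z2L].
have qB (x : R) : 0 <= x -> x <= d -> `|q x| <= (1 + C) * skap n.
  move=> x0 xd; apply: le_trans (ler_normB _ _) _.
  rewrite normrM [`|kap n|]ger0_norm ?(ltW (kap_gt0 n))//.
  have := HC d x d0 x0 xd; have := hat_le x0 xd; rewrite {2 3}/d invrK => h1 h2.
  have : kap n * `|hat 0 1 d x| <= skap n.
    apply: le_trans (ler_wpM2l (ltW (kap_gt0 n)) h1) _.
    by rewrite -skap2 expr2 mulfK// gt_eqF.
  lra.
have q0 (x : R) : d < x -> q x = 0.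
  by move=> dx; rewrite /q hat_eq0// hat2_eq0// mulr0 subrr.
have [qL qn] := nsq_Jp_le d0 mq qB q0.
have [_ zn] := nsq_Jp_le d0 (zL.1) (@hat_le _ d) (fun x => @hat_eq0 _ 0 1 d x d0).
have {}qn : nsq Jp q <= (1 + C) ^+ 2 * skap n.
  by apply: le_trans qn _; rewrite exprMn -mulrA ler_wpM2l ?sqr_ge0// expr2 mulfK// gt_eqF.
have {}zn : nsq Jp (hat 0 1 d) <= 4 * skap n.
  by apply: le_trans zn _; rewrite -exprSr; exact: skapV3_le.
have uq : u 0 = \int[mu]_(x in Jp) (u x * q x) - \int[mu]_(x in Jp) (f x * hat 0 1 d x).
  apply/eqP; rewrite -eqr_opp -G; apply/eqP.
  rewrite -RintegralB//; [|exact: L2M|exact: L2M].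
  rewrite -mulN1r -RintegralZl//; last by apply: itgB => //; exact: L2M.
  by apply: eq_Rintegral => x _; rewrite /q fE; ring.
have -> : u 0 ^+ 2 = `|u 0| ^+ 2 by rewrite -normrX ger0_norm ?sqr_ge0.
apply: le_sqr_of_AMGM => //; first by rewrite addr_ge0 ?nsq_ge0.
  by rewrite mulr_gt0// /K ltr_wpDl// sqr_ge0.
move=> s sp; rewrite uq; apply: le_trans (ler_normB _ _) _.
have h1 := Rint_norm_le mJ sp uJ qL; have h2 := Rint_norm_le mJ sp fJ zL.
have h3 : s * nsq Jp u <= s * nsq setT u by rewrite ler_pM2l//; exact: le_nsq.
have h4 : s * nsq Jp f <= s * nsq setT f by rewrite ler_pM2l//; exact: le_nsq.
have h5 : nsq Jp q / s <= (1 + C) ^+ 2 * skap n / s by rewrite ler_pM2r ?invr_gt0.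
have h6 : nsq Jp (hat 0 1 d) / s <= 4 * skap n / s by rewrite ler_pM2r ?invr_gt0.
have -> : (s * (nsq setT u + nsq setT f) + K * skap n / s) / 2 =
   (s * nsq setT u + s * nsq setT f + ((1 + C) ^+ 2 * skap n / s + 4 * skap n / s)) / 2.
  by rewrite /K; ring.
lra.
Qed.

(* Vanishes at the origin, where its derivative jumps by [1]. *)
Definition kick n (x : R) : R := if 0 <= x then hat 0 1 (skap n)^-1 x else 0.
Definition kick2 n (x : R) : R := if 0 < x then hat2 0 1 (skap n)^-1 x else 0.

Lemma strong_kick n : strong (kick n) (hat1 0 1 (skap n)^-1) (fun=> 0) (kick2 n).
Proof.
have d0 : 0 < (skap n)^-1 by rewrite invr_gt0 skap_gt0.
have mJ := @measurable_Jm R.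
have z : H2on Jm (fun=> 0) (fun=> 0) (fun=> 0 : R).
  by split; [exact: isprim_cst|exact: isprim_cst|split; exact: L20].
by apply: (strong_glue (H2on_hat 0 1 d0) z); rewrite hat_0.
Qed.

Lemma kick_0 n : kick n 0 = 0.
Proof. by rewrite /kick lexx hat_0. Qed.

(** On an interval of length [d] the kick is at most [d] and its second derivative at most [C / d].
    The squared norms of [kap n * kick n] and [kick2 n] are thus of order [kap n ^ 2 * d ^ 3] and
    [1 / d], which agree at [d = (skap n)^-1]. *)
Lemma kick_le : exists2 K : R, 0 < K & forall n,
  nsq setT (kick n) <= K * skap n /\
  nsq setT (fun x => - kick2 n x + kap n * kick n x) <= K * skap n.
Proof.
have [C C0 HC] := @hat2_le R.
exists (2 * C ^+ 2 + 8); first by rewrite ltr_wpDl// mulr_ge0// sqr_ge0.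
move=> n; have s0 := skap_gt0 n; set d := (skap n)^-1.
have d0 : 0 < d by rewrite invr_gt0.
have [kL k2L] := strong_L2 (strong_kick n).
have mJ := @measurable_Jp R; have mJ' := @measurable_Jm R.
have Jm0 (f : R -> R) : {in Jm, f =1 (fun=> 0 : R)} -> nsq Jm f = 0.
  move=> f0; by rewrite /nsq Rint_eq0// => x xJ; rewrite f0 ?mem_set// expr0n.
have kn0 : nsq setT (kick n) <= d ^+ 2 * d.
  rewrite nsq_setT// Jm0 ?add0r; last first.
    by move=> x /set_mem/JmP; rewrite le_eqVlt => /predU1P[->|x0]; [rewrite kick_0|rewrite /kick leNgt x0].
  have [] := @nsq_Jp_le _ (kick n) d d d0.
  - by case: (L2S mJ measurableT (@subsetT _ _) kL).
  - by move=> x x0 xd; rewrite /kick x0; exact: hat_le.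
  - by move=> x dx; rewrite /kick (le_trans (ltW d0) (ltW dx)) hat_eq0.
  by [].
have kn : nsq setT (kick n) <= 4 * skap n.
  by apply: le_trans kn0 _; rewrite -exprSr; exact: skapV3_le.
have k2n : nsq setT (kick2 n) <= C ^+ 2 * skap n.
  rewrite nsq_setT// Jm0 ?add0r; last first.
    by move=> x /set_mem/JmP x0; rewrite /kick2 ltNge x0.
  have [] := @nsq_Jp_le _ (kick2 n) d (C / d) d0.
  - by case: (L2S mJ measurableT (@subsetT _ _) k2L).
  - move=> x x0 xd; rewrite /kick2; case: ifP => _; first exact: HC.
    by rewrite normr0 divr_ge0// ltW.
  - by move=> x dx; rewrite /kick2 (lt_trans d0 dx) hat2_eq0.
  move=> _; move/le_trans; apply; rewrite exprMn -mulrA ler_wpM2l ?sqr_ge0//.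
  by rewrite expr2 -mulrA mulVf ?gt_eqF// mulr1 /d invrK.
split.
  by apply: le_trans kn _; rewrite ler_wpM2r ?(ltW s0)//; have := sqr_ge0 C; lra.
apply: le_trans (nsqD_le measurableT (L2N measurableT k2L) (L2Z (kap n) measurableT kL)) _.
have -> : nsq setT (fun x => - kick2 n x) = nsq setT (kick2 n).
  by apply: eq_Rintegral => x _; rewrite sqrrN.
rewrite nsqZ//.
have kn' : kap n ^+ 2 * nsq setT (kick n) <= skap n.
  apply: le_trans (ler_wpM2l (sqr_ge0 _) kn0) _.
  have -> : kap n ^+ 2 * (d ^+ 2 * d) = skap n by rewrite -skap2 /d; field; rewrite gt_eqF.
  exact: lexx.
have := skap_gt0 n; lra.
Qed.

Definition cutoff (N n : nat) : R :=
  if (n <= N)%N then 1 else if (n <= 2 * N)%N then (2 * N%:R - n%:R) / N%:R else 0.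

Lemma cutoff_ge0 N n : (0 < N)%N -> 0 <= cutoff N n.
Proof.
move=> N0; rewrite /cutoff; case: ifP => // _; case: ifP => // n2.
rewrite divr_ge0// subr_ge0 -natrM ler_nat; exact: n2.
Qed.

Lemma cutoff_le1 N n : (0 < N)%N -> cutoff N n <= 1.
Proof.
move=> N0; rewrite /cutoff; case: ifP => // /negbT; rewrite -ltnNge => Nn; case: ifP => // n2.
rewrite ler_pdivrMr ?ltr0n// mul1r.
have : N%:R <= n%:R :> R by rewrite ler_nat ltnW.
lra.
Qed.

Lemma cutoffS N n : (0 < N)%N -> `|cutoff N n.+1 - cutoff N n| <= N%:R^-1.
Proof.
move=> N0; have NR : 0 < N%:R :> R by rewrite ltr0n.
have Nn0 : N%:R != 0 :> R by rewrite gt_eqF.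
have iN : 0 <= N%:R^-1 :> R by rewrite invr_ge0 ltW.
rewrite /cutoff; case: (ltngtP n N) => [nN|nN|->].
- by rewrite subrr normr0.
- case: (ltngtP n (2 * N)) => [n2|n2|n2].
  + have -> : (2 * N%:R - n.+1%:R) / N%:R - (2 * N%:R - n%:R) / N%:R = - N%:R^-1 :> R.
      by rewrite -natr1; field.
    by rewrite normrN ger0_norm.
  + by rewrite subrr normr0.
  + by rewrite n2 natrM subrr mul0r subrr normr0.
- case: ifP => N2.
  + have -> : (2 * N%:R - N.+1%:R) / N%:R - 1 = - N%:R^-1 :> R by rewrite -natr1; field.
    by rewrite normrN ger0_norm.
  + by move: N2; rewrite mul2n -addnn -addn1 leq_add2l N0.
Qed.

End TraceAndKick.

(** * Approximation in the graph norm by finite sequences *)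

Section Approximation.
Context {R : realType}.
Local Notation mu := (@lebesgue_measure R).
Implicit Types (u v f g h w : nat -> R -> R) (r E : nat -> R).

Lemma summable_tail r (c e : R) : (forall n, 0 <= r n) ->
  (forall M, \sum_(0 <= n < M) r n <= c) -> 0 < e ->
  exists N, forall M, \sum_(N <= n < M) r n <= e.
Proof.
move=> r0 rc e0.
have cv : cvgn (series r).
  apply: nondecreasing_is_cvgn.
    by move=> m n mn; apply: (@nondecreasing_series _ r xpredT).
  by exists c => _ [M _ <-]; exact: rc.
have nd : nondecreasing_seq (series r).
  by move=> m n mn; apply: (@nondecreasing_series _ r xpredT).
have /cvgrPdist_le /(_ e e0) [N _ HN] := cv.
exists N => M; have [NM|MN] := leqP N M; last by rewrite big_geq ?ltW// ltnW.
have : series r M <= limn (series r) by exact: nondecreasing_cvgn_le.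
have := HN N (leqnn N) => /(le_trans (ler_norm _)).
rewrite /series /= (@big_cat_nat _ _ _ N 0 M)//=; lra.
Qed.

(** Each [r n] is counted by at most three indices. Because [E] starts at [N + 1], the left
    neighbour [n.-1] still belongs to the tail from [N]. *)
Lemma sum_neighbours_le E r (N : nat) (C e : R) : (forall n, (n < N.+1)%N -> E n = 0) ->
  0 <= C -> (forall n, (N < n)%N -> E n <= C * (r n.-1 + r n + r n.+1)) ->
  (forall n, 0 <= r n) -> (forall M, \sum_(N <= n < M) r n <= e) ->
  forall M, \sum_(0 <= n < M) E n <= 3 * C * e.
Proof.
move=> E0 C0 EC r0 re M.
have e0 : 0 <= e by apply: le_trans (re N); rewrite big_geq.
(* Keeping the three shifted tails separate makes the induction exact: the new index contributes the
   last term of each. *)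
have T M' : (N < M')%N -> \sum_(0 <= n < M') E n <=
   C * (\sum_(N <= n < M'.-1) r n + \sum_(N <= n < M') r n + \sum_(N <= n < M'.+1) r n).
  elim: M' => // M' IH; rewrite ltnS leq_eqVlt => /predU1P[<-|NM].
    rewrite big_nat big1 => [|n /andP[_]]; last exact: E0.
    by rewrite mulr_ge0// !addr_ge0// sumr_ge0.
  rewrite big_nat_recr//=; have := IH NM; have := EC M' NM.
  have -> : \sum_(N <= n < M'.+2) r n = \sum_(N <= n < M'.+1) r n + r M'.+1.
    by rewrite big_nat_recr//= ltnW// ltnS ltnW.
  have -> : \sum_(N <= n < M'.+1) r n = \sum_(N <= n < M') r n + r M'.
    by rewrite big_nat_recr//= ltnW.
  have -> : \sum_(N <= n < M') r n = \sum_(N <= n < M'.-1) r n + r M'.-1.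
    by case: M' NM {IH} => // M'; rewrite ltnS => NM; rewrite big_nat_recr.
  by rewrite /=; lra.
have [NM|MN] := ltnP N M.
  apply: le_trans (T M NM) _; rewrite -mulrA mulrCA ler_wpM2l//.
  have := re M.-1; have := re M; have := re M.+1; lra.
rewrite big_nat big1 => [|n /andP[_ nM]]; last by apply: E0; rewrite ltnS ltnW// (leq_trans nM).
by rewrite mulr_ge0// mulr_ge0.
Qed.

Lemma skap_le n : skap n <= skap n.+1 :> R.
Proof. by rewrite /skap ler_wsqrtr// /kap lerD2r ler_nat. Qed.

Lemma skapM_le n : n.+1%:R * (skap n * skap n.+1) <= n.+1%:R * kap n.+1 :> R.
Proof.
by rewrite ler_wpM2l// -skap2 expr2 ler_wpM2r ?(ltW (skap_gt0 _))// skap_le.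
Qed.

(* Multiplying by the cutoff breaks the matching conditions, which [delta n] times
   a kick restores.  The trace estimate gives
   [delta n ^+ 2 * skap n <= D * (r n.-1 + r n + r n.+1)], whose sum over
   [n > N] is a tail of a convergent series, because the cutoff has slope [1 / N]
   and is constant for [n >= 2 * N]. *)
Lemma rA_approximation (m0 : R) v g (e : R) : 0 < m0 -> rA m0 v g -> 0 < e ->
  exists u f, [/\ rA0 m0 u f, nHle (subr v u) e & nHle (subr g f) e].
Proof.
move=> m0_gt0 [[wp [wm [h [S gE Mv]]]] [v2 [cv vc]] [g2 [cg gc]]] e0.
have m00 : m0 != 0 by rewrite gt_eqF.
have [K K0 HK] := @trace_le R; have [K' K'0 HK'] := @kick_le R.
pose r n := nsq setT (v n) + nsq setT (g n).
have r0 n : 0 <= r n by rewrite addr_ge0// nsq_ge0.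
have rc M : \sum_(0 <= n < M) r n <= cv + cg by rewrite big_split/= lerD.
(* The square of a sum of two terms costs a factor 2, each term is at most [12 * K] times some
   [r j], and [delta] carries the factor [m0^-1]. *)
pose D := 24 * K / m0 ^+ 2; have D0 : 0 < D.
  by rewrite divr_gt0 ?exprn_gt0// mulr_gt0.
(* Both parts of the error, the removed portion of the component and the added kick, are doubled by
   [nsqD_le]. *)
pose C := 2 + 2 * D * K'.
have C0 : 0 < C by have := mulr_gt0 D0 K'0; rewrite /C; clearbody D; lra.
have [N0 HN0] : exists N, forall M, \sum_(N <= n < M) r n <= e / (3 * C).
  by apply: summable_tail rc _ => //; rewrite divr_gt0// mulr_gt0.
have HN M : \sum_(N0 <= n < M) r n <= e / (3 * C) by exact: HN0.
(* One more than [N0]: the first index where [delta] can be nonzero is [N], and its left neighbour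
   [N0] is still in the small tail. *)
pose N := N0.+1; pose chi := cutoff N : nat -> R.
have N_gt0 : (0 < N)%N by [].
(* The defect of the cut sequence in the [n]-th matching condition, divided by [m0]. The kick
   vanishes at the origin, so correcting the jump leaves all boundary values unchanged. *)
pose delta n : R := m0^-1 * (Num.sqrt n.+1%:R * (chi n.+1 - chi n) * v n.+1 0 +
   Num.sqrt n%:R * (chi n.-1 - chi n) * v n.-1 0).
have chi1 n : (n <= N)%N -> chi n = 1 by move=> nN; rewrite /chi /cutoff nN.
have chi0 n : (2 * N <= n)%N -> chi n = 0.
  move=> n2; rewrite /chi /cutoff ifF; last first.
    apply/negbTE; rewrite -ltnNge; apply: leq_trans n2.
    by rewrite mul2n -addnn -addn1 leq_add2l.
  case: ifP => // n2'; have -> : n = (2 * N)%N by apply/eqP; rewrite eqn_leq n2 n2'.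
  by rewrite natrM subrr mul0r.
have delta0 n : (n < N)%N -> delta n = 0.
  move=> nN; rewrite /delta !chi1 ?subrr ?mulr0 ?mul0r ?addr0 ?mulr0//; last exact: ltnW.
  exact: leq_trans (leq_pred _) (ltnW nN).
have delta0' n : (2 * N < n)%N -> delta n = 0.
  move=> nN; rewrite /delta !chi0 ?subrr ?mulr0 ?mul0r ?addr0 ?mulr0//.
  - by case: n nN.
  - exact: ltnW.
  - exact: leq_trans (ltnW nN) _.
pose u n (x : R) : R := chi n * v n x + delta n * kick n x.
pose fk n (x : R) : R := - kick2 n x + kap n * kick n x.
pose f n (x : R) : R := chi n * g n x + delta n * fk n x.
have SK n := @strong_kick R n.
have dom : rdom m0 u f.
  exists (fun n x => chi n * wp n x + delta n * hat1 0 1 (skap n)^-1 x).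
  exists (fun n x => chi n * wm n x + delta n * 0).
  exists (fun n x => chi n * h n x + delta n * kick2 n x); split.
  - by move=> n; exact: strong_lin (S n) (SK n).
  - by move=> n x; rewrite /f /fk gE /u; ring.
  - move=> n; rewrite hat1_0 /u !kick_0 !mulr0 !addr0 mulr1.
    have -> : m0 * (chi n * wp n 0 + delta n - chi n * wm n 0) =
       chi n * (m0 * (wp n 0 - wm n 0)) + m0 * delta n by ring.
    by rewrite Mv /delta mulrA mulfV// mul1r; ring.
have kL n : L2 setT (@kick R n) by have [] := strong_L2 (SK n).
have k2L n : L2 setT (@kick2 R n) by have [] := strong_L2 (SK n).
have fkL n : L2 setT (fk n) by apply: L2D => //; [exact: L2N|exact: L2Z].
have deltaK n : (N <= n)%N -> delta n ^+ 2 * skap n <= D * (r n.-1 + r n + r n.+1).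
  move=> Nn; have [n2|n2] := ltnP (2 * N)%N n.
    rewrite delta0'// expr0n/= mul0r; apply: mulr_ge0; first exact: ltW.
    by apply: addr_ge0; [apply: addr_ge0|]; exact: r0.
  have sn := skap_gt0 n (R := R).
  case: n Nn n2 sn => // n Nn n2 sn.
  have HS k : `|chi k.+1 - chi k| <= N%:R^-1 by exact: cutoffS.
  have NR : 0 < N%:R :> R by rewrite ltr0n.
  have sq k : (chi k.+1 - chi k) ^+ 2 <= N%:R^-1 ^+ 2.
    rewrite -[_ ^+ 2]ger0_norm ?sqr_ge0// normrX; apply: lerXn2r; last exact: HS.
      by rewrite nnegrE normr_ge0.
    by rewrite nnegrE invr_ge0 ltW.
  have t1 := HK _ _ _ _ _ _ (S n.+2) (gE n.+2).
  have t2 := HK _ _ _ _ _ _ (S n) (gE n).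
  rewrite -/(r _) in t1; rewrite -/(r _) in t2.
  pose A := Num.sqrt n.+2%:R * (chi n.+2 - chi n.+1) * v n.+2 0.
  pose B := Num.sqrt n.+1%:R * (chi n - chi n.+1) * v n 0.
  have NV : N%:R^-1 ^+ 2 * N%:R ^+ 2 = 1 :> R by rewrite -exprMn mulVf ?expr1n ?gt_eqF.
  have nN : n.+1%:R <= 2 * N%:R :> R by rewrite -natrM ler_nat.
  have N1 : 1 <= N%:R :> R by rewrite ler1n.
  (* In the relevant range [k <= 3 * N] and [kap l <= 4 * N]; the product 12 absorbs the shifts by
     one and by one half, since [N >= 1]. *)
  have key k l : (0 < k)%N -> k%:R <= 2 * N%:R + 1 :> R -> l%:R <= 2 * N%:R + 1 :> R ->
      k%:R * kap l <= 12 * N%:R ^+ 2 :> R.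
    move=> _ h1 h2; have k0 : 0 <= k%:R :> R by []. have l0 := kap_gt0 l (R := R).
    apply: (@le_trans _ _ ((3 * N%:R) * (4 * N%:R))); last by rewrite le_eqVlt; apply/orP; left; apply/eqP; ring.
    by apply: ler_pM; [exact: k0|exact: ltW|lra|rewrite /kap; lra].
  (* Here [c] is a difference of cutoff values and [t] a boundary value. The squared slope
     [N ^ (-2)] exactly compensates the growth [N ^ 2] of the weight [l] and the two factors
     [skap]. *)
  have term (l j : nat) (c t : R) : c ^+ 2 <= N%:R^-1 ^+ 2 -> t ^+ 2 <= r j * (K * skap j) ->
      l%:R * (skap j * skap n.+1) <= 12 * N%:R ^+ 2 :> R ->
      (Num.sqrt l%:R * c * t) ^+ 2 * skap n.+1 <= 12 * K * r j.
    move=> cN tr hh; rewrite !exprMn sqr_sqrtr//.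
    apply: (@le_trans _ _ (l%:R * N%:R^-1 ^+ 2 * (r j * (K * skap j)) * skap n.+1)).
      apply: ler_wpM2r; first exact: ltW.
      apply: ler_pM tr; [by apply: mulr_ge0; [|exact: sqr_ge0]|exact: sqr_ge0|].
      exact: ler_wpM2l.
    have -> : l%:R * N%:R^-1 ^+ 2 * (r j * (K * skap j)) * skap n.+1 =
       (l%:R * (skap j * skap n.+1)) * (N%:R^-1 ^+ 2 * (K * r j)) by ring.
    have -> : 12 * K * r j = 12 * N%:R ^+ 2 * (N%:R^-1 ^+ 2 * (K * r j)).
      rewrite [RHS](_ : _ = 12 * K * r j * (N%:R^-1 ^+ 2 * N%:R ^+ 2)); last by ring.
      by rewrite NV mulr1.
    apply: ler_wpM2r hh; apply: mulr_ge0; [exact: sqr_ge0|apply: mulr_ge0; [exact: ltW|exact: r0]].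
  have A2 : A ^+ 2 * skap n.+1 <= 12 * K * r n.+2.
    apply: term t1 _; first exact: sq.
    apply: (@le_trans _ _ (n.+2%:R * kap n.+2)).
      apply: ler_wpM2l => //; rewrite -skap2 expr2.
      by apply: ler_wpM2l; [exact/ltW/skap_gt0|exact: skap_le].
    by apply: key => //; rewrite -natr1; lra.
  have B2 : B ^+ 2 * skap n.+1 <= 12 * K * r n.
    apply: term t2 _; last by apply: le_trans (skapM_le n) _; apply: key => //; lra.
    by have -> : (chi n - chi n.+1) ^+ 2 = (chi n.+1 - chi n) ^+ 2 by ring.
  have -> : delta n.+1 = m0^-1 * (A + B) by [].
  have AB : (A + B) ^+ 2 * skap n.+1 <= 24 * K * (r n + r n.+1 + r n.+2).
    apply: (@le_trans _ _ (2 * (A ^+ 2 * skap n.+1) + 2 * (B ^+ 2 * skap n.+1))).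
      have -> : 2 * (A ^+ 2 * skap n.+1) + 2 * (B ^+ 2 * skap n.+1) =
        (2 * A ^+ 2 + 2 * B ^+ 2) * skap n.+1 by ring.
      apply: ler_wpM2r; first exact: ltW.
      by have := sqr_ge0 (A - B); nra.
    have : 0 <= K * r n.+1 by apply: mulr_ge0; [exact: ltW|exact: r0].
    clearbody A B; move: A2 B2; clearbody r; lra.
  have -> : D * (r n.+1.-1 + r n.+1 + r n.+2) =
      m0^-1 ^+ 2 * (24 * K * (r n + r n.+1 + r n.+2)) by rewrite /D /=; field.
  have -> : (m0^-1 * (A + B)) ^+ 2 * skap n.+1 = m0^-1 ^+ 2 * ((A + B) ^+ 2 * skap n.+1) by ring.
  by apply: ler_wpM2l AB; exact: sqr_ge0.
have est (p q p' : nat -> R -> R) n : (forall n, L2 setT (p n)) -> (forall n, L2 setT (q n)) ->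
    (forall x, p' n x = chi n * p n x + delta n * q n x) ->
    nsq setT (p n) <= r n -> nsq setT (q n) <= K' * skap n -> (N0 < n)%N ->
    nsq setT (subr p p' n) <= C * (r n.-1 + r n + r n.+1).
  move=> pL qL pE pn qn Nn.
  have -> : nsq setT (subr p p' n) = nsq setT (fun x => (1 - chi n) * p n x + (- delta n) * q n x).
    by apply: eq_nsq => x _; rewrite /subr pE; ring.
  apply: le_trans (nsqD_le measurableT (L2Z _ measurableT (pL n)) (L2Z _ measurableT (qL n))) _.
  rewrite !nsqZ// sqrrN.
  have h1 : (1 - chi n) ^+ 2 * nsq setT (p n) <= r n.
    apply: le_trans pn; apply: ler_piMl; first exact: nsq_ge0.
    have := @cutoff_ge0 R N n N_gt0; have := @cutoff_le1 R N n N_gt0; rewrite -/(chi n); nra.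
  have h2 : delta n ^+ 2 * nsq setT (q n) <= K' * (D * (r n.-1 + r n + r n.+1)).
    apply: (@le_trans _ _ (delta n ^+ 2 * (K' * skap n))); first by apply: ler_wpM2l; [exact: sqr_ge0|].
    have -> : delta n ^+ 2 * (K' * skap n) = K' * (delta n ^+ 2 * skap n) by ring.
    by apply: ler_wpM2l; [exact: ltW|exact: deltaK].
  have := r0 n.-1; have := r0 n.+1; rewrite /C; clearbody D r; lra.
have zero (p q p' : nat -> R -> R) n :
    (forall x, p' n x = chi n * p n x + delta n * q n x) ->
    (n < N0.+1)%N -> nsq setT (subr p p' n) = 0.
  move=> pE nN; rewrite /nsq Rint_eq0// => x _.
  by rewrite /subr pE chi1 ?(ltnW nN)// delta0// mul1r mul0r addr0 subrr expr0n.
have vu : nHle (subr v u) e.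
  move=> M; have -> : e = 3 * C * (e / (3 * C)) by rewrite mulrCA mulfV ?mulr1// gt_eqF// mulr_gt0.
  apply: (@sum_neighbours_le (fun n => nsq setT (subr v u n)) r N0) => //; last 1 first.
  - move=> n nN; apply: (est v (@kick R)) => //; first by rewrite lerDl nsq_ge0.
    by have [] := HK' n.
  - move=> n nN; exact: (zero v (@kick R)).
  - exact: ltW.
have gf : nHle (subr g f) e.
  move=> M; have -> : e = 3 * C * (e / (3 * C)) by rewrite mulrCA mulfV ?mulr1// gt_eqF// mulr_gt0.
  apply: (@sum_neighbours_le (fun n => nsq setT (subr g f n)) r N0) => //; last 1 first.
  - move=> n nN; apply: (est g fk) => //; first by rewrite lerDr nsq_ge0.
    by have [] := HK' n.
  - move=> n nN; exact: (zero g fk).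
  - exact: ltW.
have uL n : L2 setT (u n) by apply: L2D => //; exact: L2Z.
have fL n : L2 setT (f n) by apply: L2D => //; exact: L2Z.
have back (p q : nat -> R -> R) c : (forall n, L2 setT (p n)) -> (forall n, L2 setT (q n)) ->
    nHle p c -> nHle (subr p q) e -> inHr q.
  move=> pL qL pc pq; split => //; exists (2 * c + 2 * e) => M.
  have -> : \sum_(0 <= n < M) nsq setT (q n) = \sum_(0 <= n < M) nsq setT (subr p (subr p q) n).
    by apply: eq_bigr => n _; apply: eq_nsq => x _; rewrite /subr; ring.
  by apply: nHle_sub => //; move=> n; exact: L2B.
exists u, f; split => //; split.
  by split => //; [exact: back vc vu|exact: back gc gf].
(* The component [2 * N] may still carry a kick, because [chi] is nonzero at [2 * N - 1]. *)
exists (2 * N).+1 => n nN x.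
by rewrite /u chi0 ?(ltnW nN)// delta0'// !mul0r addr0.
Qed.

End Approximation.

(** * Regularity of a single component from its weak equation *)

Section Regularity.
Context {R : realType}.
Local Notation mu := (@lebesgue_measure R).
Implicit Types (f g h u v w phi V G : R -> R).

Lemma H2on_hat_opp a p d : 0 < d ->
  H2on Jm (fun x => hat a (- p) d (- x)) (fun x => - hat1 a (- p) d (- x))
    (fun x => hat2 a (- p) d (- x) : R).
Proof.
by move=> d0; have := H2on_opp (@measurable_Jp R) (H2on_hat a (- p) d0); rewrite oppset_Jp.
Qed.

(* A compactly supported function with value [a] and one-sided derivatives
   [p] and [m] at the origin. *)
Definition tent a p m (x : R) : R := if 0 <= x then hat a p 1 x else hat a (- m) 1 (- x).
Definition tent2 a p m (x : R) : R := if 0 < x then hat2 a p 1 x else hat2 a (- m) 1 (- x).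

Lemma strong_tent a p m : strong (tent a p m) (hat1 a p 1)
  (fun x => - hat1 a (- m) 1 (- x)) (tent2 a p m).
Proof.
by apply: (strong_glue (H2on_hat _ _ ltr01) (H2on_hat_opp _ _ ltr01)); rewrite oppr0 !hat_0.
Qed.

Lemma tent_0 a p m : tent a p m 0 = a.
Proof. by rewrite /tent lexx hat_0. Qed.

Lemma tent_eq0 x : tent 0 0 0 x = 0.
Proof. by rewrite /tent oppr0; case: ifP => _; rewrite /hat add0r mul0r mul0r. Qed.

Lemma tent2_eq0 x : tent2 0 0 0 x = 0.
Proof. by rewrite /tent2 oppr0; case: ifP => _; rewrite /hat2 !mul0r !add0r mul0r. Qed.

Lemma norm_in_itv (a b x : R) : a < x -> x < b -> `|x| <= `|a| + `|b|.
Proof.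
move=> ax xb; have := ler_norm b; have := ler_norm (- a); rewrite normrN => ha hb.
have := normr_ge0 a; have := normr_ge0 b => h3 h4.
by rewrite ler_norml; apply/andP; split; lra.
Qed.

(** Vanishing outside a bounded interval passes to the derivatives because the complement is open;
    the left half-line follows by reflection. *)
Lemma C2_strong (f f1 f2 : R -> R) (b : R) :
  (forall x, isder f x (f1 x)) -> (forall x, isder f1 x (f2 x)) -> continuous f2 ->
  0 < b -> (forall x, b < `|x| -> f x = 0) -> strong f f1 f1 f2.
Proof.
have der0 (k l : R -> R) : (forall x, isder k x (l x)) -> (forall x, b < `|x| -> k x = 0) ->
    forall x, b < `|x| -> l x = 0.
  move=> kl k0 x bx; rewrite -(isder_derive1 (kl x)); apply: isder_derive1.
  apply: (isD_near (f := cst 0)); last exact: isDcst.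
  near=> y; rewrite k0//; near: y.
  have cn : {for x, continuous (fun y : R => `|y|)} by exact: norm_continuous.
  by move/cvgr_gt : cn; apply.
have pos (k k1 k2 : R -> R) : (forall x, isder k x (k1 x)) -> (forall x, isder k1 x (k2 x)) ->
    continuous k2 -> 0 < b -> (forall x, b < `|x| -> k x = 0) -> H2on Jp k k1 k2.
  move=> d1 d2 c2 b0 k0.
  have c0 : continuous k by move=> x; exact: isD_continuous (d1 x).
  have c1 : continuous k1 by move=> x; exact: isD_continuous (d2 x).
  have z (l : R -> R) : (forall x, b < `|x| -> l x = 0) -> forall x, b < x -> l x = 0.
    by move=> l0 x bx; apply: l0; apply: lt_le_trans (ler_norm x).
  split; [| |split].
  - by apply: (isprimS (@subsetT _ _)); exact: isprim_C1.
  - by apply: (isprimS (@subsetT _ _)); exact: isprim_C1.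
  - by apply: (continuous_L2_Jp b0) => //; exact: z.
  - by apply: (continuous_L2_Jp b0) => //; exact: (z _ (der0 _ _ d1 k0)).
  - by apply: (continuous_L2_Jp b0) => //; exact: (z _ (der0 _ _ d2 (der0 _ _ d1 k0))).
move=> d1 d2 c2 b0 f0; split; first exact: pos.
have opp (k l : R -> R) : (forall x, isder k x (l x)) ->
    forall x, isder (fun y => k (- y)) x (- l (- x)).
  move=> kl x; rewrite -mulrN1; apply: (isDcomp (g := fun y : R => - y)) => //.
  by apply: isDN; exact: isDid.
have e2 x : isder (fun y => - f1 (- y)) x (f2 (- x)).
  by rewrite -[f2 _]opprK; apply: isDN; exact: opp.
have c2' : continuous (fun x => f2 (- x)).
  by move=> x; apply: continuous_comp; [exact: opp_continuous|exact: c2].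
have f0' (x : R) : b < `|x| -> f (- x) = 0 by rewrite -[`|x|]normrN; exact: f0.
have := H2on_opp (@measurable_Jp R) (pos _ _ _ (opp _ _ d1) e2 c2' b0 f0'); rewrite oppset_Jp.
have -> : (fun x => f (- - x)) = f by apply/funext => x; rewrite opprK.
have -> : (fun x => - - f1 (- - x)) = f1 by apply/funext => x; rewrite !opprK.
by have -> : (fun x => f2 (- - x)) = f2 by apply/funext => x; rewrite opprK.
Unshelve. all: by end_near. Qed.

(** The weak equation makes [V] a double primitive of [h]; the hypothesis on primitives, to be
    filled by [primitive_L2_Jp] or [primitive_L2_Jm], puts the intermediate derivative in [L^2]. *)
Lemma weak_regular_side I J V h : side I J -> ~ I 0 ->
  (forall v w, isprim J v w -> isprim J w h -> L2 J v -> L2 J h -> L2 J w) ->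
  L2 setT V -> L2 setT h ->
  (forall phi, tst I phi -> \int[mu]_x (V x * derive1 (derive1 phi) x) = \int[mu]_x (h x * phi x)) ->
  exists v w, H2on J v w h /\ {ae mu, forall x, I x -> V x = v x}.
Proof.
move=> sIJ I0 pL V2 h2 H; have [oI mJ iJ [IJ JI] _] := sIJ; have [mI iI _ _] := oI.
have iT : is_interval [set: R] by move=> ? ? _ _ ? _.
have li (f : R -> R) : L2 setT f -> locitg setT f by apply: L2_locitg.
have toI (f phi : R -> R) : tst I phi -> \int[mu]_(x in I) (f x * phi x) = \int[mu]_x (f x * phi x).
  move=> [_ [a [b [Ia Ib ab p0]]]].
  by rewrite (Rint_supp _ iI Ia Ib p0) (Rint_supp _ iT Logic.I Logic.I p0).
have Vi : locitg I V by apply: locitgS (li _ V2).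
have [|v [w [vw wh Vv]]] := wd2_prim oI Vi (li _ h2).
  by move=> phi tp; rewrite !toI//; [exact: H|exact: (tst_derive1 oI (tst_derive1 oI tp))].
exists v, w; split => //.
have mv : measurable_fun I v.
  by apply: measurable_funTS; apply: continuous_measurable_fun; exact: isprim_continuous vw.
have vL : L2 J v.
  by apply: (side_L2 sIJ); apply: ae_eq_L2 (L2S mI measurableT (@subsetT _ _) V2).
have hL : L2 J h by exact: L2S h2.
have vwJ := isprimS (@subsetT _ J) vw; have whJ := isprimS (@subsetT _ J) wh.
by split => //; split => //; exact: pL vwJ whJ vL hL.
Qed.

Lemma weak_regular V G (k : R) : L2 setT V -> L2 setT G ->
  (forall z wp wm h, strong z wp wm h -> z 0 = 0 -> wp 0 = wm 0 ->
    \int[mu]_x ((- h x + k * z x) * V x) = \int[mu]_x (z x * G x)) ->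
  exists v wp wm, strong v wp wm (fun x => k * V x - G x) /\ {ae mu, forall x, V x = v x}.
Proof.
move=> V2 G2 H.
(* The value that [- V'' + k * V = G] forces on the second derivative of [V]. *)
pose h x := k * V x - G x; have h2 : L2 setT h by apply: L2B => //; exact: L2Z.
have H' z wp wm hz : strong z wp wm hz -> z 0 = 0 -> wp 0 = wm 0 ->
    \int[mu]_x (hz x * V x) = \int[mu]_x (z x * h x).
  move=> S z0 w0; have [zL hzL] := strong_L2 S.
  have i1 : itg setT (fun x => hz x * V x) by exact: L2M.
  have i2 : itg setT (fun x => z x * V x) by exact: L2M.
  have i3 : itg setT (fun x => z x * G x) by exact: L2M.
  have i2k := itgZ k measurableT i2.
  have := H z wp wm hz S z0 w0.
  have -> : \int[mu]_x ((- hz x + k * z x) * V x) =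
     k * \int[mu]_x (z x * V x) - \int[mu]_x (hz x * V x).
    by rewrite -RintegralZl// -RintegralB//; apply: eq_Rintegral => x _; ring.
  have -> : \int[mu]_x (z x * h x) = k * \int[mu]_x (z x * V x) - \int[mu]_x (z x * G x).
    by rewrite -RintegralZl// -RintegralB//; apply: eq_Rintegral => x _; rewrite /h; ring.
  by move=> <-; ring.
have Ht I : open_itv I -> ~ I 0 -> forall phi, tst I phi ->
    \int[mu]_x (V x * derive1 (derive1 phi) x) = \int[mu]_x (h x * phi x).
  move=> oI I0 phi [sp [a [b [Ia Ib ab p0]]]].
  have [_ iI _ _] := oI; pose c : R := `|a| + `|b| + 1.
  have c0 : 0 < c by rewrite ltr_wpDl// addr_ge0.
  have S : strong phi (derive1 phi) (derive1 phi) (derive1 (derive1 phi)).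
    have sp1 := smooth_derive1 sp.
    apply: (C2_strong (smooth_is_derive sp) (smooth_is_derive sp1) _ c0) => [|x cx].
      exact: smooth_continuous (smooth_derive1 sp1).
    apply: p0.
    have [xa|ax] := leP x a; [by left|right]; rewrite leNgt; apply/negP => xb.
    have := lt_le_trans cx (norm_in_itv ax xb).
    by rewrite /c ltNge lerDl ler01.
  have := H' _ _ _ _ S.
  have -> : phi 0 = 0.
    apply: p0; apply: contrapT => /not_orP[/negP + /negP]; rewrite -!ltNge => a0 b0.
    by apply: I0; apply: iI Ia Ib _ _; rewrite !ltW.
  move=> /(_ erefl erefl) e.
  rewrite (_ : \int[mu]_x (V x * _ x) = \int[mu]_x (derive1 (derive1 phi) x * V x)); last first.
    by apply: eq_Rintegral => x _; rewrite mulrC.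
  by rewrite e; apply: eq_Rintegral => x _; rewrite mulrC.
have Ip0 : ~ @half_pos R 0 by rewrite /half_pos /= ltxx.
have Im0 : ~ @half_neg R 0 by rewrite /half_neg /= ltxx.
have [vp [wp [Hp Ep]]] := weak_regular_side side_pos Ip0
  (fun v w => @primitive_L2_Jp R v w h) V2 h2 (Ht _ (@open_itv_half_pos R) Ip0).
have [vm [wm [Hm Em]]] := weak_regular_side side_neg Im0
  (fun v w => @primitive_L2_Jm R v w h) V2 h2 (Ht _ (@open_itv_half_neg R) Im0).
have ae0 := @ae_neq0 R.
have mJp := @measurable_Jp R; have mJm := @measurable_Jm R.
(* Against a function of value 0 and slope 1 at the origin, Green's formula on the two sides leaves
   [vp 0 - vm 0], and the weak equation makes it zero. *)
have cont0 : vp 0 = vm 0.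
  have S := strong_tent 0 1 1; have [zL hzL] := strong_L2 S.
  have wm0 : - hat1 0 (- 1) 1 (- 0) = 1 :> R by rewrite oppr0 hat1_0 opprK.
  have wp0 : hat1 0 1 1 0 = 1 :> R by rewrite hat1_0.
  have := H' _ _ _ _ S (tent_0 _ _ _); rewrite wm0 wp0 => /(_ erefl) e.
  have [Sp Sm] := S.
  have [_ _ [vpL _ _]] := Hp; have [_ _ [vmL _ _]] := Hm.
  have := green_Jp Sp Hp; have := green_Jm Sm Hm; rewrite tent_0 wm0 wp0 !mul1r !mul0r !subr0.
  move=> gm gp.
  have qi : itg setT (fun x => tent 0 1 1 x * h x - tent2 0 1 1 x * V x).
    by apply: itgB => //; exact: L2M.
  have := Rint_setT qi.
  have -> : \int[mu]_x (tent 0 1 1 x * h x - tent2 0 1 1 x * V x) = 0.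
    by rewrite RintegralB//; [rewrite -e subrr|exact: L2M|exact: L2M].
  have swap J (u' : R -> R) : measurable J -> L2 J u' -> {ae mu, forall x, J x -> V x = u' x} ->
      \int[mu]_(x in J) (tent 0 1 1 x * h x - tent2 0 1 1 x * V x) =
      \int[mu]_(x in J) (tent 0 1 1 x * h x - tent2 0 1 1 x * u' x) :> R.
    move=> mJ uL Vu; have sT (f : R -> R) : L2 setT f -> L2 J f by apply: L2S.
    have [m1 _] := sT _ zL; have [m2 _] := sT _ hzL; have [m3 _] := sT _ h2.
    have [m4 _] := sT _ V2; have [m5 _] := uL.
    apply: ae_eq_Rint => //.
    - by apply: measurable_funB; exact: measurable_funM.
    - by apply: measurable_funB; exact: measurable_funM.
    - by move: Vu => /aeS; apply => x Hx Jx; rewrite Hx.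
  have EpJ : {ae mu, forall x, Jp x -> V x = vp x}.
    move: (aeI Ep ae0) => /aeS; apply => x [Hx x0] /JpP xp; apply: Hx.
    by rewrite /half_pos /= lt_neqAle xp andbT eq_sym; exact/eqP.
  have EmJ : {ae mu, forall x, Jm x -> V x = vm x}.
    move: (aeI Em ae0) => /aeS; apply => x [Hx x0] /JmP xp; apply: Hx.
    by rewrite /half_neg /= lt_neqAle xp andbT; exact/eqP.
  rewrite (swap _ _ mJp vpL EpJ) (swap _ _ mJm vmL EmJ) gp gm => /esym/eqP.
  by rewrite addrC subr_eq0 => /eqP.
exists (fun x => if 0 <= x then vp x else vm x), wp, wm; split.
  have := strong_glue Hp Hm cont0; congr strong.
  by apply/funext => x; case: ifP.
move: (aeI (aeI Ep Em) ae0) => /aeS; apply => x [[e1 e2] x0].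
case: ifPn => [xp|]; first by apply: e1; rewrite /half_pos/= lt_neqAle xp andbT eq_sym; exact/eqP.
by rewrite -ltNge => xm; exact: e2.
Qed.

End Regularity.

(** * Elements of the adjoint domain of the finite operator *)

Section AdjointRegularity.
Context {R : realType}.
Local Notation mu := (@lebesgue_measure R).
Implicit Types (u v f g h w : nat -> R -> R).

Lemma sum_truncate (F : nat -> R) M K : (M <= K)%N -> (forall n, (M <= n)%N -> F n = 0) ->
  \sum_(0 <= n < K) F n = \sum_(0 <= n < M) F n.
Proof.
move=> MK F0; rewrite (@big_cat_nat _ _ _ M 0 K)//=.
have -> : \sum_(M <= n < K) F n = 0 by rewrite big_nat big1// => n /andP[Mn _]; exact: F0.
by rewrite addr0.
Qed.

Lemma dotr_finite u v M : (forall n, (M <= n)%N -> dotn u v n = 0) ->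
  dotr u v = \sum_(0 <= n < M) dotn u v n.
Proof.
move=> uv0; apply: cvg_lim => //; apply: cvg_near_cst; near=> K.
apply: sum_truncate => //; near: K; exact: nbhs_infty_ge.
Unshelve. all: by end_near. Qed.

Lemma inHr_finite u N : (forall n, L2 setT (u n)) ->
  (forall n, (N <= n)%N -> forall x, u n x = 0) -> inHr u.
Proof.
move=> u2 u0; split => //; exists (\sum_(0 <= n < N) nsq setT (u n)) => M.
have s0 n : (N <= n)%N -> nsq setT (u n) = 0.
  by move=> Nn; rewrite /nsq Rint_eq0// => x _; rewrite u0// expr0n.
have [MN|NM] := leqP M N.
  rewrite [leRHS](@big_cat_nat _ _ _ M)//= lerDl; apply: sumr_ge0 => n _; exact: nsq_ge0.
by rewrite (sum_truncate (ltnW NM) s0).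
Qed.

Lemma rA0_finite (m0 : R) u wp wm h N : (forall n, strong (u n) (wp n) (wm n) (h n)) ->
  (forall n, m0 * (wp n 0 - wm n 0) =
     Num.sqrt n.+1%:R * u n.+1 0 + Num.sqrt n%:R * u n.-1 0) ->
  (forall n, (N <= n)%N -> forall x, u n x = 0) -> (forall n, (N <= n)%N -> forall x, h n x = 0) ->
  rA0 m0 u (fun n x => - h n x + kap n * u n x).
Proof.
move=> S Mu u0 h0; split; last by exists N.
have uL n : L2 setT (u n) by have [] := strong_L2 (S n).
have hL n : L2 setT (h n) by have [] := strong_L2 (S n).
split; first by exists wp, wm, h.
- exact: (inHr_finite (N := N)).
- apply: (inHr_finite (N := N)) => [n|n Nn x]; last by rewrite u0// h0// mulr0 oppr0 addr0.
  by apply: L2D => //; [exact: L2N|exact: L2Z].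
Qed.

Lemma dotn_ae u v v' n : L2 setT (u n) -> L2 setT (v n) -> L2 setT (v' n) ->
  {ae mu, forall x, v n x = v' n x} -> dotn u v n = dotn u v' n.
Proof.
move=> [mu' _] [mv _] [mv' _] vv'; apply: ae_eq_Rint => //.
- exact: measurable_funM.
- exact: measurable_funM.
- by move: vv' => /aeS; apply => x Hx _; rewrite Hx.
Qed.

(** A sequence concentrated in component [n], with zero value and no jump at the origin, has both
    sides of every matching condition equal to zero; testing with it isolates the weak equation of
    [v n]. *)
Lemma adjoint_regular (m0 : R) v g n : inHr v -> inHr g ->
  (forall u f, rA0 m0 u f -> dotr f v = dotr u g) ->
  exists v' wp wm : R -> R, strong v' wp wm (fun x => kap n * v n x - g n x) /\
    {ae mu, forall x, v n x = v' x}.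
Proof.
move=> [v2 _] [g2 _] H; apply: weak_regular => // z wp wm h S z0 w0.
pose c (q : R -> R) m : R -> R := if m == n then q else fun=> 0.
have cz m : c z m 0 = 0 by rewrite /c; case: ifP.
have cn q m : (n.+1 <= m)%N -> forall x, c q m x = 0 by move=> nm x; rewrite /c gtn_eqF.
have A : rA0 m0 (c z) (fun m x => - c h m x + kap m * c z m x).
  apply: (rA0_finite (wp := c wp) (wm := c wm) (N := n.+1)); [|move=> m|exact: cn|exact: cn].
    by move=> m; rewrite /c; case: ifP => _ //; exact: strong0.
  by rewrite !cz !mulr0 addr0 /c; case: ifP => _; rewrite ?w0 subrr mulr0.
have single (p q : nat -> R -> R) : (forall m, m != n -> forall x, p m x = 0) ->
    dotr p q = dotn p q n.
  move=> p0; have pq m : m != n -> dotn p q m = 0.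
    by move=> mn; rewrite /dotn Rint_eq0// => x _; rewrite p0// mul0r.
  rewrite (@dotr_finite _ _ n.+1) => [|m nm]; last by rewrite pq// gtn_eqF.
  by rewrite big_nat_recr//= big_nat big1 ?add0r// => m /andP[_ mn]; rewrite pq// ltn_eqF.
have := H _ _ A; rewrite !single.
- by rewrite /dotn /c eqxx.
- by move=> m /negbTE mn x; rewrite /c mn.
- by move=> m /negbTE mn x; rewrite /c mn mulr0 oppr0 addr0.
Qed.

(* Testing against a finite sequence with boundary values [a n = (n == k)] and
   the jumps prescribed by them isolates the [k]-th matching condition. *)
Lemma adjoint_matching (m0 : R) v wp wm h g : 0 < m0 ->
  (forall n, strong (v n) (wp n) (wm n) (h n)) ->
  (forall n x, g n x = - h n x + kap n * v n x) ->
  (forall u f, rA0 m0 u f -> dotr f v = dotr u g) ->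
  forall k, m0 * (wp k 0 - wm k 0) =
    Num.sqrt k.+1%:R * v k.+1 0 + Num.sqrt k%:R * v k.-1 0.
Proof.
move=> m0_gt0 S gE H k.
have m00 : m0 != 0 by rewrite gt_eqF.
pose a (m : nat) : R := (m == k)%:R.
have a0 m : (k < m)%N -> a m = 0 by move=> km; rewrite /a gtn_eqF.
(* The jump that the [m]-th matching condition imposes on boundary values [a]; it is nonzero at most
   for the two neighbours of [k], so the sequence is finite. *)
pose J m : R := (Num.sqrt m.+1%:R * a m.+1 + Num.sqrt m%:R * a m.-1) / m0.
have J0 m : (k.+2 <= m)%N -> J m = 0.
  case: m => // m km; rewrite /J !a0 ?mulr0 ?addr0 ?mul0r//=.
  by apply: ltnW; exact: ltnW.
pose u m := tent (a m) (J m) 0; pose hu m := tent2 (a m) (J m) 0.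
have Su m : strong (u m) (hat1 (a m) (J m) 1) (fun x => - hat1 (a m) (- 0) 1 (- x)) (hu m).
  exact: strong_tent.
have uz m : (k.+2 <= m)%N -> forall x, u m x = 0.
  by move=> km x; rewrite /u a0 ?J0//; [exact: tent_eq0|exact: ltnW].
have hz m : (k.+2 <= m)%N -> forall x, hu m x = 0.
  by move=> km x; rewrite /hu a0 ?J0//; [exact: tent2_eq0|exact: ltnW].
have jump m : hat1 (a m) (J m) 1 0 - - hat1 (a m) (- 0) 1 (- 0) = J m.
  by rewrite opprK !oppr0 !hat1_0 addr0.
have A : rA0 m0 u (fun m x => - hu m x + kap m * u m x).
  apply: (rA0_finite Su _ uz hz) => m.
  by rewrite jump /u !tent_0 /J mulrCA mulfV// mulr1.
set f := (fun m x => _) in A.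
(* The defect of [v] in its [m]-th condition. In [step] it appears multiplied by [a m], so after the
   Wronskian has telescoped away the whole sum reduces to [- X k]. *)
pose X m : R := m0 * (wp m 0 - wm m 0) - (Num.sqrt m.+1%:R * v m.+1 0 + Num.sqrt m%:R * v m.-1 0).
pose t m : R := Num.sqrt m%:R * (a m * v m.-1 0 - a m.-1 * v m 0).
have step m : m0 * (dotn f v m - dotn u g m) = t m.+1 - t m - a m * X m.
  rewrite (@green_term R u (fun m => hat1 (a m) (J m) 1) (fun m x => - hat1 (a m) (- 0) 1 (- x)) hu
    f v wp wm h g m (Su m) (fun=> erefl) (S m) (gE m)) jump mulrBr mulrA.
  rewrite /u tent_0 /J mulrCA mulfV// mulr1 /t /X /=; ring.
have z0 (p q : nat -> R -> R) m : (forall x, p m x = 0) -> dotn p q m = 0.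
  by move=> p0; rewrite /dotn Rint_eq0// => x _; rewrite p0 mul0r.
have := H _ _ A.
rewrite (@dotr_finite _ _ k.+2) => [|m km]; last first.
  by apply: z0 => x; rewrite /f hz// uz// mulr0 oppr0 addr0.
rewrite (@dotr_finite _ _ k.+2) => [|m km]; last by apply: z0 => x; exact: uz.
move/eqP; rewrite -subr_eq0 -sumrB => /eqP/(congr1 (fun y => m0 * y)).
rewrite mulr0 mulr_sumr (eq_bigr _ (fun n _ => step n)) sumrB telescope_sumr//.
rewrite {1}/t !a0//= !mul0r subrr mulr0 {1}/t sqrtr0 mul0r subrr sub0r.
rewrite big_nat_recr//= a0// mul0r addr0 big_nat_recr//= big_nat big1 ?add0r => [|m /andP[_ mk]]; last first.
  by rewrite /a ltn_eqF// mul0r.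
by rewrite /a eqxx mul1r => /eqP; rewrite oppr_eq0 /X subr_eq0 => /eqP.
Qed.

Lemma rA0_adjoint (m0 : R) v g : 0 < m0 -> inHr v -> inHr g ->
  (forall u f, rA0 m0 u f -> dotr f v = dotr u g) ->
  exists v' g', [/\ rA m0 v' g', forall n, {ae mu, forall x, v n x = v' n x} &
    forall n, {ae mu, forall x, g n x = g' n x}].
Proof.
move=> m0_gt0 vH gH H; have [[v2 [cv vc]] [g2 [cg gc]]] := (vH, gH).
have /choice[v' H1] := fun n => adjoint_regular n vH gH H.
have /choice[wp H2] := H1; have /choice[wm H3] := H2.
pose h n x := kap n * v n x - g n x.
have S n : strong (v' n) (wp n) (wm n) (h n) by case: (H3 n).
have vv' n : {ae mu, forall x, v n x = v' n x} by case: (H3 n).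
(* Recomputed from the continuous representative [v'], because [rdom] demands the differential
   expression at every point and not only almost everywhere. *)
pose g' n x := - h n x + kap n * v' n x.
have gg' n : {ae mu, forall x, g n x = g' n x}.
  by move: (vv' n) => /aeS; apply => x Hx; rewrite /g' /h Hx; ring.
have v'2 n : L2 setT (v' n) by have [] := strong_L2 (S n).
have h2 n : L2 setT (h n) by have [] := strong_L2 (S n).
have g'2 n : L2 setT (g' n) by apply: L2D => //; [exact: L2N|exact: L2Z].
have aensq (p q : nat -> R -> R) n : L2 setT (p n) -> L2 setT (q n) ->
    {ae mu, forall x, p n x = q n x} -> nsq setT (q n) = nsq setT (p n).
  move=> [mp _] [mq _] pq; symmetry; apply: ae_eq_nsq => //.
  by move: pq => /aeS; apply => x Hx _.
have v'H : inHr v'.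
  by split => //; exists cv => M; rewrite (eq_bigr _ (fun n _ => aensq v v' n (v2 n) (v'2 n) (vv' n))).
have g'H : inHr g'.
  by split => //; exists cg => M; rewrite (eq_bigr _ (fun n _ => aensq g g' n (g2 n) (g'2 n) (gg' n))).
exists v', g'; split => //; split => //.
exists wp, wm, h; split => //.
apply: (adjoint_matching m0_gt0 S (g := g')) => // u f A.
have [[[wpu [wmu [hu [Su fE Mu]]]] [u2 _] [f2 _]] _] := A.
have -> : dotr f v' = dotr f v.
  by rewrite /dotr; congr (limn _); apply/funext => M; apply: eq_bigr => n _; rewrite (dotn_ae (v' := v')).
rewrite (H _ _ A) /dotr; congr (limn _); apply/funext => M; apply: eq_bigr => n _.
by rewrite (dotn_ae (v' := g')).
Qed.

End AdjointRegularity.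

(** * Density of the domain by truncation and averaging *)

Section Density.
Context {R : realType}.
Local Notation mu := (@lebesgue_measure R).
Implicit Types (f g h F : R -> R) (P Q : (R -> R) -> Prop).

Lemma nsq_dominated f (f_ : nat -> R -> R) G : (forall n, measurable_fun setT (f_ n)) ->
  measurable_fun setT f -> itg setT G -> (forall n x, (f x - f_ n x) ^+ 2 <= G x) ->
  {ae mu, forall x, f_ n x @[n --> \oo] --> f x} ->
  nsq setT (fun x => f x - f_ n x) @[n --> \oo] --> (0 : R).
Proof.
move=> mf_ mf Gi le cv.
have m n : measurable_fun setT (fun x => (f x - f_ n x) ^+ 2).
  by apply: measurable_funX; apply: measurable_funB.
have [] := @dominated_convergence _ _ _ mu setT measurableT
  (fun n x => ((f x - f_ n x) ^+ 2)%:E) (fun=> 0%E) (EFin \o G).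
- by move=> n; apply/measurable_EFinP; exact: m.
- exact: measurable_cst.
- move: cv => /aeS; apply => x H _; apply: cvg_EFin; first by apply: nearW.
  have H0 : f x - f_ n x @[n --> \oo] --> (0 : R).
    by rewrite -(subrr (f x)); apply: cvgB => //; exact: cvg_cst.
  have -> : fine \o (fun n => ((f x - f_ n x) ^+ 2)%:E) = fun n => (f x - f_ n x) * (f x - f_ n x).
    by apply/funext => n /=; rewrite expr2.
  by rewrite -[X in _ --> X](mulr0 (0 : R)); exact: cvgM.
- exact: Gi.
- by apply: nearW => x n _ /=; rewrite lee_fin ger0_norm ?sqr_ge0.
move=> _ _ H; apply: (@fine_cvg _ _ _ _ _ (0 : R)); rewrite /=.
by move: H; rewrite integral0.
Qed.

Definition approximable P f := forall e : R, 0 < e ->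
  exists2 g, P g & nsq setT (fun x => f x - g x) <= e.

Lemma approximable_cvg P f (f_ : nat -> R -> R) N : (forall n, (N <= n)%N -> P (f_ n)) ->
  nsq setT (fun x => f x - f_ n x) @[n --> \oo] --> (0 : R) -> approximable P f.
Proof.
move=> Pf cv e e0; have : \forall n \near \oo, nsq setT (fun x => f x - f_ n x) <= e.
  exact: (cvgr_le _ cv).
move=> [M _ HM]; exists (f_ (maxn N M)); first by apply: Pf; rewrite leq_maxl.
by apply: HM; rewrite /= leq_maxr.
Qed.

Lemma approximable_trans P Q f : L2 setT f -> (forall g, P g -> L2 setT g) ->
  (forall g, Q g -> L2 setT g) -> approximable Q f -> (forall g, Q g -> approximable P g) ->
  approximable P f.
Proof.
(* A quarter on each side, as [nsqD_le] doubles both squared distances. *)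
move=> f2 P2 Q2 fQ QP e e0; have e4 : 0 < e / 4 by rewrite divr_gt0.
have [g Qg ge] := fQ _ e4; have [h Ph he] := QP g Qg _ e4.
exists h => //; have mT := @measurableT _ (measurableTypeR R).
have fg : L2 setT (fun x => f x - g x) by apply: L2B => //; exact: Q2.
have gh : L2 setT (fun x => g x - h x) by apply: L2B; [|exact: Q2|exact: P2].
rewrite (@eq_nsq _ _ _ (fun x => (f x - g x) + (g x - h x))) => [|x _]; last by rewrite addrA subrK.
by apply: le_trans (nsqD_le mT fg gh) _; lra.
Qed.

(** Bounded functions supported away from the origin and from infinity. Vanishing near the origin is
    what will make the approximants satisfy every matching condition trivially. *)
Definition bsupp (K r : R) f := [/\ measurable_fun setT f, forall x, `|f x| <= K,
  forall x, `|x| <= r -> f x = 0 & forall x, r^-1 <= `|x| -> f x = 0].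

Lemma bsupp_patch K r f : bsupp K r f -> f = f \_ `[- r^-1, r^-1].
Proof.
move=> [_ _ _ f0]; apply/funext => x; rewrite patchR; case: ifPn => // /negP xr.
apply: f0; apply: contrapT => /negP; rewrite -ltNge ltr_norml => /andP[h1 h2].
by apply: xr; rewrite inE/= in_itv/= !ltW.
Qed.

Lemma bsupp_itg K r f : bsupp K r f -> itg setT f.
Proof.
move=> fb; rewrite (bsupp_patch fb); have [mf fK _ _] := fb; apply: itg_patch => //.
by apply: (itg_bounded (M := K) _ (@subset_refl _ _)) => //; exact: measurable_funTS.
Qed.

Lemma bsupp_L2 K r f : bsupp K r f -> L2 setT f.
Proof.
move=> fb; rewrite (bsupp_patch fb); have [mf fK _ _] := fb; apply: L2_patch => //.
by apply: (L2_bounded (M := K) _ (@subset_refl _ _)) => //; exact: measurable_funTS.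
Qed.

(** The function is kept where [|x|] is neither small nor large and [|f x|] is not large. Every
    nonzero [x] at which this is asked is eventually kept, and the squared error is dominated by
    [f ^+ 2]. *)
Lemma L2_approximable_bsupp f : L2 setT f ->
  approximable (fun g => exists K r, [/\ 0 < r, r <= 1 & bsupp K r g]) f.
Proof.
move=> [mf fi].
pose r n : R := n.+1%:R^-1; pose c n (x : R) := [&& r n < `|x|, `|x| < (r n)^-1 & `|f x| <= n%:R].
pose f_ n (x : R) : R := if c n x then f x else 0.
have r0 n : 0 < r n by rewrite invr_gt0.
have mn : measurable_fun setT (fun x : R => `|x|) by exact: measurableT_comp.
have mf_ n : measurable_fun setT (f_ n).
  apply: measurable_fun_ifT => //.
  apply: measurable_and; first exact: measurable_fun_ltr.
  apply: measurable_and; first exact: measurable_fun_ltr.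
  by apply: measurable_fun_ler => //; exact: measurableT_comp.
apply: (@approximable_cvg _ _ f_ 0).
  move=> n _; exists n%:R, (r n); split => //; first by rewrite invf_le1// ler1n.
  split => // x.
  - by rewrite /f_; case: ifPn => [/and3P[_ _ ->]//|_]; rewrite normr0.
  - by rewrite /f_ /c leNgt => /negbTE ->.
  - by rewrite /f_ /c leNgt => /negbTE ->; rewrite andbF.
apply: (@nsq_dominated _ _ (fun x => f x ^+ 2)) => //.
  move=> n x; rewrite /f_; case: ifP => _; last by rewrite subr0.
  by rewrite subrr expr0n sqr_ge0.
move: (@ae_neq0 R) => /aeS; apply => x /eqP x0.
apply: cvg_near_cst.
have rc : r n @[n --> \oo] --> (0 : R) by exact: cvg_harmonic.
have ax : 0 < `|x| by rewrite normr_gt0.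
have c1 : \forall n \near \oo, r n < `|x| by exact: (cvgr_lt _ rc).
have c2 : \forall n \near \oo, r n < `|x|^-1 by apply: (cvgr_lt _ rc); rewrite invr_gt0.
have c3 : \forall n \near \oo, `|f x| <= n%:R.
  exists (Num.bound `|f x|) => // n /= nn; apply: ltW.
  by apply: lt_le_trans (archi_boundP (normr_ge0 _)) _; rewrite ler_nat.
near=> n; rewrite /f_ /c; have -> : r n < `|x| by near: n.
have -> : `|f x| <= n%:R by near: n.
have -> // : `|x| < (r n)^-1.
rewrite -[`|x|]invrK ltf_pV2 ?posrE ?invr_gt0//; near: n; exact: c2.
Unshelve. all: by end_near. Qed.

(** The one-sided Steklov mean. It gains one order of differentiability, its derivative being the
    difference quotient [fwd d f] when [f] is continuous. *)
Definition avg (d : R) f x := d^-1 * \int[mu]_(t in `[x, x + d]) f t.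

Lemma avgE d f F x : 0 <= d -> isprim setT F f -> avg d f x = d^-1 * (F (x + d) - F x).
Proof.
move=> d0 Ff; have xd : x <= x + d by rewrite lerDl.
by have [_ ->] := Ff x (x + d) Logic.I Logic.I xd.
Qed.

Lemma bsupp_isprim K r f : bsupp K r f -> isprim setT (prim 0 f) f.
Proof. by move=> /bsupp_itg fi; apply: isprim_prim => // x y _ _; exact: itgS fi. Qed.

Lemma avg_continuous K r d f : bsupp K r f -> 0 <= d -> continuous (avg d f).
Proof.
move=> fb d0; have H := bsupp_isprim fb; have cF := isprim_continuous H.
have -> : avg d f = fun x => d^-1 * (prim 0 f (x + d) - prim 0 f x).
  by apply/funext => x; exact: avgE.
move=> x; apply: cvgM; first exact: cvg_cst.
apply: cvgB; last exact: cF.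
apply: (@continuous_comp _ _ _ (fun y : R => y + d) (prim 0 f)); last exact: cF.
by apply: cvgD; [exact: cvg_id|exact: cvg_cst].
Qed.

Lemma avg_bsupp K r d f : 0 < r -> r <= 1 -> bsupp K r f -> 0 < d -> d <= r / 2 ->
  bsupp K (r / 2) (avg d f).
Proof.
move=> r0 r1 fb d0 dr; have fi := bsupp_itg fb; have H := bsupp_isprim fb.
have [mf fK fn ff] := fb.
have avg0 x : (forall t, x <= t -> t <= x + d -> f t = 0) -> avg d f x = 0.
  move=> f0; rewrite /avg Rint_eq0 ?mulr0// => t.
  by rewrite /= in_itv/= => /andP[]; exact: f0.
split.
- by apply: continuous_measurable_fun; exact: avg_continuous fb (ltW d0).
- move=> x; have mI := measurable_itv `[x, x + d].
  have fI : itg `[x, x + d] f by exact: itgS fi.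
  have cI (c : R) : itg `[x, x + d] (fun=> c).
    by apply: (itg_bounded (M := `|c|) mI (@subset_refl _ _)) => //.
  have xd : x <= x + d by rewrite lerDl ltW.
  have cE (c : R) : \int[mu]_(t in `[x, x + d]) c = c * d.
    by rewrite Rint_cst_itv// addrAC subrr add0r.
  have up : \int[mu]_(t in `[x, x + d]) f t <= K * d.
    rewrite -cE; apply: le_Rintegral; [exact: mI|exact: fI|exact: cI|move=> t _].
    exact: le_trans (ler_norm _) (fK t).
  have lo : - K * d <= \int[mu]_(t in `[x, x + d]) f t.
    rewrite -cE; apply: le_Rintegral; [exact: mI|exact: cI|exact: fI|move=> t _].
    by have := fK t; rewrite ler_norml => /andP[].
  rewrite /avg ler_norml; apply/andP; split.
    by rewrite ler_pdivlMl// mulrC.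
  by rewrite ler_pdivrMl// mulrC.
- move=> x xr; apply: avg0 => t xt td; apply: fn.
  by move: xr; rewrite !ler_norml => /andP[h1 h2]; apply/andP; split; lra.
- move=> x xr; apply: avg0 => t xt td; apply: ff.
  have rE : (r / 2)^-1 = 2 * r^-1 by rewrite invf_div.
  move: xr; rewrite rE => xr.
  (* The bound [r <= 1] enters here: from [|x| >= 2 / r] and [d <= r / 2 <= 1 / r], the averaging
     window stays in [|t| >= 1 / r]. *)
  have ri : 1 <= r^-1 by rewrite invf_ge1.
  have [x0|x0] := leP 0 x.
    move: xr; rewrite (ger0_norm x0) => xr.
    by rewrite ger0_norm; lra.
  move: xr; rewrite (ltr0_norm x0) => xr.
  by rewrite ltr0_norm; lra.
Qed.

Lemma isder_quotient_cvg F (x l : R) : isder F x l ->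
  n.+1%:R * (F (x + n.+1%:R^-1) - F x) @[n --> \oo] --> l.
Proof.
move=> [dF <-].
have dv : h^-1 * (F (h + x) - F x) @[h --> (0 : R)^'] --> 'D_1 F x.
  have := dF => /cvg_ex[l' H]; rewrite /derive (cvg_lim _ H)//.
  apply: cvg_trans H; apply: near_eq_cvg; apply: nearW => h /=.
  by rewrite /GRing.scale /= mulr1.
have := (proj1 (cvgr_dnbhsP _ _ _) dv) (fun n => n.+1%:R^-1).
have hc : (forall n, n.+1%:R^-1 != 0 :> R) /\ n.+1%:R^-1 @[n --> \oo] --> (0 : R).
  by split; [move=> n; rewrite invr_eq0 pnatr_eq0|exact: cvg_harmonic].
move=> /(_ hc); apply: cvg_trans; apply: near_eq_cvg; apply: nearW => n /=.
by rewrite invrK [x + _]addrC.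
Qed.

(** Lebesgue's differentiation theorem for the primitive of [f]. *)
Lemma avg_cvg K r f : bsupp K r f ->
  {ae mu, forall x, avg n.+1%:R^-1 f x @[n --> \oo] --> f x}.
Proof.
move=> fb; have fi := bsupp_itg fb.
pose F x := \int[mu]_(t in `]-oo, x]) f t.
have fN (y : R) : mu.-integrable `]-oo, y] (EFin \o f) by exact: itgS fi.
have loc : locally_integrable [set: R] f by apply: open_integrable_locally => //; exact: openT.
have Fp : isprim setT F f.
  move=> x y _ _ xy; split; first exact: itgS fi.
  rewrite /F (Rintegral_itvB (fN y)) ?bnd_simp// Rintegral_itv_obnd_cbnd//.
  exact: itgS fi.
move: (FTC1Ny fN loc) => /aeS; apply => x [dF Fx].
have Fl : 'D_1 F x = f x by rewrite -derive1E.
have /isder_quotient_cvg : isder F x (f x) by exact: (DeriveDef dF Fl).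
apply: cvg_trans; apply: near_eq_cvg; apply: nearW => n /=.
by rewrite (avgE _ _ Fp) ?invr_ge0// invrK.
Qed.

Lemma bsupp_approximable P K r f : 0 < r -> r <= 1 -> bsupp K r f ->
  (forall d, 0 < d -> d <= r / 2 -> P (avg d f)) -> approximable P f.
Proof.
move=> r0 r1 fb PA; have r20 : 0 < r / 2 by rewrite divr_gt0.
have rc : n.+1%:R^-1 @[n --> \oo] --> (0 : R) by exact: cvg_harmonic.
have [N _ HN] : \forall n \near \oo, n.+1%:R^-1 <= r / 2 by exact: (cvgr_le _ rc).
pose f_ n := avg n.+1%:R^-1 f.
have d0 n : 0 < n.+1%:R^-1 :> R by rewrite invr_gt0.
apply: (@approximable_cvg _ _ (fun n => f_ (N + n)%N) 0).
  by move=> n _; apply: PA => //; apply: HN; rewrite /= leq_addr.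
have [mf fK _ ff] := fb.
have fnb n : bsupp K (r / 2) (f_ (N + n)%N).
  by apply: avg_bsupp => //; apply: HN; rewrite /= leq_addr.
pose A : set R := `[- (r / 2)^-1, (r / 2)^-1]%classic.
apply: (@nsq_dominated _ _ ((fun=> (2 * K) ^+ 2 : R) \_ A)).
- by move=> n; have [] := fnb n.
- exact: mf.
- apply: itg_patch; first exact: measurable_itv.
  apply: (itg_bounded (M := (2 * K) ^+ 2) _ (@subset_refl _ _)) => // x _.
  by rewrite ger0_norm ?sqr_ge0.
- move=> n x; have [_ gK _ gf] := fnb n; rewrite patchR; case: ifPn => [_|xA].
    have := ler_normB (f x) (f_ (N + n)%N x); have := gK x; have := fK x => h1 h2 h3.
    rewrite -real_normK ?num_real//; apply: lerXn2r; rewrite ?nnegrE//; first by have := normr_ge0 (f x); lra.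
    lra.
  have xr : (r / 2)^-1 <= `|x|.
    rewrite leNgt; apply/negP; rewrite ltr_norml => /andP[h1 h2].
    by move/negP : xA; apply; rewrite /A inE/= in_itv/= !ltW.
  rewrite gf// ff ?subrr ?expr0n//; apply: le_trans xr.
  by rewrite lef_pV2 ?posrE//; lra.
- move: (avg_cvg fb) => /aeS; apply => x cv.
  have := cvg_comp _ _ (cvg_addnl N) cv.
  by apply: cvg_trans; apply: near_eq_cvg; apply: nearW => n.
Qed.

Definition fwd (d : R) f x := d^-1 * (f (x + d) - f x).

Lemma isder_fwd d f g : (forall x, isder f x (g x)) -> forall x, isder (fwd d f) x (fwd d g x).
Proof.
move=> fg x; rewrite /fwd.
apply: isder_eq.
  apply: isDM; first exact: isDcst.
  apply: isDD; last by apply: isDN; exact: fg.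
  apply: (isDcomp (g := fun y : R => y + d)); first exact: fg.
  by apply: isDD; [exact: isDid|exact: isDcst].
by rewrite /=; ring.
Qed.

Lemma continuous_fwd d f : continuous f -> continuous (fwd d f).
Proof.
move=> cf x; apply: cvgM; first exact: cvg_cst.
apply: cvgB; last exact: cf.
apply: (@continuous_comp _ _ _ (fun y : R => y + d) f); last exact: cf.
by apply: cvgD; [exact: cvg_id|exact: cvg_cst].
Qed.

Lemma isder_avg d f : 0 <= d -> continuous f -> forall x, isder (avg d f) x (fwd d f x).
Proof.
move=> d0 cf; have fp : isprim setT (prim 0 f) f.
  apply: isprim_prim => // x y _ _; apply: itg_continuous; exact: continuous_subspaceT.
have -> : avg d f = fwd d (prim 0 f) by apply/funext => x; rewrite (avgE _ d0 fp).
by apply: isder_fwd => x; exact: isder_prim.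
Qed.

(* Averaging three times: bounded functions become continuous, then [C1], then [C2]. *)
Lemma L2_approximable_strong f : L2 setT f ->
  approximable (fun z => exists z1 z2, strong z z1 z1 z2 /\ z 0 = 0) f.
Proof.
pose P0 g := exists K r, [/\ 0 < r, r <= 1 & bsupp K r g].
pose P1 g := P0 g /\ continuous g.
pose P2 g := P0 g /\ exists g1, (forall x, isder g x (g1 x)) /\ continuous g1.
pose P3 z := exists z1 z2 : R -> R, strong z z1 z1 z2 /\ z 0 = 0.
have L0 g : P0 g -> L2 setT g by move=> [K [r [_ _ /bsupp_L2]]].
have L1 g : P1 g -> L2 setT g by move=> [/L0].
have L2' g : P2 g -> L2 setT g by move=> [/L0].
have L3 z : P3 z -> L2 setT z by move=> [z1 [z2 [/strong_L2[]]]].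
have half (r : R) : 0 < r -> r <= 1 -> 0 < r / 2 /\ r / 2 <= 1 by move=> *; split; lra.
have A01 g : P0 g -> approximable P1 g.
  move=> [K [r [r0 r1 gb]]]; apply: (bsupp_approximable r0 r1 gb) => d d0 dr.
  have [h0 h1] := half r r0 r1; split; last exact: avg_continuous gb (ltW d0).
  by exists K, (r / 2); split => //; exact: avg_bsupp.
have A12 g : P1 g -> approximable P2 g.
  move=> [[K [r [r0 r1 gb]]] cg]; apply: (bsupp_approximable r0 r1 gb) => d d0 dr.
  have [h0 h1] := half r r0 r1; split; first by exists K, (r / 2); split => //; exact: avg_bsupp.
  exists (fwd d g); split; last exact: continuous_fwd.
  by apply: isder_avg => //; exact: ltW.
have A23 g : P2 g -> approximable P3 g.
  move=> [[K [r [r0 r1 gb]]] [g1 [gg1 cg1]]].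
  apply: (bsupp_approximable r0 r1 gb) => d d0 dr.
  have [h0 h1] := half r r0 r1; have [_ _ z0 zb] := avg_bsupp r0 r1 gb d0 dr.
  have cg : continuous g by move=> x; exact: isD_continuous (gg1 x).
  exists (fwd d g), (fwd d g1); split; last by apply: z0; rewrite normr0 ltW.
  apply: (@C2_strong _ _ _ _ (r / 2)^-1).
  - by apply: isder_avg => //; exact: ltW.
  - exact: isder_fwd.
  - exact: continuous_fwd.
  - by rewrite invr_gt0.
  - by move=> x xr; apply: zb; exact: ltW.
move=> f2; apply: (approximable_trans f2 L3 L0 (L2_approximable_bsupp f2)) => g Pg.
apply: (approximable_trans (L0 g Pg) L3 L1 (A01 g Pg)) => {Pg}g Pg.
by apply: (approximable_trans (L1 g Pg) L3 L2' (A12 g Pg)) => {Pg}g; exact: A23.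
Qed.

(** The approximants vanish at the origin and have no jump there, so any finite sequence of them
    lies in the domain, whatever the coupling. *)
Lemma rA0_dense (m0 : R) (u : nat -> R -> R) (e : R) : inHr u -> 0 < e ->
  exists v f : nat -> R -> R, rA0 m0 v f /\ nHle (subr u v) e.
Proof.
move=> [u2 [c uc]] e0; have e2 : 0 < e / 2 by rewrite divr_gt0.
have [N HN] := summable_tail (fun n => nsq_ge0 setT (u n)) uc e2.
(* The [N] retained components share one half of the error; the successor keeps the denominator
   positive when [N] is zero. The tail uses the other half. *)
have eN : 0 < e / 2 / N.+1%:R by rewrite divr_gt0.
have /choice[z Hz] : forall n, exists z : R -> R, (exists z1 z2, strong z z1 z1 z2 /\ z 0 = 0) /\
    nsq setT (fun x => u n x - z x) <= e / 2 / N.+1%:R.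
  by move=> n; have [z ? ?] := L2_approximable_strong (u2 n) eN; exists z.
have /choice[z1 Hz1] := fun n => (Hz n).1; have /choice[z2 Hz2] := Hz1.
pose cut (q : nat -> R -> R) n : R -> R := if (n < N)%N then q n else fun=> 0.
have cut0 q n : (N <= n)%N -> forall x, cut q n x = 0 by move=> Nn x; rewrite /cut ltnNge Nn.
have z0 n : cut z n 0 = 0 by rewrite /cut; case: ifP => // _; have [] := Hz2 n.
exists (cut z), (fun n x => - cut z2 n x + kap n * cut z n x); split.
  apply: (rA0_finite (wp := cut z1) (wm := cut z1) (N := N)); [|by move=> n; rewrite !z0 !mulr0 subrr mulr0 addr0|exact: cut0|exact: cut0].
  by move=> n; rewrite /cut; case: ifP => _; [have [] := Hz2 n|exact: strong0].
have term n : nsq setT (subr u (cut z) n) <= (if (n < N)%N then e / 2 / N.+1%:R else nsq setT (u n)).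
  rewrite /subr /cut; case: ifP => _; first exact: (Hz n).2.
  by rewrite (@eq_nsq _ _ _ (u n))// => x _; rewrite subr0.
move=> M; apply: (@le_trans _ _ (\sum_(0 <= n < maxn N M) nsq setT (subr u (cut z) n))).
  rewrite [leRHS](@big_cat_nat _ _ _ M) ?leq_maxr//= lerDl.
  by apply: sumr_ge0 => n _; exact: nsq_ge0.
rewrite (@big_cat_nat _ _ _ N) ?leq_maxl//= [leRHS](splitr e); apply: lerD.
  apply: (@le_trans _ _ (\sum_(0 <= n < N) (e / 2 / N.+1%:R))).
    rewrite big_nat [leRHS]big_nat; apply: ler_sum => n /andP[_ nN].
    by apply: le_trans (term n) _; rewrite nN.
  rewrite sumr_const_nat subn0; move: (e / 2) e2 => q q0; rewrite -[_ *+ N]mulr_natr.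
  rewrite -mulrA; apply: ler_piMr; first exact: ltW.
  by rewrite mulrC ltW// ltr_pdivrMr// mul1r ltr_nat.
apply: le_trans (HN (maxn N M)); rewrite big_nat [leRHS]big_nat; apply: ler_sum => n /andP[Nn _].
by apply: le_trans (term n) _; rewrite ltnNge Nn.
Qed.

End Density.

(** * Passing to limits in the pairing *)

Section Closedness.
Local Open Scope complex_scope.
Context {R : realType}.
Local Notation mu := (@lebesgue_measure R).
Implicit Types (u v f g p q w : nat -> R -> R).

Lemma dotrC u v : dotr u v = dotr v u.
Proof.
rewrite /dotr; congr (limn _); apply/funext => M; apply: eq_bigr => n _.
by apply: eq_Rintegral => x _; rewrite mulrC.
Qed.

Lemma dotr_ae u u' v v' : inHr u -> inHr u' -> inHr v -> inHr v' ->
  (forall n, {ae mu, forall x, u n x = u' n x}) -> (forall n, {ae mu, forall x, v n x = v' n x}) ->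
  dotr u v = dotr u' v'.
Proof.
move=> [u2 _] [u2' _] [v2 _] [v2' _] uu vv; rewrite /dotr; congr (limn _); apply/funext => M.
apply: eq_bigr => n _; apply: ae_eq_Rint => //.
- by apply: measurable_funM; [case: (u2 n)|case: (v2 n)].
- by apply: measurable_funM; [case: (u2' n)|case: (v2' n)].
- by move: (aeI (uu n) (vv n)) => /aeS; apply => x [-> ->] _.
Qed.

Lemma nHle_ae u v c : (forall n, L2 setT (u n)) -> (forall n, L2 setT (v n)) ->
  (forall n, {ae mu, forall x, u n x = v n x}) -> nHle u c -> nHle v c.
Proof.
move=> u2 v2 uv uc M; apply: le_trans (uc M); apply: ler_sum => n _.
have [[mu' _] [mv _]] := (u2 n, v2 n); rewrite le_eqVlt; apply/orP; left; apply/eqP; symmetry.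
by apply: ae_eq_nsq => //; move: (uv n) => /aeS; apply => x Hx _.
Qed.

Lemma inHr_ae u v : inHr u -> (forall n, L2 setT (v n)) ->
  (forall n, {ae mu, forall x, u n x = v n x}) -> inHr v.
Proof. by move=> [u2 [c uc]] v2 uv; split => //; exists c; exact: nHle_ae uc. Qed.

Lemma inHr0 : inHr (fun (_ : nat) (_ : R) => 0 : R).
Proof. by apply: (inHr_finite (N := 0)) => // n; exact: L20. Qed.

Lemma dot0r v : dotr (fun _ _ => 0) v = 0.
Proof.
rewrite (@dotr_finite _ _ _ 0) ?big_geq// => n _; 
by rewrite /dotn Rint_eq0// => x _; rewrite mul0r.
Qed.

Lemma dotr_small p (e : R) : inHr p -> 0 < e -> exists2 b : R, 0 < b &
  forall w, inHr w -> nHle w b -> `|dotr p w| <= e.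
Proof.
move=> pH e0; have [p2 [c pc]] := pH.
have c0 : 0 <= c by have := pc 0%N; rewrite big_geq.
have c1 : 0 < c + 1 by rewrite ltr_wpDl.
(* With this weight the first term of the bound is at most [e], and the choice [b = e * s] makes the
   second one equal to [e]; their mean is then at most [e]. *)
pose s := e / (c + 1); have s0 : 0 < s by rewrite divr_gt0.
exists (e * s) => [|w wH wb]; first by rewrite mulr_gt0.
apply: le_trans (dotr_le pH wH pc wb s0) _.
rewrite mulfK ?gt_eqF// ler_pdivrMr// mulr_natr mulr2n lerD2r.
by rewrite /s -mulrA ler_piMr ?(ltW e0)// mulrC ler_pdivrMr// mul1r lerDl.
Qed.

(** For fixed [p] and [q] both pairings are continuous, so the relation survives limits of the pair.
    This serves for the closedness of the adjoint and for extending symmetry from finite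
    sequences. *)
Lemma dotr_closed p q v g : inHr p -> inHr q -> inHr v -> inHr g ->
  (forall b : R, 0 < b -> exists v' g', [/\ inHr v', inHr g' & dotr p v' = dotr q g'] /\
     nHle (subr v v') b /\ nHle (subr g g') b) ->
  dotr p v = dotr q g.
Proof.
move=> pH qH vH gH H; apply/eqP; rewrite -subr_eq0 -normr_le0; apply/ler_addgt0Pr => e e0.
rewrite add0r; have e2 : 0 < e / 2 by rewrite divr_gt0.
have [b1 b10 B1] := dotr_small pH e2; have [b2 b20 B2] := dotr_small qH e2.
have b0 : 0 < Num.min b1 b2 by rewrite lt_min b10.
have [v' [g' [[v'H g'H E] [v'b g'b]]]] := H _ b0.
have h1 : `|dotr p (subr v v')| <= e / 2.
  by apply: B1; [exact: inHr_sub|move=> M; apply: le_trans (v'b M) _; rewrite ge_min lexx].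
have h2 : `|dotr q (subr g g')| <= e / 2.
  by apply: B2; [exact: inHr_sub|move=> M; apply: le_trans (g'b M) _; rewrite ge_min lexx orbT].
have -> : dotr p v - dotr q g = dotr p (subr v v') - dotr q (subr g g').
  rewrite ![dotr _ (subr _ _)]dotrC !dotr_subl// ![dotr _ p]dotrC ![dotr _ q]dotrC E.
  by ring.
by apply: le_trans (ler_normB _ _) _; rewrite [leRHS](splitr e) lerD.
Qed.

Lemma rA_symmetric (m0 : R) u f v g : 0 < m0 -> rA m0 u f -> rA m0 v g -> dotr f v = dotr u g.
Proof.
move=> m0_gt0 uf vg; have [[_ uH fH] [_ vH gH]] := (uf, vg).
rewrite dotrC [RHS]dotrC; symmetry; apply: dotr_closed => // b b0.
have [u' [f' [A ub fb]]] := rA_approximation m0_gt0 uf b0; have [[_ u'H f'H] _] := A.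
exists u', f'; split => //; split => //.
by rewrite [LHS]dotrC -(rA0_symmetric m0_gt0 A vg) dotrC.
Qed.

End Closedness.

(** * Splitting the complex Hilbert space into real and imaginary parts *)

Section Components.
Local Open Scope complex_scope.
Context {R : realType}.
Local Notation mu := (@lebesgue_measure R).
Implicit Types (U V F G : nat -> R -> R[i]) (u v f g : nat -> R -> R).

Definition reH U n := re_fun (U n).
Definition imH U n := im_fun (U n).
Definition cpx u v n x : R[i] := u n x +i* v n x.

Lemma sqnormH_leP U (c : R) : (forall n, inL2 setT (U n)) ->
  (sqnormH U <= c%:E)%E <->
  forall M, \sum_(0 <= n < M) (nsq setT (reH U n) + nsq setT (imH U n)) <= c.
Proof.
move=> U2; have E n : sqnormL2 setT (U n) = (nsq setT (reH U n) + nsq setT (imH U n))%:E.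
  exact: sqnormL2E.
have p0 n : (0 <= sqnormL2 setT (U n))%E by rewrite E lee_fin addr_ge0 ?nsq_ge0.
have S M : (\sum_(0 <= n < M) sqnormL2 setT (U n))%E =
    (\sum_(0 <= n < M) (nsq setT (reH U n) + nsq setT (imH U n)))%:E.
  by rewrite -sumEFin; apply: eq_bigr => n _.
split=> [Uc M|Uc].
  rewrite -lee_fin -S; apply: le_trans Uc; apply: nneseries_lim_ge => n _ _; exact: p0.
apply: lime_le; first by apply: is_cvg_nneseries => n _ _; exact: p0.
by apply: nearW => M; rewrite S lee_fin.
Qed.

Lemma inHP U : inH U <-> inHr (reH U) /\ inHr (imH U).
Proof.
have sum_le (a b : nat -> R) c : (forall n, 0 <= b n) ->
    (forall M, \sum_(0 <= n < M) (a n + b n) <= c) -> forall M, \sum_(0 <= n < M) a n <= c.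
  by move=> b0 H M; apply: le_trans (H M); apply: ler_sum => n _; rewrite lerDl.
split=> [[U2 Uoo]|[[r2 [a ra]] [i2 [b ib]]]].
  have U0 : (0 <= sqnormH U)%E.
    apply: nneseries_ge0 => n _ _; apply: integral_ge0 => x _.
    by rewrite lee_fin addr_ge0 ?sqr_ge0.
  have Ufin : (sqnormH U \is a fin_num) by rewrite ge0_fin_numE.
  have := (sqnormH_leP (fine (sqnormH U)) U2).1; rewrite fineK// => /(_ (lexx _)) H.
  have L n : L2 setT (reH U n) /\ L2 setT (imH U n) by apply/inL2P.
  split; split; [by move=> n; have [] := L n| |by move=> n; have [] := L n|].
  - exists (fine (sqnormH U)); apply: (sum_le _ _ _ _ H) => n; exact: nsq_ge0.
  - exists (fine (sqnormH U)); apply: (@sum_le _ (fun n => nsq setT (reH U n))) => [n|M]; first exact: nsq_ge0.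
    by rewrite (eq_bigr _ (fun n _ => addrC _ _)); exact: H.
have U2 n : inL2 setT (U n) by apply/inL2P => //; split; [exact: r2|exact: i2].
split => //; apply: (@le_lt_trans _ _ (a + b)%:E); last exact: ltry.
by apply/(sqnormH_leP _ U2) => M; rewrite big_split/= lerD.
Qed.

Lemma reH_sub U V : reH (subH U V) = subr (reH U) (reH V).
Proof. by apply/funext => n; apply/funext => x; rewrite /reH /re_fun /subH /subr raddfB. Qed.

Lemma imH_sub U V : imH (subH U V) = subr (imH U) (imH V).
Proof. by apply/funext => n; apply/funext => x; rewrite /imH /im_fun /subH /subr raddfB. Qed.

Lemma sqnormH_sub_lt U V (e : R) : inH U -> inH V -> 0 < e ->
  nHle (subr (reH U) (reH V)) (e ^+ 2 / 4) -> nHle (subr (imH U) (imH V)) (e ^+ 2 / 4) ->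
  (sqnormH (subH U V) < (e ^+ 2)%:E)%E.
Proof.
move=> /inHP[Ur Ui] /inHP[Vr Vi] e0 hr hi.
have e2 : 0 < e ^+ 2 by rewrite exprn_gt0.
(* Quarters instead of halves leave room for the strict inequality. *)
apply: (@le_lt_trans _ _ (e ^+ 2 / 4 + e ^+ 2 / 4)%:E); last by rewrite lte_fin; lra.
have [s2 _] := inHr_sub Ur Vr; have [t2 _] := inHr_sub Ui Vi.
apply/sqnormH_leP => [n|M].
  apply/inL2P => //; have := s2 n; have := t2 n.
  by rewrite -reH_sub -imH_sub.
by rewrite reH_sub imH_sub big_split/= lerD.
Qed.

Lemma nHle_sqnormH_sub U V (b : R) : inH U -> inH V -> (sqnormH (subH U V) < b%:E)%E ->
  nHle (subr (reH U) (reH V)) b /\ nHle (subr (imH U) (imH V)) b.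
Proof.
move=> /inHP[Ur Ui] /inHP[Vr Vi] /ltW.
have [s2 _] := inHr_sub Ur Vr; have [t2 _] := inHr_sub Ui Vi.
have d2 n : inL2 setT (subH U V n).
  by apply/inL2P => //; have := s2 n; have := t2 n; rewrite -reH_sub -imH_sub.
move=> /(sqnormH_leP _ d2); rewrite reH_sub imH_sub => H; split => M; apply: le_trans (H M).
  by apply: ler_sum => n _; rewrite lerDl nsq_ge0.
by apply: ler_sum => n _; rewrite lerDr nsq_ge0.
Qed.

Lemma dotHE U V : inH U -> inH V ->
  dotH U V = (dotr (reH U) (reH V) + dotr (imH U) (imH V)) +i*
             (dotr (imH U) (reH V) - dotr (reH U) (imH V)).
Proof.
move=> /inHP[Ur Ui] /inHP[Vr Vi].
have [[ur2 _] [ui2 _] [vr2 _] [vi2 _]] := And4 Ur Ui Vr Vi.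
have mT := @measurableT _ (measurableTypeR R).
have ReE (z w : R[i]) : complex.Re (z * conjc w) =
    complex.Re z * complex.Re w + complex.Im z * complex.Im w.
  by case: z w => a b [c d] /=; ring.
have ImE (z w : R[i]) : complex.Im (z * conjc w) =
    complex.Im z * complex.Re w - complex.Re z * complex.Im w.
  by case: z w => a b [c d] /=; ring.
rewrite /dotH; congr (_ +i* _).
- rewrite /dotr -limD; [|exact: dot_cvg|exact: dot_cvg]; congr (limn _); apply/funext => M.
  rewrite /series /= fctE -big_split/=; apply: eq_bigr => n _.
  rewrite /dotn -RintegralD//; [|exact: L2M|exact: L2M].
  by apply: eq_Rintegral => x _; rewrite /re_fun ReE.
- rewrite /dotr -limB; [|exact: dot_cvg|exact: dot_cvg]; congr (limn _); apply/funext => M.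
  rewrite /series /= fctE -sumrB/=; apply: eq_bigr => n _.
  rewrite /dotn -RintegralB//; [|exact: L2M|exact: L2M].
  by apply: eq_Rintegral => x _; rewrite /im_fun ImE.
Qed.

Lemma actE U n x : act U n x = - deriv2 (U n) x + (kap n)%:C * U n x.
Proof.
rewrite /act /opL /kap rmorphD/= fmorphV/= !rmorph_nat; ring.
Qed.

End Components.

(** * The inclusions between the operators and the conclusion *)

Section SelfAdjointness.
Local Open Scope complex_scope.
Context {R : realType}.
Local Notation mu := (@lebesgue_measure R).
Implicit Types (U V F G : nat -> R -> R[i]) (u v f g : nat -> R -> R) (alpha : R).

Lemma act_re_im U n :
  re_fun (act U n) = (fun x => - re_fun (deriv2 (U n)) x + kap n * re_fun (U n) x) /\
  im_fun (act U n) = (fun x => - im_fun (deriv2 (U n)) x + kap n * im_fun (U n) x).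
Proof.
split; apply/funext => x; rewrite /re_fun /im_fun actE.
  by case: (deriv2 _ _) (U n x) => a b [c d] /=; ring.
by case: (deriv2 _ _) (U n x) => a b [c d] /=; ring.
Qed.

Lemma cpx_reim U n x : U n x = reH U n x +i* imH U n x.
Proof. by rewrite /reH /imH /re_fun /im_fun; case: (U n x). Qed.

Lemma inH_cpx u v : inHr u -> inHr v -> inH (cpx u v).
Proof. by move=> uH vH; apply/inHP; split. Qed.

Lemma Dom_rA alpha U : Dom alpha U -> rA (coupling alpha) (reH U) (reH (act U)) /\
  rA (coupling alpha) (imH U) (imH (act U)).
Proof.
move=> [UH UW MU actU]; have /inHP[Ur Ui] := UH.
have /choice[wrp /choice[wrm /choice[wip /choice[wim S]]]] := fun n => inW_strong (UW n).
have Sr n := (S n).1; have Si n := (S n).2.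
have actH : inH (act U).
  split => // n; apply/inL2P => //.
  have [-> ->] := act_re_im U n.
  have [ur hr] := strong_L2 (Sr n); have [ui hi] := strong_L2 (Si n).
  by split; apply: L2D => //; [exact: L2N|exact: L2Z|exact: L2N|exact: L2Z].
have /inHP[ar ai] := actH.
have M n := MU n; split; split => //.
- exists wrp, wrm, (fun n => re_fun (deriv2 (U n))); split => // n.
    by move=> x; rewrite /reH; have [-> _] := act_re_im U n.
  have [dp dm] := strong_deriv0 (Sr n) (Si n).
  have := congr1 (@complex.Re R) (MU n); rewrite dp dm /reH /re_fun.
  case: (U n.+1 0) (U n.-1 0) => a b [c d] /=; rewrite !mul0r !subr0; exact.
- exists wip, wim, (fun n => im_fun (deriv2 (U n))); split => // n.
    by move=> x; rewrite /imH; have [_ ->] := act_re_im U n.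
  have [dp dm] := strong_deriv0 (Sr n) (Si n).
  have := congr1 (@complex.Im R) (MU n); rewrite dp dm /imH /im_fun.
  case: (U n.+1 0) (U n.-1 0) => a b [c d] /=; rewrite !mul0r !addr0; exact.
Qed.

(** The second statement can only hold almost everywhere, since [act] contains the chosen weak
    derivatives. *)
Lemma rA_Dom alpha ur fr ui fi : rA (coupling alpha) ur fr -> rA (coupling alpha) ui fi ->
  Dom alpha (cpx ur ui) /\ eqH (cpx fr fi) (act (cpx ur ui)).
Proof.
move=> [[wrp [wrm [hr [Sr fE Mr]]]] urH frH] [[wip [wim [hi [Si gE Mi]]]] uiH fiH].
set U := cpx ur ui; have W n : inW (U n) /\ {ae mu, forall x, deriv2 (U n) x = hr n x +i* hi n x}.
  exact: (strong_inW (U := U n) (Sr n) (Si n)).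
have E : eqH (cpx fr fi) (act U).
  move=> n; move: (W n).2 => /aeS; apply => x Hx.
  by rewrite actE Hx /U /cpx fE gE; apply/eqP; rewrite eq_complex /=; apply/andP; split; apply/eqP; ring.
have actL n : inL2 setT (act U n).
  have [wp [wm [wp' [wm' [T1 T2]]]]] := inW_strong (W n).1.
  apply/inL2P => //; have [-> ->] := act_re_im U n.
  have [u1 h1] := strong_L2 T1; have [u2 h2] := strong_L2 T2.
  by split; apply: L2D => //; [exact: L2N|exact: L2Z|exact: L2N|exact: L2Z].
have actH : inH (act U).
  apply/inHP; split; [apply: (inHr_ae frH)|apply: (inHr_ae fiH)].
  - by move=> n; have /(inL2P _ measurableT)[] := actL n.
  - by move=> n; move: (E n) => /aeS; apply => x; rewrite /reH /re_fun => <-.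
  - by move=> n; have /(inL2P _ measurableT)[] := actL n.
  - by move=> n; move: (E n) => /aeS; apply => x; rewrite /imH /im_fun => <-.
split => //; split; [exact: inH_cpx|by move=> n; have [] := W n| |by case: actH].
move=> n; have [-> ->] := strong_deriv0 (U := U n) (Sr n) (Si n).
apply/eqP; rewrite eq_complex /=; apply/andP; split; apply/eqP; rewrite ?mul0r ?subr0 ?addr0.
  by rewrite -Mr; ring.
by rewrite -Mi; ring.
Qed.

Lemma opAP alpha V G : opA alpha (V, G) <-> [/\ inH V, inH G & exists ur fr ui fi,
  [/\ rA (coupling alpha) ur fr, rA (coupling alpha) ui fi, eqH V (cpx ur ui) & eqH G (cpx fr fi)]].
Proof.
split=> [[/= VH GH [U [D VU GU]]]|[VH GH [ur [fr [ui [fi [Ar Ai Vu Gf]]]]]]]; split => //.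
  have [Ar Ai] := Dom_rA D; exists (reH U), (reH (act U)), (imH U), (imH (act U)); split => //.
    by move=> n; move: (VU n) => /aeS; apply => x ->; exact: cpx_reim.
  by move=> n; move: (GU n) => /aeS; apply => x ->; exact: cpx_reim.
have [D E] := rA_Dom Ar Ai; exists (cpx ur ui); split => // n.
by move: (aeI (Gf n) (E n)) => /aeS; apply => x /= [-> ->].
Qed.

Lemma opA0_opA alpha : opA0 alpha `<=` opA alpha.
Proof. by move=> [V G] [/= VH GH [U [[D _] VU GU]]]; split => //; exists U. Qed.

Lemma opA0_rA0 alpha V G : opA0 alpha (V, G) -> exists ur fr ui fi,
  [/\ rA0 (coupling alpha) ur fr, rA0 (coupling alpha) ui fi, eqH V (cpx ur ui) & eqH G (cpx fr fi)].
Proof.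
move=> [/= VH GH [U [[D [N U0]] VU GU]]].
have [Ar Ai] := Dom_rA D; exists (reH U), (reH (act U)), (imH U), (imH (act U)); split => //.
- by split => //; exists N => n Nn x; rewrite /reH /re_fun U0.
- by split => //; exists N => n Nn x; rewrite /imH /im_fun U0.
- by move=> n; move: (VU n) => /aeS; apply => x ->; exact: cpx_reim.
- by move=> n; move: (GU n) => /aeS; apply => x ->; exact: cpx_reim.
Qed.

Lemma rA0_opA0 alpha ur fr ui fi : rA0 (coupling alpha) ur fr -> rA0 (coupling alpha) ui fi ->
  opA0 alpha (cpx ur ui, cpx fr fi).
Proof.
move=> [Ar [N ur0]] [Ai [M ui0]]; have [D E] := rA_Dom Ar Ai.
have [[_ urH frH] [_ uiH fiH]] := (Ar, Ai).
split; [exact: inH_cpx|exact: inH_cpx|exists (cpx ur ui); split => //].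
- split => //; exists (maxn N M) => n; rewrite geq_max => /andP[Nn Mn] x.
  by rewrite /cpx ur0// ui0.
- by move=> n; apply: aeW => x.
Qed.

(** Serves as the imaginary part of real test elements. *)
Lemma rA0_0 (m0 : R) : rA0 m0 (fun _ _ => 0) (fun _ _ => 0).
Proof.
have := @rA0_finite R m0 (fun _ _ => 0) (fun _ _ => 0) (fun _ _ => 0) (fun _ _ => 0) 0.
have -> : (fun n (x : R) => - 0 + kap n * 0) = (fun _ _ => 0 : R).
  by apply/funext => n; apply/funext => x; rewrite mulr0 oppr0 addr0.
by apply => // n; [exact: strong0|rewrite !mulr0 subrr mulr0 addr0].
Qed.

Lemma dotH_real u V : inHr u -> inH V ->
  dotH (cpx u (fun _ _ => 0)) V = dotr u (reH V) +i* - dotr u (imH V).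
Proof.
move=> uH VH; have UH : inH (cpx u (fun _ _ => 0)) by apply: inH_cpx => //; exact: inHr0.
rewrite dotHE//.
have -> : reH (cpx u (fun _ _ => 0)) = u by [].
have -> : imH (cpx u (fun _ _ => 0)) = fun _ _ => 0 by [].
by rewrite !dot0r addr0 sub0r.
Qed.

Lemma dotHE_ae U V ur ui vr vi : inH U -> inH V -> inHr ur -> inHr ui -> inHr vr -> inHr vi ->
  eqH U (cpx ur ui) -> eqH V (cpx vr vi) ->
  dotH U V = (dotr ur vr + dotr ui vi) +i* (dotr ui vr - dotr ur vi).
Proof.
move=> UH VH urH uiH vrH viH Uu Vv; rewrite dotHE//.
have /inHP[Ur Ui] := UH; have /inHP[Vr Vi] := VH.
have r1 n : {ae mu, forall x, reH U n x = ur n x}.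
  by move: (Uu n) => /aeS; apply => x; rewrite /reH /re_fun => ->.
have i1 n : {ae mu, forall x, imH U n x = ui n x}.
  by move: (Uu n) => /aeS; apply => x; rewrite /imH /im_fun => ->.
have r2 n : {ae mu, forall x, reH V n x = vr n x}.
  by move: (Vv n) => /aeS; apply => x; rewrite /reH /re_fun => ->.
have i2 n : {ae mu, forall x, imH V n x = vi n x}.
  by move: (Vv n) => /aeS; apply => x; rewrite /imH /im_fun => ->.
by rewrite !(dotr_ae Ur urH Vr vrH r1 r2, dotr_ae Ui uiH Vi viH i1 i2,
  dotr_ae Ui uiH Vr vrH i1 r2, dotr_ae Ur urH Vi viH r1 i2).
Qed.

Lemma opA_symmetric alpha U F V G : 0 < coupling alpha -> opA alpha (U, F) -> opA alpha (V, G) ->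
  dotH F V = dotH U G.
Proof.
move=> m0 /opAP[UH FH [ur [fr [ui [fi [A1 A2 E1 E2]]]]]].
move=> /opAP[VH GH [vr [gr [vi [gi [B1 B2 E3 E4]]]]]].
have [[_ urH frH] [_ uiH fiH]] := (A1, A2); have [[_ vrH grH] [_ viH giH]] := (B1, B2).
rewrite (dotHE_ae FH VH frH fiH vrH viH E2 E3) (dotHE_ae UH GH urH uiH grH giH E1 E4).
by rewrite !(rA_symmetric m0 A1 B1, rA_symmetric m0 A1 B2, rA_symmetric m0 A2 B1, rA_symmetric m0 A2 B2).
Qed.

(** Testing with elements whose imaginary part is zero separates the complex adjoint relation into
    one for the real parts and one for the imaginary parts of [V] and [G], to which [rA0_adjoint]
    applies. *)
Lemma adjoint_opA0 alpha : 0 < coupling alpha -> adjoint (opA0 alpha) `<=` opA alpha.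
Proof.
move=> m0 [V G] [/= VH GH H]; have /inHP[Vr Vi] := VH; have /inHP[Gr Gi] := GH.
have Z0 := rA0_0 (coupling alpha).
have real u f : rA0 (coupling alpha) u f ->
    dotr f (reH V) = dotr u (reH G) /\ dotr f (imH V) = dotr u (imH G).
  move=> A; have [[_ uH fH] _] := A; have := H _ _ (rA0_opA0 A Z0).
  by rewrite !dotH_real// => -[-> /oppr_inj ->].
have [vr [gr [Br Er Fr]]] := rA0_adjoint m0 Vr Gr (fun u f A => (real u f A).1).
have [vi [gi [Bi Ei Fi]]] := rA0_adjoint m0 Vi Gi (fun u f A => (real u f A).2).
apply/opAP; split => //; exists vr, gr, vi, gi; split => // n.
  by move: (aeI (Er n) (Ei n)) => /aeS; apply => x [e1 e2]; rewrite cpx_reim e1 e2.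
by move: (aeI (Fr n) (Fi n)) => /aeS; apply => x [e1 e2]; rewrite cpx_reim e1 e2.
Qed.

Lemma opA_closure alpha : 0 < coupling alpha -> opA alpha `<=` op_closure (opA0 alpha).
Proof.
move=> m0 [V G] /opAP[VH GH [vr [gr [vi [gi [Br Bi Ev Eg]]]]]]; split => // e e0 /=.
have /inHP[Vr Vi] := VH; have /inHP[Gr Gi] := GH.
have [[_ vrH grH] [_ viH giH]] := (Br, Bi).
have e4 : 0 < e ^+ 2 / 4 by rewrite divr_gt0// exprn_gt0.
have [ur [fr [Ar ur_ fr_]]] := rA_approximation m0 Br e4.
have [ui [fi [Ai ui_ fi_]]] := rA_approximation m0 Bi e4.
have [[[_ urH frH] _] [[_ uiH fiH] _]] := (Ar, Ai).
have close v v' u : inHr v -> inHr v' -> inHr u -> (forall n, {ae mu, forall x, v' n x = v n x}) ->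
    nHle (subr v u) (e ^+ 2 / 4) -> nHle (subr v' u) (e ^+ 2 / 4).
  move=> vH v'H uH vv; apply: nHle_ae.
  - by have [] := inHr_sub vH uH.
  - by have [] := inHr_sub v'H uH.
  - by move=> n; move: (vv n) => /aeS; apply => x; rewrite /subr => ->.
have re_ae U u v : eqH U (cpx u v) -> forall n, {ae mu, forall x, reH U n x = u n x}.
  by move=> E n; move: (E n) => /aeS; apply => x; rewrite /reH /re_fun => ->.
have im_ae U u v : eqH U (cpx u v) -> forall n, {ae mu, forall x, imH U n x = v n x}.
  by move=> E n; move: (E n) => /aeS; apply => x; rewrite /imH /im_fun => ->.
exists (cpx ur ui), (cpx fr fi); split; first exact: rA0_opA0.
- apply: sqnormH_sub_lt => //; first exact: inH_cpx.
  + exact: (close _ _ _ vrH Vr urH (re_ae _ _ _ Ev) ur_).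
  + exact: (close _ _ _ viH Vi uiH (im_ae _ _ _ Ev) ui_).
- apply: sqnormH_sub_lt => //; first exact: inH_cpx.
  + exact: (close _ _ _ grH Gr frH (re_ae _ _ _ Eg) fr_).
  + exact: (close _ _ _ giH Gi fiH (im_ae _ _ _ Eg) fi_).
Qed.

(** Elements of [opA0] satisfy the adjoint relation by symmetry, and [dotr_closed] carries it to
    their limits. *)
Lemma closure_adjoint alpha : 0 < coupling alpha ->
  op_closure (opA0 alpha) `<=` adjoint (opA0 alpha).
Proof.
move=> m0 [V G] [/= VH GH H]; split => //= U F UF; have UF' := opA0_opA UF.
have /opAP[UH FH _] := UF'.
have [ur [fr [ui [fi [Ar Ai Eu Ef]]]]] := opA0_rA0 UF.
have [[[_ urH frH] _] [[_ uiH fiH] _]] := (Ar, Ai).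
have /inHP[Vr Vi] := VH; have /inHP[Gr Gi] := GH.
have real u f : rA0 (coupling alpha) u f -> 
    dotr f (reH V) = dotr u (reH G) /\ dotr f (imH V) = dotr u (imH G).
  move=> A; have [[_ uH fH] _] := A.
  have approx (b : R) : 0 < b -> exists V' G', [/\ opA0 alpha (V', G'),
      (nHle (subr (reH V) (reH V')) b /\ nHle (subr (imH V) (imH V')) b) &
      (nHle (subr (reH G) (reH G')) b /\ nHle (subr (imH G) (imH G')) b)].
    (* The closure is stated with [e ^+ 2]; being at most 1, this [e] has [e ^+ 2 <= e <= b]. *)
    move=> b0; pose e := Num.min 1 b; have e0 : 0 < e by rewrite lt_min ltr01.
    have eb : e ^+ 2 <= b.
      apply: (@le_trans _ _ e); last by rewrite ge_min lexx orbT.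
      by rewrite expr2; apply: ler_piMr; [exact: ltW|rewrite /e ge_min lexx].
    have [V' [G' [A' Vb Gb]]] := H e e0; have /opAP[V'H G'H _] := opA0_opA A'.
    exists V', G'; split => //.
      by apply: nHle_sqnormH_sub => //; apply: lt_le_trans Vb _; rewrite lee_fin.
    by apply: nHle_sqnormH_sub => //; apply: lt_le_trans Gb _; rewrite lee_fin.
  have sym V' G' : opA0 alpha (V', G') -> dotr f (reH V') = dotr u (reH G') /\
      dotr f (imH V') = dotr u (imH G').
    move=> A'; have VG' := opA0_opA A'; have /opAP[V'H G'H _] := VG'.
    have /inHP[V'r V'i] := V'H; have /inHP[G'r G'i] := G'H.
    have Z0 := rA0_0 (coupling alpha).
    have := opA_symmetric m0 (opA0_opA (rA0_opA0 A Z0)) VG'.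
    by rewrite !dotH_real// => -[-> /oppr_inj ->].
  split; apply: dotr_closed => // b /approx[V' [G' [A' [V'r V'i] [G'r G'i]]]];
    have [e1 e2] := sym _ _ A'; have /opAP[/inHP[? ?] /inHP[? ?] _] := opA0_opA A'.
  - by exists (reH V'), (reH G').
  - by exists (imH V'), (imH G').
have VV : eqH V (cpx (reH V) (imH V)) by move=> n; apply: aeW => x; exact: cpx_reim.
have GG : eqH G (cpx (reH G) (imH G)) by move=> n; apply: aeW => x; exact: cpx_reim.
rewrite (dotHE_ae FH VH frH fiH Vr Vi Ef VV) (dotHE_ae UH GH urH uiH Gr Gi Eu GG).
by have [-> ->] := real _ _ Ar; have [-> ->] := real _ _ Ai.
Qed.

Lemma opA_dense alpha : densely_defined (opA alpha).
Proof.
move=> U UH e e0; have /inHP[Ur Ui] := UH.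
have e4 : 0 < e ^+ 2 / 4 by rewrite divr_gt0// exprn_gt0.
have [vr [fr [Ar vr_]]] := rA0_dense (coupling alpha) Ur e4.
have [vi [fi [Ai vi_]]] := rA0_dense (coupling alpha) Ui e4.
have [[[_ vrH _] _] [[_ viH _] _]] := (Ar, Ai).
exists (cpx vr vi); first by exists (cpx fr fi); apply: opA0_opA; exact: rA0_opA0.
by apply: sqnormH_sub_lt => //; exact: inH_cpx.
Qed.

End SelfAdjointness.

Theorem theorem4p1 (R : realType) (alpha : R) (alpha_gt0 : 0 < alpha) :
  self_adjoint (opA alpha) /\ opA alpha = op_closure (opA0 alpha).
Proof.
have m0 : 0 < coupling alpha by rewrite divr_gt0// sqrtr_gt0 ltr0n.
split; last first.
  (* The reverse inclusion goes through the adjoint of [opA0], which contains the closure and is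
     contained in [opA]. *)
  apply/seteqP; split; first exact: opA_closure.
  by move=> VG /(closure_adjoint m0); exact: adjoint_opA0.
split; first exact: opA_dense.
(* The adjoint reverses inclusions: an element of the adjoint of [opA] is in that of the smaller
   [opA0], hence in [opA]. The converse is symmetry. *)
apply/seteqP; split=> [[V G] [/= VH GH H]|[V G] A].
  apply: (adjoint_opA0 m0); split; [exact: VH|exact: GH|move=> U F UF].
  by apply: H; exact: opA0_opA.
have /opAP[VH GH _] := A; split; [exact: VH|exact: GH|move=> U F UF].
exact: opA_symmetric m0 UF A.
Qed.
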